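(* Assume that the communication graph is undirected and connected with symmetric, nonnegative, doubly stochastic weight matrix $W$, that each $f_i$ is $L$-smooth, that the Riemannian gradient samples are unbiased with variance bounded by $\sigma^2$, and that they are uniformly bounded in norm by $A_1$ (all as detailed in the context). Consider Algorithm 1 (described in the context) with $\mathbf{X}_0\in\mathcal{S}$ and $t\ge\lceil\log_{\sigma_2}(\frac{1}{2\sqrt N})\rceil$. Suppose that $\alpha>0$ satisfies $\alpha\le\min\{1,\frac1M,\frac{\Phi}{L_t}\}$ and that $\beta>0$ satisfies $$\beta\le\min\Big\{\bar\beta,\ \frac{1}{9L_G},\ \frac{1}{4[\alpha\delta_1L_G(16\Gamma_0+\Gamma_2)+2C_1]}\Big\},\qquad \bar\beta:=\min\Big\{\frac{(1-\rho_t)\delta_1}{10A+L_G},\frac{\alpha\delta_1}{5(10A+L_G)}\Big\}.$$ Then for every $K\ge0$: (i) If $N_k=\lceil q^{-k}\rceil$ with $q\in(0,1)$, then $$\min_{k=0,\dots,K}E[\|\mathrm{grad}f(\hat X_k)\|_F^2]\le\frac{(16+\Gamma_0\alpha^2\delta_1^2)\Big[f(\hat X_0)-f^*+\tilde\Gamma_3+\frac{\sigma^2(2\beta\Gamma_2(1+q)+\tilde D_3)}{1-q}\Big]+\tilde\Gamma_1}{\beta(K+1)}.$$ (ii) If $N_k=\lceil(k+1)^a\rceil$ with $a>0$, then for $a=1$ $$\min_{k=0,\dots,K}E[\|\mathrm{grad}f(\hat X_k)\|_F^2]\le\frac{\tilde\Gamma_1+(16+\Gamma_0\alpha^2\delta_1^2)\big[f(\hat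 X_0)-f^*+\tilde\Gamma_3+2\sigma^2(4\beta\Gamma_2+\tilde D_3)(\ln(K+1)+1)\big]}{\beta(K+1)};$$ for $a<1$ $$\min_{k=0,\dots,K}E[\|\mathrm{grad}f(\hat X_k)\|_F^2]\le\frac{\sigma^2(16+\Gamma_0\alpha^2\delta_1^2)(6\Gamma_2+\tilde D_3)}{\beta(1-a)(K+1)^a}+\frac{(16+\Gamma_0\alpha^2\delta_1^2)[f(\hat X_0)-f^*+\tilde\Gamma_3]+\tilde\Gamma_1}{\beta(K+1)};$$ and for $a>1$ $$\min_{k=0,\dots,K}E[\|\mathrm{grad}f(\hat X_k)\|_F^2]\le\frac{\sigma^2(16+\Gamma_0\alpha^2\delta_1^2)(3\Gamma_2a+\Gamma_2+\frac{a\tilde D_3}{\beta})}{(a-1)(K+1)}+\frac{(16+\Gamma_0\alpha^2\delta_1^2)[f(\hat X_0)-f^*+\tilde\Gamma_3]+\tilde\Gamma_1}{\beta(K+1)}.$$ (iii) If $N_k=Q$ for all $k$, where $Q>0$ is a constant (integer), then $$\min_{k=0,\dots,K}E[\|\mathrm{grad}f(\hat X_k)\|_F^2]\le(16+\Gamma_0\alpha^2\delta_1^2)\frac{\sigma^2(4\beta\Gamma_2+\tilde D_3)}{\beta Q}+\frac{\tilde\Gamma_1+(16+\Gamma_0\alpha^2\delta_1^2)[f(\hat X_0)-f^*+\tilde\Gamma_3]}{\beta(K+1)}.$$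
   Context: Manifold. $\mathcal{M}=\mathrm{St}(n,r)=\{X\in\mathbb{R}^{n\times r}:X^\top X=I_r\}$ with tangent space $T_X\mathcal{M}=\{u\in\mathbb{R}^{n\times r}:X^\top u+u^\top X=0\}$, inner product $\langle u,v\rangle=\mathrm{tr}(u^\top v)$, and orthogonal projection $\mathcal{P}_{T_X\mathcal{M}}(Y)=Y-\frac12X(X^\top Y+Y^\top X)$. For differentiable $\phi$, $\mathrm{grad}\,\phi(X)=\mathcal{P}_{T_X\mathcal{M}}(\nabla\phi(X))$. The polar retraction is $\mathcal{R}_X(v)=(X+v)(I_r+v^\top v)^{-1/2}$, $v\in T_X\mathcal{M}$, and $M>0$ is a constant with $\|\mathcal{R}_X(v)-(X+v)\|_F\le M\|v\|_F^2$ for all $X\in\mathrm{St}(n,r)$, $v\in T_X\mathcal{M}$. For $\mathbf{X}=[X_1^\top,\dots,X_N^\top]^\top\in\mathrm{St}(n,r)^N$ the induced arithmetic mean (IAM) is $\hat X\in\arg\min_{Y\in\mathrm{St}(n,r)}\sum_{i=1}^N\|Y-X_i\|_F^2$, and $\hat{\mathbf{X}}=(\mathbf{1}_N\otimes I_n)\hat X$. $\hat X_k$, $\hat{\mathbf{X}}_k$ are those of $\mathbf{X}_k$. Problem. $N$ agents, $\mathcal{N}=\{1,\dots,N\}$, minimize $f=\frac1N\sum_{i=1}^Nf_i$ over $\mathrm{St}(n,r)$, where $f_i(X)=\mathbb{E}_{\xi_i}F_i(X,\xi_i)$; $f^*=\min_{X\in\mathrm{St}(n,r)}f(X)$. Each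 $f_i$ is differentiable on $\mathbb{R}^{n\times r}$ with $\|\nabla f_i(X)-\nabla f_i(Y)\|_F\le L\|X-Y\|_F$. Put $L_n=\max_{i}\max_{X\in\mathrm{St}(n,r)}\|\nabla f_i(X)\|_2$ and $L_G=L+2L_n$. Network. The graph $\mathcal{G}=(\mathcal{N},\mathcal{E})$ is undirected and connected; $W=(w_{ij})\in\mathbb{R}^{N\times N}$ has $w_{ij}>0$ if $(i,j)\in\mathcal{E}$ or $i=j$, $w_{ij}=0$ otherwise, $W=W^\top$, $W\mathbf{1}_N=\mathbf{1}_N$. $W^t_{ij}$ is the $(i,j)$ entry of $W^t$; $\sigma_2\in[0,1)$ is the second largest singular value of $W$; $L_t=1-\sigma_N(W^t)\in(0,2]$ with $\sigma_N(W^t)$ the smallest eigenvalue of $W^t$. (If $\sigma_2=0$ the condition on $t$ is just $t\ge1$.) Local region. $\delta_1,\delta_2>0$ are given constants with $\delta_1\le\frac{1}{5\sqrt r}\delta_2$, $\delta_2\le\frac16$, and $\mathcal{S}$ is the set of $\mathbf{X}\in\mathrm{St}(n,r)^N$ with $\|\mathbf{X}-\hat{\mathbf{X}}\|_F^2\le N\delta_1^2$ and $\max_i\|X_i-\hat X\|_F\le\delta_2$. $\Phi$ is a constant with $1\le\Phi\le 2-\max_i\|X_i-\hat X\|_F^2$ for all $\mathbf{X}\in\mathcal{S}$ (e.g. $\Phi=2-\delta_2^2$). Stochastic oracle. $G_i(X,\xi_i)\in T_X\mathcal{M}$ satisfies, for all $i$ and $X\in\mathrm{St}(n,r)$: $E_{\xi_i}[G_i(X,\xi_i)]=\mathrm{grad}f_i(X)$,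 $E_{\xi_i}[\|G_i(X,\xi_i)-\mathrm{grad}f_i(X)\|_F^2]\le\sigma^2$, and $\|G_i(X,\xi_i)\|_F\le A_1$ for all $\xi_i$ in the support. $A_2$ is a constant with $\max_{X\in\mathrm{St}(n,r)}\|\nabla f_i(X)\|_F\le A_2$ for all $i$; $A=\max\{A_1,A_2\}$. Algorithm 1. Sample sizes $N_k$ are positive integers; $F_i(X_{i,k}):=\frac{1}{N_k}\sum_{j=1}^{N_k}G_i(X_{i,k},\xi_{i,k}^{[j]})$, where $\xi_{i,k}^{[j]}$, $j=1,\dots,N_k$, are i.i.d. realizations of $\xi_i$ drawn independently of the past. Given a (deterministic) $\mathbf{X}_0\in\mathcal{S}$, $Y_{i,0}=F_i(X_{i,0})$, and integer $t\ge1$, for $k=0,1,\dots$ and all $i$: $v_{i,k}=\mathcal{P}_{T_{X_{i,k}}\mathcal{M}}Y_{i,k}$; $X_{i,k+1}=\mathcal{R}_{X_{i,k}}\big(\alpha\mathcal{P}_{T_{X_{i,k}}\mathcal{M}}[\sum_{j=1}^NW_{ij}^tX_{j,k}]-\beta v_{i,k}\big)$; $Y_{i,k+1}=\sum_{j=1}^NW_{ij}^tY_{j,k}+F_i(X_{i,k+1})-F_i(X_{i,k})$. Stack $\mathbf{X}_k=[X_{1,k}^\top,\dots,X_{N,k}^\top]^\top$, $\mathbf{Y}_k=[Y_{1,k}^\top,\dots,Y_{N,k}^\top]^\top$; $\bar F_k=\frac1N\sum_iF_i(X_{i,k})$, $\bar{\mathbf{F}}_k=(\mathbf{1}_N\otimes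 I_n)\bar F_k$. Constants. $\rho_t=\sqrt{1-(\alpha L_t\Phi-\alpha^2L_t^2)}$; $\Gamma_0=\frac{2}{(1-\rho_t)^2}$; $\Gamma_1=\frac{2}{1-\rho_t^2}\|\mathbf{X}_0-\hat{\mathbf{X}}_0\|_F^2$; $\Gamma_2=\frac{2}{(1-\sigma_2^t)^2}$; $\Gamma_3=\frac{2}{1-\sigma_2^{2t}}\cdot\frac1N E\|\mathbf{Y}_0-\bar{\mathbf{F}}_0\|_F^2$; $D_1=(\delta_1^2+5)L_G+2MA$; $D_4=\frac{4r\delta_1^2}{\beta^2L_G}$; $D_2=3L_G+2\alpha A+13L_G\tilde C\alpha^2+D_4$ with $\tilde C=\frac{\delta_2^2}{r}$; $D_3=\frac{1+4L_G^2\beta^2}{2L_G}$; $\tilde D_3=D_3+\frac{5\beta}{8}$; $C_0=\frac{D_4\Gamma_0\alpha^2\delta_1^2}{25}+\Gamma_1(D_2+D_4)$; $C_1=D_2\Gamma_0+D_4\Gamma_0+D_1$; $\tilde\Gamma_1=2L_G^2\beta\Gamma_1$; $\tilde\Gamma_3=C_0+\frac\beta2(\Gamma_3+16\alpha^2L_G^2\Gamma_2\Gamma_1)$. (The condition on $\beta$ is to be read as an inequality on $\beta$, since $C_1$ itself depends on $\beta$.) *)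

(* Defs.v *)
From HB Require Import structures.
From mathcomp Require Import all_boot all_order all_algebra.
From mathcomp Require Import all_classical all_reals all_analysis.
Set Implicit Arguments.
Unset Strict Implicit.
Unset Printing Implicit Defensive.
Import Order.TTheory GRing.Theory Num.Theory.
Import numFieldNormedType.Exports.
Local Open Scope classical_set_scope.
Local Open Scope ring_scope.

Section MatrixAnalysis.
Context {R : realType}.

Definition frob m p (A : 'M[R]_(m, p)) : R := Num.sqrt (\tr (A^T *m A)).

(* Operator norm induced by the Euclidean norms, i.e. the matrix 2-norm. *)
Definition spectral_norm m p (A : 'M[R]_(m, p)) : R :=
  sup [set frob (A *m u) | u in [set u : 'cV[R]_p | frob u = 1]].

(* Real eigenvalues with multiplicity, in nonincreasing order; a sequence of
   length m whenever the characteristic polynomial splits over R, in particular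
   for symmetric A (the only case used), and [::] otherwise. *)
Definition spectrum m (A : 'M[R]_m) : seq R :=
  xget [::] [set s : seq R | sorted >=%R s
                           /\ char_poly A = \prod_(x <- s) ('X - x%:P)].

Definition singular_values m p (A : 'M[R]_(m, p)) : seq R :=
  [seq Num.sqrt x | x <- spectrum (A^T *m A)].

(* The symmetric positive semidefinite square root (unique when A is itself
   symmetric positive semidefinite). *)
Definition sqrtmx m (A : 'M[R]_m) : 'M[R]_m :=
  xget 0 [set S : 'M[R]_m | [/\ S^T = S,
    forall u : 'cV[R]_m, 0 <= (u^T *m S *m u) 0 0 & S *m S = A]].

(* Euclidean gradient: the matrix of partial derivatives. *)
Definition grad n r (phi : 'M[R]_(n, r) -> R) (X : 'M[R]_(n, r)) :
    'M[R]_(n, r) :=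
  \matrix_(a, b) 'D_(delta_mx a b) phi X.

End MatrixAnalysis.

Section Stiefel.
Context {R : realType} {n r : nat}.
Implicit Types X u v Y : 'M[R]_(n, r).

Definition stiefel : set 'M[R]_(n, r) := [set X | X^T *m X = 1%:M].

Definition tangent X : set 'M[R]_(n, r) := [set u | X^T *m u + u^T *m X = 0].

Definition proj_tangent X Y : 'M[R]_(n, r) :=
  Y - 2^-1 *: (X *m (X^T *m Y + Y^T *m X)).

Definition rgrad (phi : 'M[R]_(n, r) -> R) X : 'M[R]_(n, r) :=
  proj_tangent X (grad phi X).

Definition polar_retraction X v : 'M[R]_(n, r) :=
  (X + v) *m invmx (sqrtmx (1%:M + v^T *m v)).

End Stiefel.

Section Agents.
Context {R : realType} {n r N : nat}.

(* An N-tuple of n x r matrices stands for the vertically stacked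
   (N n) x r matrix; this is the squared Frobenius norm of the latter. *)
Definition stack_frob2 (X : 'I_N -> 'M[R]_(n, r)) : R :=
  \sum_i frob (X i) ^+ 2.

Definition avg (X : 'I_N -> 'M[R]_(n, r)) : 'M[R]_(n, r) :=
  N%:R^-1 *: \sum_i X i.

Definition is_iam (X : 'I_N -> 'M[R]_(n, r)) (Xhat : 'M[R]_(n, r)) : Prop :=
  stiefel Xhat /\
  forall Y, stiefel Y ->
    \sum_i frob (Xhat - X i) ^+ 2 <= \sum_i frob (Y - X i) ^+ 2.

Definition local_region (hat : ('I_N -> 'M[R]_(n, r)) -> 'M[R]_(n, r))
    (delta1 delta2 : R) : set ('I_N -> 'M[R]_(n, r)) :=
  [set X | [/\ forall i, stiefel (X i),
    stack_frob2 (fun i => X i - hat X) <= N%:R * delta1 ^+ 2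
    & forall i, frob (X i - hat X) <= delta2]].

Definition mixing_matrix (e : rel 'I_N) (W : 'M[R]_N) : Prop :=
  [/\ forall i j, e i j || (i == j) -> 0 < W i j,
      forall i j, ~~ (e i j || (i == j)) -> W i j = 0,
      W^T = W & W *m const_mx 1 = const_mx 1 :> 'cV[R]_N].

Definition avg_obj (f : 'I_N -> 'M[R]_(n, r) -> R) (X : 'M[R]_(n, r)) : R :=
  N%:R^-1 * \sum_i f i X.

Definition max_grad_norm (f : 'I_N -> 'M[R]_(n, r) -> R) : R :=
  sup [set s | exists i X, stiefel X /\ s = spectral_norm (grad (f i) X)].

End Agents.

Section Stochastic.
Context {R : realType} {n r N : nat} {dX : measure_display}
  {Xi : 'I_N -> measurableType dX}.

(* Coordinate cylinders; they generate the Borel sigma-algebra of R^(n x r). *)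
Definition mx_cylinder : set (set 'M[R]_(n, r)) :=
  [set E | exists a b (B : set R),
    measurable B /\ E = [set X : 'M[R]_(n, r) | B (X a b)]].

Definition borel_mx : Type := g_sigma_algebraType mx_cylinder.

Definition jointly_measurable i (g : 'M[R]_(n, r) -> Xi i -> 'M[R]_(n, r)) :=
  forall a b, measurable_fun ((stiefel : set borel_mx) `*` [set: Xi i])
    (fun p : borel_mx * Xi i => g p.1 p.2 a b).

(* The distribution of xi_i is mu i on the sample space Xi i. *)
Definition local_obj (mu : forall i, probability (Xi i) R)
    (F : forall i, 'M[R]_(n, r) -> Xi i -> R) i (X : 'M[R]_(n, r)) : R :=
  fine ('E_(mu i)[F i X])%E.

(* "For all xi_i in the support" is read as "for mu i-almost every xi_i". *)
Definition stochastic_oracle (mu : forall i, probability (Xi i) R)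
    (f : 'I_N -> 'M[R]_(n, r) -> R)
    (G : forall i, 'M[R]_(n, r) -> Xi i -> 'M[R]_(n, r)) (sigma A1 : R) i :=
  [/\ jointly_measurable (G i),
      {ae mu i, forall z, forall X, stiefel X ->
        tangent X (G i X z) /\ frob (G i X z) <= A1},
      forall X, stiefel X -> forall a b,
        ('E_(mu i)[fun z => G i X z a b] = (rgrad (f i) X a b)%:E)%E
    & forall X, stiefel X ->
        ('E_(mu i)[fun z => frob (G i X z - rgrad (f i) X) ^+ 2]%R
           <= (sigma ^+ 2)%:E)%E].

Context {dO : measure_display} {Omega : measurableType dO}.

(* xi i k j is the j-th sample (j < Nk k) drawn by agent i at iteration k. *)
Implicit Types (xi : forall i : 'I_N, nat -> nat -> Omega -> Xi i)
  (Nk : nat -> nat).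

Definition past Nk xi (k : nat) : set (set Omega) :=
  <<s [set E | exists i l j (B : set (Xi i)),
       [/\ (l < k)%N, (j < Nk l)%N, measurable B & E = xi i l j @^-1` B]] >>.

(* Within each batch (i, k) the samples are i.i.d. with law mu i, and the batch
   is independent of the sigma-algebra generated by all earlier samples of all
   agents.  Nothing is assumed on the joint law of the batches of distinct
   agents at the same iteration. *)
Definition iid_sampling (P : probability Omega R)
    (mu : forall i, probability (Xi i) R) Nk xi : Prop :=
  forall i k,
  [/\ forall j, (j < Nk k)%N -> measurable_fun [set: Omega] (xi i k j),
      forall j, (j < Nk k)%N -> forall B, measurable B ->
        P (xi i k j @^-1` B) = mu i B,
      forall B : nat -> set (Xi i), (forall j, measurable (B j)) ->
        P (\bigcap_(j < Nk k) (xi i k j @^-1` B j))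
        = (\prod_(j < Nk k) P (xi i k j @^-1` B j))%E
    & forall (E : set Omega) (B : nat -> set (Xi i)),
        past Nk xi k E -> (forall j, measurable (B j)) ->
        P (E `&` \bigcap_(j < Nk k) (xi i k j @^-1` B j))
        = (P E * P (\bigcap_(j < Nk k) (xi i k j @^-1` B j)))%E].

(* The sample average F_i(X_{i,k}); the same realisation enters every
   occurrence of F_i(X_{i,k}) in the algorithm. *)
Definition batch_grad (G : forall i, 'M[R]_(n, r) -> Xi i -> 'M[R]_(n, r))
    Nk xi (X : nat -> Omega -> 'I_N -> 'M[R]_(n, r)) (k : nat) (w : Omega)
    (i : 'I_N) : 'M[R]_(n, r) :=
  (Nk k)%:R^-1 *: \sum_(j < Nk k) G i (X k w i) (xi i k j w).

Definition algorithm1 (W : 'M[R]_N) (t : nat) (alpha beta : R)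
    (G : forall i, 'M[R]_(n, r) -> Xi i -> 'M[R]_(n, r)) Nk xi
    (X0 : 'I_N -> 'M[R]_(n, r))
    (X Y : nat -> Omega -> 'I_N -> 'M[R]_(n, r)) : Prop :=
  let F := batch_grad G Nk xi X in
  forall w i,
  [/\ X 0 w i = X0 i,
      Y 0 w i = F 0 w i,
      forall k, X k.+1 w i =
        polar_retraction (X k w i)
          (alpha *: proj_tangent (X k w i) (\sum_j (W ^+ t) i j *: X k w j)
           - beta *: proj_tangent (X k w i) (Y k w i))
    & forall k, Y k.+1 w i =
        \sum_j (W ^+ t) i j *: Y k w j + F k.+1 w i - F k w i].

End Stochastic.

(* Main.v *)
(* Along almost every sample path the run is a deterministic perturbed gradient
   tracking scheme with bounded data, and three quantities are followed: the
   consensus error S_k (mean squared distance of the X_{i,k} to their induced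
   arithmetic mean), the tracking error T_k (mean squared distance of the Y_{i,k}
   to the average sampled gradient) and the objective at the mean.  The projected
   averaging step contracts S_k, because the normal component of an average of
   points of the manifold is quadratic in their distances; mixing contracts T_k by
   the factor sigma_2^(2t) <= 1/8; and the polar retraction is the metric
   projection, hence cannot increase distances to points of the manifold.  The
   averaged motion of the mean is -beta times the mean tracked direction up to
   quadratic errors, since the mean of the X_{i,k} and its projection differ by a
   normal vector of size S_k/2.  Eliminating S and T from the descent inequality
   gives a pathwise bound of beta * sum_k |grad f(mean_k)|^2 by the initial gap, the
   initial errors and 20 beta times the accumulated sampling noise.

   The sampling noise at step k has expectation at most sigma^2/N_k: the iterate is
   measurable with respect to the past, so that jointly with a fresh sample it has a
   product law, and distinct samples of a batch give uncorrelated errors.  The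
   selection of the mean need not be measurable, so expectations of the gradients at
   the mean are lower integrals; these are superadditive and monotone, which is all
   that is needed.  The four rates follow by summing 1/N_k. *)
Require Import Defs.
From HB Require Import structures.
From mathcomp Require Import all_boot all_order all_algebra.
From mathcomp Require Import fingroup perm complex.
From mathcomp Require Import all_classical all_reals all_analysis.
From mathcomp Require Import measurable_realfun.
From mathcomp Require Import ring lra.
Set Implicit Arguments.
Unset Strict Implicit.
Unset Printing Implicit Defensive.
Import Order.TTheory GRing.Theory Num.Theory.
Import numFieldNormedType.Exports.
Local Open Scope classical_set_scope.
Local Open Scope ring_scope.


(** * The Frobenius inner product *)

Section FrobeniusInnerProduct.
Context {R : realType}.

(** Nothing closes without a separation of scales, and it is hidden in the third bound on [beta].
    That bound involves [C1], which contains [D4], and [D4] has [beta ^+ 2 * LG] in its denominator;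
    solved for [delta1] it says [32 * delta1 ^+ 2 <= alpha ^+ 2 * (beta * LG)]. Together with
    [betabar], which bounds [beta * LG] by [alpha * delta1 / 5], this forces
    [160 * delta1 <= alpha ^+ 3] and [800 * (beta * LG) <= alpha ^+ 4], so all error terms are
    absorbed with numerical constants. The condition on [t] is used as [N * s2 ^+ (2 * t) <= 1 / 4].
    The factor [N] pays for bounding one agent by the whole stack: this keeps every agent within
    [delta2] of the mean and every [Y i] within [9 * A]. Invariance of the local region is thus
    proved along each path, not assumed. The argument has its own small constants, and those of the
    theorem are recovered by comparison at the end: [20 * beta <= 1 / (2 * LG) <= D3t] for the
    noise, [3 * LG * Gamma1 <= C0] for the consensus error and [2 * T0 <= Gamma3] for the tracking
    error. *)

Definition dotm m p (A B : 'M[R]_(m, p)) : R := \tr (A^T *m B).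

Lemma dotmE m p (A B : 'M[R]_(m, p)) : dotm A B = \sum_i \sum_j A i j * B i j.
Proof.
rewrite /dotm /mxtrace exchange_big/=; apply: eq_bigr => j _.
by rewrite mxE; apply: eq_bigr => i _; rewrite mxE.
Qed.

Lemma dotmC m p (A B : 'M[R]_(m, p)) : dotm A B = dotm B A.
Proof. by rewrite /dotm -mxtrace_tr trmx_mul trmxK. Qed.

Lemma dotmDr m p (A B C : 'M[R]_(m, p)) : dotm A (B + C) = dotm A B + dotm A C.
Proof. by rewrite /dotm mulmxDr mxtraceD. Qed.

Lemma dotmDl m p (A B C : 'M[R]_(m, p)) : dotm (A + B) C = dotm A C + dotm B C.
Proof. by rewrite dotmC dotmDr !(dotmC C). Qed.

Lemma dotmZr m p c (A B : 'M[R]_(m, p)) : dotm A (c *: B) = c * dotm A B.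
Proof. by rewrite /dotm -scalemxAr mxtraceZ. Qed.

Lemma dotmZl m p c (A B : 'M[R]_(m, p)) : dotm (c *: A) B = c * dotm A B.
Proof. by rewrite dotmC dotmZr dotmC. Qed.

Lemma dotmNr m p (A B : 'M[R]_(m, p)) : dotm A (- B) = - dotm A B.
Proof. by rewrite -scaleN1r dotmZr mulN1r. Qed.

Lemma dotmNl m p (A B : 'M[R]_(m, p)) : dotm (- A) B = - dotm A B.
Proof. by rewrite dotmC dotmNr dotmC. Qed.

Lemma dotm0r m p (A : 'M[R]_(m, p)) : dotm A 0 = 0.
Proof. by rewrite /dotm mulmx0 mxtrace0. Qed.

Lemma dotm0l m p (A : 'M[R]_(m, p)) : dotm 0 A = 0.
Proof. by rewrite dotmC dotm0r. Qed.

Lemma dotm_sumr m p I (s : seq I) (P : pred I) (A : 'M[R]_(m, p)) (B : I -> _) :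
  dotm A (\sum_(i <- s | P i) B i) = \sum_(i <- s | P i) dotm A (B i).
Proof. by apply: (big_morph (dotm A)); [exact: dotmDr | exact: dotm0r]. Qed.

Lemma dotm_suml m p I (s : seq I) (P : pred I) (A : 'M[R]_(m, p)) (B : I -> _) :
  dotm (\sum_(i <- s | P i) B i) A = \sum_(i <- s | P i) dotm (B i) A.
Proof. by rewrite dotmC dotm_sumr; apply: eq_bigr => i _; rewrite dotmC. Qed.

Definition dotm_lin := (dotmDl, dotmDr, dotmNl, dotmNr, dotmZl, dotmZr).

Lemma dotm_ge0 m p (A : 'M[R]_(m, p)) : 0 <= dotm A A.
Proof.
by rewrite dotmE; do 2!apply: sumr_ge0 => ? _; rewrite -expr2 sqr_ge0.
Qed.

Lemma frob_sqr m p (A : 'M[R]_(m, p)) : frob A ^+ 2 = dotm A A.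
Proof. by rewrite sqr_sqrtr ?dotm_ge0. Qed.

Lemma frob_ge0 m p (A : 'M[R]_(m, p)) : 0 <= frob A.
Proof. exact: sqrtr_ge0. Qed.

Lemma dotm_eq0 m p (A : 'M[R]_(m, p)) : (dotm A A == 0) = (A == 0).
Proof.
apply/eqP/eqP => [|->]; last by rewrite dotm0r.
rewrite dotmE => /eqP; rewrite psumr_eq0 => [|i _]; last first.
  by apply: sumr_ge0 => j _; rewrite -expr2 sqr_ge0.
move=> /allP h; apply/matrixP => i j; rewrite mxE.
have := h i (mem_index_enum _); rewrite psumr_eq0 => [|k _]; last first.
  by rewrite -expr2 sqr_ge0.
by move=> /allP /(_ j (mem_index_enum _)); rewrite -expr2 sqrf_eq0 => /eqP.
Qed.

Lemma frob_eq0 m p (A : 'M[R]_(m, p)) : (frob A == 0) = (A == 0).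
Proof. by rewrite -sqrf_eq0 frob_sqr dotm_eq0. Qed.

Lemma frob0 m p : frob (0 : 'M[R]_(m, p)) = 0.
Proof. by apply/eqP; rewrite frob_eq0. Qed.

Lemma frobT m p (A : 'M[R]_(m, p)) : frob A^T = frob A.
Proof. by rewrite /frob trmxK mxtrace_mulC. Qed.

Lemma frobZ m p c (A : 'M[R]_(m, p)) : frob (c *: A) = `|c| * frob A.
Proof.
apply/eqP; rewrite -(eqrXn2 (n := 2))//; last 2 first.
- exact: frob_ge0.
- by rewrite mulr_ge0 ?frob_ge0.
by rewrite exprMn !frob_sqr !dotm_lin real_normK ?num_real// expr2 mulrA.
Qed.

Lemma frobN m p (A : 'M[R]_(m, p)) : frob (- A) = frob A.
Proof. by rewrite -scaleN1r frobZ normrN1 mul1r. Qed.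

Lemma frobBC m p (A B : 'M[R]_(m, p)) : frob (A - B) = frob (B - A).
Proof. by rewrite -frobN opprB. Qed.

Lemma dotm_young m p (A B : 'M[R]_(m, p)) :
  2 * dotm A B <= dotm A A + dotm B B.
Proof.
have := dotm_ge0 (A - B).
by rewrite !dotm_lin (dotmC B A); lra.
Qed.

Lemma cauchy_schwarz m p (A B : 'M[R]_(m, p)) : dotm A B <= frob A * frob B.
Proof.
have [->|A0] := eqVneq A 0; first by rewrite dotm0l frob0 mul0r.
have [->|B0] := eqVneq B 0; first by rewrite dotm0r frob0 mulr0.
have fA : 0 < frob A by rewrite lt_def frob_ge0 frob_eq0 A0.
have fB : 0 < frob B by rewrite lt_def frob_ge0 frob_eq0 B0.
have := dotm_young ((frob A)^-1 *: A) ((frob B)^-1 *: B).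
rewrite !dotm_lin -!frob_sqr !expr2 !mulKf ?gt_eqF// !mulVf ?gt_eqF// => h.
have : (frob A)^-1 * ((frob B)^-1 * dotm A B) <= 1 by lra.
by rewrite ler_pdivrMl// ler_pdivrMl// mulr1 mulrC.
Qed.

Lemma cauchy_schwarz_abs m p (A B : 'M[R]_(m, p)) :
  `|dotm A B| <= frob A * frob B.
Proof.
rewrite ler_norml cauchy_schwarz andbT lerNl -dotmNl.
by rewrite (le_trans (cauchy_schwarz _ _))// frobN.
Qed.

Lemma frobD m p (A B : 'M[R]_(m, p)) : frob (A + B) <= frob A + frob B.
Proof.
rewrite -(@ler_pXn2r _ 2) ?nnegrE ?addr_ge0 ?frob_ge0//.
rewrite sqrrD !frob_sqr !dotm_lin (dotmC B A) -mulr_natl.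
by have := cauchy_schwarz A B; lra.
Qed.

Lemma frobB m p (A B : 'M[R]_(m, p)) : frob (A - B) <= frob A + frob B.
Proof. by rewrite (le_trans (frobD _ _))// frobN. Qed.

Lemma frob_sum m p I (s : seq I) (P : pred I) (B : I -> 'M[R]_(m, p)) :
  frob (\sum_(i <- s | P i) B i) <= \sum_(i <- s | P i) frob (B i).
Proof.
elim/big_ind2 : _ => [|A a C c hA hC|//]; first by rewrite frob0.
by rewrite (le_trans (frobD _ _))// lerD.
Qed.

Lemma frob_sqrD2 m p (A B : 'M[R]_(m, p)) :
  frob (A + B) ^+ 2 <= 2 * frob A ^+ 2 + 2 * frob B ^+ 2.
Proof.
rewrite !frob_sqr; have := dotm_young A B.
by rewrite !dotm_lin (dotmC B A); lra.
Qed.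

Lemma frob_col_sqr m p (A : 'M[R]_(m, p)) :
  frob A ^+ 2 = \sum_j frob (col j A) ^+ 2.
Proof.
rewrite frob_sqr dotmE exchange_big/=; apply: eq_bigr => j _.
rewrite frob_sqr dotmE; apply: eq_bigr => i _.
by rewrite big_ord1 !mxE.
Qed.

Lemma frob_row_sqr m p (A : 'M[R]_(m, p)) :
  frob A ^+ 2 = \sum_i frob (row i A) ^+ 2.
Proof.
rewrite frob_sqr dotmE; apply: eq_bigr => i _.
rewrite frob_sqr dotmE big_ord1; apply: eq_bigr => j _.
by rewrite !mxE.
Qed.

Lemma mulmx_dotm m p q (A : 'M[R]_(m, p)) (B : 'M[R]_(p, q)) i j :
  (A *m B) i j = dotm (row i A)^T (col j B).
Proof.
rewrite mxE dotmE; apply: eq_bigr => k _.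
by rewrite big_ord1 !mxE.
Qed.

Lemma frobM m p q (A : 'M[R]_(m, p)) (B : 'M[R]_(p, q)) :
  frob (A *m B) <= frob A * frob B.
Proof.
rewrite -(@ler_pXn2r _ 2) ?nnegrE ?mulr_ge0 ?frob_ge0//.
rewrite exprMn (frob_row_sqr A) (frob_col_sqr B) frob_sqr dotmE mulr_suml.
apply: ler_sum => i _; rewrite mulr_sumr; apply: ler_sum => j _.
rewrite mulmx_dotm -expr2 -real_normK ?num_real// -exprMn -(frobT (row i A)).
by rewrite ler_pXn2r ?nnegrE ?mulr_ge0 ?frob_ge0 ?cauchy_schwarz_abs.
Qed.

Lemma dotm_mull m p q (A : 'M[R]_(m, p)) (B : 'M[R]_(p, q)) C :
  dotm (A *m B) C = dotm B (A^T *m C).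
Proof. by rewrite /dotm trmx_mul mulmxA. Qed.

Lemma dotm_mulr m p q (A : 'M[R]_(m, p)) (B : 'M[R]_(p, q)) C :
  dotm (A *m B) C = dotm A (C *m B^T).
Proof. by rewrite /dotm trmx_mul -mulmxA mxtrace_mulC mulmxA. Qed.

Lemma dotmT m p (A B : 'M[R]_(m, p)) : dotm A^T B^T = dotm A B.
Proof. by rewrite /dotm trmxK mxtrace_mulC -mxtrace_tr trmx_mul trmxK. Qed.

Lemma dotm_isoL m p q (X : 'M[R]_(m, p)) (A B : 'M[R]_(p, q)) :
  stiefel X -> dotm (X *m A) (X *m B) = dotm A B.
Proof. by move=> hX; rewrite dotm_mull mulmxA hX mul1mx. Qed.

Lemma frob_isoL m p q (X : 'M[R]_(m, p)) (A : 'M[R]_(p, q)) :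
  stiefel X -> frob (X *m A) = frob A.
Proof. by move=> hX; rewrite /frob trmx_mul mulmxA -(mulmxA _ X^T) hX mulmx1. Qed.

Lemma frob_isoTL m p q (X : 'M[R]_(m, p)) (A : 'M[R]_(m, q)) :
  stiefel X -> frob (X^T *m A) <= frob A.
Proof.
move=> hX; have [h0|h0] := eqVneq (frob (X^T *m A)) 0.
  by rewrite h0 frob_ge0.
have : frob (X^T *m A) * frob (X^T *m A) <= frob (X^T *m A) * frob A.
  rewrite -expr2 frob_sqr dotm_mull trmxK.
  by rewrite (le_trans (cauchy_schwarz _ _))// frob_isoL// mulrC.
by rewrite ler_pM2l// lt_def h0 frob_ge0.
Qed.

Lemma frob_isoR m p q (X : 'M[R]_(m, p)) (A : 'M[R]_(q, m)) :
  stiefel X -> frob (A *m X) <= frob A.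
Proof.
by move=> hX; rewrite -frobT trmx_mul (le_trans (frob_isoTL _ hX))// frobT.
Qed.

Lemma frob_stiefel m p (X : 'M[R]_(m, p)) : stiefel X -> frob X ^+ 2 = p%:R.
Proof. by move=> hX; rewrite frob_sqr /dotm hX mxtrace1. Qed.

(** Jensen's inequality for unnormalised weights: both sides become sums over pairs with weights
    [a i * a j], compared termwise by Young's inequality. *)
Lemma frob_wsum_sqr m p I (s : seq I) (a : I -> R) (B : I -> 'M[R]_(m, p)) :
  (forall i, 0 <= a i) ->
  frob (\sum_(i <- s) a i *: B i) ^+ 2
    <= (\sum_(i <- s) a i) * \sum_(i <- s) a i * frob (B i) ^+ 2.
Proof.
move=> a0.
have -> : (\sum_(i <- s) a i) * \sum_(i <- s) a i * frob (B i) ^+ 2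
   = 2^-1 * \sum_(i <- s) \sum_(j <- s)
       a i * a j * (frob (B i) ^+ 2 + frob (B j) ^+ 2).
  have E : \sum_(i <- s) \sum_(j <- s) a i * a j * frob (B i) ^+ 2
      = \sum_(i <- s) \sum_(j <- s) a i * a j * frob (B j) ^+ 2.
    rewrite exchange_big/=; apply: eq_bigr => i _; apply: eq_bigr => j _.
    by rewrite (mulrC (a i)).
  under [in RHS]eq_bigr do under eq_bigr do rewrite mulrDr.
  under [in RHS]eq_bigr do rewrite big_split.
  rewrite big_split/= E -mulr2n -[X in 2^-1 * X]mulr_natl mulrA mulVf// mul1r.
  rewrite mulr_suml; apply: eq_bigr => i _; rewrite mulr_sumr.
  by apply: eq_bigr => j _; rewrite mulrA.
rewrite frob_sqr dotm_suml mulr_sumr; apply: ler_sum => i _.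
rewrite dotm_sumr mulr_sumr; apply: ler_sum => j _.
rewrite dotmZl dotmZr !mulrA -mulrA (mulrC 2^-1) -mulrA.
rewrite [leRHS](_ : _ = a i * (a j * (2^-1 * (frob (B i) ^+ 2 + frob (B j) ^+ 2)))); last first.
  by ring.
rewrite ler_wpM2l// ler_wpM2l// !frob_sqr.
by have := dotm_young (B i) (B j); lra.
Qed.

End FrobeniusInnerProduct.

(** * The spectral theorem for real symmetric matrices *)

Section SymmetricSpectral.
Context {R : realType}.

(** The eigenvalue is found over the complex numbers, where the matrix is hermitian and its spectral
    diagonal real; a real root of the characteristic polynomial then has a real eigenvector. *)
Lemma sym_eigenvector m (A : 'M[R]_m.+1) : A^T = A ->
  exists c : R, exists2 v : 'rV[R]_m.+1, v *m A = c *: v & frob v = 1.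
Proof.
move=> As.
pose C : numClosedFieldType := complex R.
pose toC : {rmorphism R -> C} := real_complex R.
pose AC := map_mx toC A.
have ACherm : AC \is hermsymmx.
  apply: realsym_hermsym.
    apply/is_hermitianmxP; rewrite expr0 scale1r map_mx_id//.
    by rewrite /AC map_trmx As.
  by apply/mxOverP => i j; rewrite mxE; apply/complex_realP; exists (A i j).
have /mxOverP dreal := hermitian_spectral_diag_real ACherm.
have [c hc] : exists c, spectral_diag AC 0 0 = toC c.
  by have /complex_realP [c ->] := dreal 0 0; exists c.
have /orthomx_spectralP E := hermitian_normalmx ACherm.
have : root (char_poly AC) (toC c).
  rewrite -hc -eigenvalue_root_char; apply/eigenvalueP.
  exists (row 0 (spectralmx AC)).
    rewrite [X in _ *m X]E -row_mul !mulmxA mulmxV ?spectral_unit// mul1mx.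
    by rewrite row_mul row_diag_mx -scalemxAl -rowE.
  apply/eqP => r0; have := spectral_unit AC.
  rewrite -row_free_unit -kermx_eq0 => /eqP K.
  have : (delta_mx 0 0 : 'rV_m.+1) *m spectralmx AC == 0 by rewrite -rowE r0.
  move=> /eqP /sub_kermxP; rewrite K submx0 => /eqP /matrixP /(_ 0 0).
  by rewrite !mxE !eqxx => /eqP; rewrite oner_eq0.
rewrite -map_char_poly fmorph_root -eigenvalue_root_char => /eigenvalueP [v vA v0].
exists c, ((frob v)^-1 *: v); first by rewrite -scalemxAl vA scalerA mulrC scalerA.
by rewrite frobZ ger0_norm ?invr_ge0 ?frob_ge0// mulVf// frob_eq0.
Qed.

(** A reflection that swaps the first unit row and [v]. Being symmetric and involutive, it
    conjugates a symmetric matrix with eigenvector [v] into one whose first row is diagonal, which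
    is the deflation step of the induction. *)
Lemma householder m (v : 'rV[R]_m.+1) : frob v = 1 ->
  exists2 H : 'M[R]_m.+1, H^T = H /\ H *m H = 1%:M & delta_mx 0 0 *m H = v.
Proof.
move=> v1; pose e : 'rV[R]_m.+1 := delta_mx 0 0.
have [->|ve] := eqVneq v e.
  by exists 1%:M; rewrite ?trmx1 ?mulmx1.
pose u := v - e.
pose d := dotm u u.
have d0 : d != 0 by rewrite dotm_eq0 subr_eq0.
have uuT : u *m u^T = d%:M by rewrite [LHS]mx11_scalar /d /dotm mxtrace_mulC trace_mx11.
have vv : dotm v v = 1 by rewrite -frob_sqr v1 expr1n.
have ee : dotm e e = 1.
  by rewrite dotmE big_ord1 (bigD1 0)//= big1 ?mxE ?addr0 ?mulr1// => i i0; rewrite !mxE (negbTE i0) mulr0.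
exists (1%:M - (2 / d) *: (u^T *m u)).
  split.
    by rewrite linearB/= linearZ/= trmx_mul trmxK trmx1.
  set K := _ *: _.
  have KK : K *m K = K + K.
    rewrite /K -scalemxAl -scalemxAr mulmxA -(mulmxA u^T u) uuT mul_mx_scalar.
    rewrite -scalemxAl !scalerA -scalerDl; congr (_ *: _); by field.
  by rewrite mulmxBl mul1mx mulmxBr mulmx1 KK opprB addrK subrK.
rewrite mulmxBr mulmx1 -scalemxAr mulmxA.
have -> : e *m u^T = (dotm e u)%:M.
  by rewrite [LHS]mx11_scalar dotmC /dotm mxtrace_mulC trace_mx11.
rewrite mul_scalar_mx scalerA.
have -> : 2 / d * dotm e u = -1.
  rewrite /d /u !dotm_lin vv ee (dotmC e v).
  have h : 2 - 2 * dotm v e != 0.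
    by move: d0; rewrite /d /u !dotm_lin vv ee (dotmC e v); apply: contraNneq; lra.
  by field; rewrite -oppr_eq0 in h; lra.
by rewrite scaleN1r opprK /u addrC subrK.
Qed.

Theorem sym_spectral m (A : 'M[R]_m) : A^T = A ->
  exists Q : 'M[R]_m, exists2 d : 'rV[R]_m,
    Q^T *m Q = 1%:M /\ Q *m Q^T = 1%:M & A = Q^T *m diag_mx d *m Q.
Proof.
elim: m A => [|m IH] A As.
  exists 1%:M, 0; first by rewrite trmx1 mulmx1.
  by apply/matrixP => -[].
have [c [v vA v1]] := sym_eigenvector As.
have [H [HT HH] He] := householder v1.
have [B BE0] : exists B : 'M[R]_(1 + m), B = H *m A *m H by exists (H *m A *m H).
have BT : B^T = B by rewrite BE0 !trmx_mul HT As mulmxA.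
have Brow : row 0 B = c *: delta_mx 0 0.
  by rewrite rowE BE0 !mulmxA He vA -scalemxAl -He -mulmxA HH mulmx1.
have L00 : lshift m (0 : 'I_1) = (0 : 'I_m.+1) by exact: val_inj.
have B0 (j : 'I_(1 + m)) : B (lshift m 0) j = c *+ (j == lshift m 0).
  have /matrixP/(_ 0 j) := Brow; rewrite !mxE mulr_natr L00 => ->.
  by rewrite eqxx.
have Bul : ulsubmx B = c%:M.
  apply/matrixP => i j; rewrite !mxE !ord1.
  by rewrite B0 eqxx.
have Bur : ursubmx B = 0.
  apply/matrixP => i j; rewrite !mxE ord1.
  by rewrite B0.
have Bdl : dlsubmx B = 0 by rewrite -[dlsubmx B]trmxK trmx_dlsub BT Bur trmx0.
have := IH (drsubmx B); rewrite trmx_drsub BT => /(_ erefl).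
move=> [Q [d [QTQ QQT] Bdr]].
have BE : B = block_mx c%:M 0 0 (Q^T *m diag_mx d *m Q).
  by rewrite -[LHS]submxK Bul Bur Bdl -Bdr.
pose Q1 : 'M[R]_(1 + m) := block_mx 1%:M 0 0 Q.
have Q1T : Q1^T = block_mx 1%:M 0 0 Q^T by rewrite tr_block_mx trmx1 !trmx0.
have QQ1 : Q1 *m Q1^T = 1%:M.
  rewrite Q1T /Q1 mulmx_block.
  by rewrite !mul0mx !mulmx0 mulmx1 !add0r !addr0 QQT -scalar_mx_block.
have B1 : Q1^T *m diag_mx (row_mx c%:M d) *m Q1 = B.
  have -> : diag_mx (row_mx c%:M d) = block_mx c%:M 0 0 (diag_mx d).
    rewrite diag_mx_row; congr (block_mx _ _ _ _).
    by apply/matrixP => i j; rewrite !mxE !ord1 eqxx.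
  by rewrite Q1T /Q1 BE !mulmx_block
    !(mul0mx, mulmx0, addr0, add0r, mul1mx, mulmx1).
have AE : A = H *m B *m H.
  by rewrite BE0 !mulmxA HH mul1mx -mulmxA HH mulmx1.
exists (Q1 *m H), (row_mx c%:M d); first split.
- rewrite trmx_mul mulmxA HT -(mulmxA _ Q1^T) Q1T /Q1 mulmx_block.
  by rewrite !mul0mx !mulmx0 mulmx1 !add0r !addr0 QTQ -scalar_mx_block mulmx1 HH.
- by rewrite trmx_mul mulmxA HT -(mulmxA Q1 H H) HH mulmx1; exact: QQ1.
- by rewrite [LHS]AE trmx_mul HT -B1 !mulmxA.
Qed.

End SymmetricSpectral.

(** * The polar factor and the polar retraction *)

Section PolarRetraction.
Context {R : realType}.

Lemma quad_dotm m (S : 'M[R]_m) (u : 'cV[R]_m) :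
  (u^T *m S *m u) 0 0 = dotm u (S *m u).
Proof. by rewrite /dotm trace_mx11 mulmxA. Qed.

Lemma diag_mx_dotm m p (d : 'rV[R]_m) (U : 'M[R]_(m, p)) :
  dotm U (diag_mx d *m U) = \sum_i d 0 i * frob (row i U) ^+ 2.
Proof.
rewrite dotmE; apply: eq_bigr => i _.
rewrite frob_sqr dotmE big_ord1 mulr_sumr; apply: eq_bigr => j _.
by rewrite mul_diag_mx !mxE; ring.
Qed.

Lemma spectral_dotm m p (Q : 'M[R]_m) d (U : 'M[R]_(m, p)) :
  dotm U (Q^T *m diag_mx d *m Q *m U)
  = \sum_i d 0 i * frob (row i (Q *m U)) ^+ 2.
Proof. by rewrite -diag_mx_dotm dotm_mull !mulmxA. Qed.

Lemma psd_spectral_ge0 m (Q : 'M[R]_m) d : Q *m Q^T = 1%:M ->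
  (forall u : 'cV[R]_m, 0 <= dotm u (Q^T *m diag_mx d *m Q *m u)) ->
  forall i, 0 <= d 0 i.
Proof.
move=> QQ h i; have := h (Q^T *m delta_mx i 0).
rewrite spectral_dotm mulmxA QQ mul1mx (bigD1 i)//= big1 ?addr0.
  have -> : row i (delta_mx i 0 : 'cV[R]_m) = 1%:M.
    by apply/matrixP => a b; rewrite !mxE !ord1 !eqxx.
  by rewrite frob_sqr /dotm trmx1 mulmx1 mxtrace1 mulr1.
move=> j ji; have -> : row j (delta_mx i 0 : 'cV[R]_m) = 0.
  by apply/matrixP => a b; rewrite !mxE !ord1 (negbTE ji).
by rewrite frob0 expr0n mulr0.
Qed.

Lemma psd_sqrt m (A : 'M[R]_m) : A^T = A ->
  (forall u : 'cV[R]_m, 0 <= dotm u (A *m u)) ->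
  exists S : 'M[R]_m, [/\ S^T = S,
    forall u : 'cV[R]_m, 0 <= (u^T *m S *m u) 0 0 & S *m S = A].
Proof.
move=> As A0; have [Q [d [QTQ QQT] AE]] := sym_spectral As.
have d0 : forall i, 0 <= d 0 i by apply: (psd_spectral_ge0 QQT); rewrite -AE.
pose s : 'rV[R]_m := \row_i Num.sqrt (d 0 i).
exists (Q^T *m diag_mx s *m Q); split.
- by rewrite !trmx_mul trmxK tr_diag_mx mulmxA.
- move=> u; rewrite quad_dotm spectral_dotm; apply: sumr_ge0 => i _.
  by rewrite mulr_ge0 ?sqr_ge0// mxE sqrtr_ge0.
- rewrite AE !mulmxA -(mulmxA _ Q) QQT mulmx1; congr (_ *m _).
  rewrite -mulmxA mulmx_diag; congr (_ *m diag_mx _).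
  by apply/matrixP => i j; rewrite !mxE !ord1 -expr2 sqr_sqrtr.
Qed.

Lemma sqrtmxP m (A : 'M[R]_m) : A^T = A ->
  (forall u : 'cV[R]_m, 0 <= dotm u (A *m u)) ->
  [/\ (sqrtmx A)^T = sqrtmx A,
   forall u : 'cV[R]_m, 0 <= dotm u (sqrtmx A *m u)
   & sqrtmx A *m sqrtmx A = A].
Proof.
move=> As A0; rewrite /sqrtmx; case: xgetP => [S _ [S1 S2 S3]|no].
  by split=> // u; rewrite -quad_dotm.
by have [S HS] := psd_sqrt As A0; case: (no S).
Qed.

Lemma dotm_gram n m p (v : 'M[R]_(n, m)) (U : 'M[R]_(m, p)) :
  dotm U ((1%:M + v^T *m v) *m U) = dotm U U + dotm (v *m U) (v *m U).
Proof. by rewrite mulmxDl mul1mx dotmDr dotm_mull !mulmxA. Qed.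

Lemma gram_sym n m (v : 'M[R]_(n, m)) : (1%:M + v^T *m v)^T = 1%:M + v^T *m v.
Proof. by rewrite linearD/= trmx1 trmx_mul trmxK. Qed.

Lemma gram_psd n m (v : 'M[R]_(n, m)) (u : 'cV[R]_m) :
  0 <= dotm u ((1%:M + v^T *m v) *m u).
Proof. by rewrite dotm_gram addr_ge0 ?dotm_ge0. Qed.

(** The symmetric polar factor of [X + v] for [v] tangent at [X]: tangency cancels the cross terms
    of [(X + v)^T *m (X + v)]. *)
Definition gram_sqrt n m (v : 'M[R]_(n, m)) := sqrtmx (1%:M + v^T *m v).

Lemma gram_sqrt_sym n m (v : 'M[R]_(n, m)) : (gram_sqrt v)^T = gram_sqrt v.
Proof. by have [] := sqrtmxP (gram_sym v) (gram_psd v). Qed.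

Lemma gram_sqrtK n m (v : 'M[R]_(n, m)) :
  gram_sqrt v *m gram_sqrt v = 1%:M + v^T *m v.
Proof. by have [] := sqrtmxP (gram_sym v) (gram_psd v). Qed.

(** In an eigenbasis, each squared eigenvalue minus one is an eigenvalue of [v^T *m v], hence
    nonnegative. This coercivity yields invertibility, a nonexpansive inverse, and the projection
    property of the retraction. *)
Lemma gram_sqrt_ge1 n m p (v : 'M[R]_(n, m)) (U : 'M[R]_(m, p)) :
  dotm U U <= dotm U (gram_sqrt v *m U).
Proof.
have [_ psd _] := sqrtmxP (gram_sym v) (gram_psd v).
have [Q [d [QTQ QQT] SE]] := sym_spectral (gram_sqrt_sym v).
have d0 : forall i, 0 <= d 0 i by apply: (psd_spectral_ge0 QQT); rewrite -SE.
have d1 i : 1 <= d 0 i.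
  rewrite -(@ler_pXn2r _ 2) ?nnegrE ?ler01// expr1n.
  have : 0 <= (\row_j (d 0 j ^+ 2 - 1)) 0 i; last by rewrite mxE subr_ge0.
  apply: (psd_spectral_ge0 QQT) => u.
  have -> : Q^T *m diag_mx (\row_j (d 0 j ^+ 2 - 1)) *m Q = v^T *m v.
    have -> : v^T *m v = gram_sqrt v *m gram_sqrt v - Q^T *m 1%:M *m Q.
      by rewrite gram_sqrtK mulmx1 QTQ addrAC subrr add0r.
    rewrite SE !mulmxA -(mulmxA _ Q) QQT mulmx1 -mulmxBl; congr (_ *m _).
    rewrite -mulmxA mulmx_diag -mulmxBr; congr (_ *m _).
    by apply/matrixP => a b; rewrite !mxE; case: eqP => [->|_] /=;
       rewrite ?mulr1n ?mulr0n ?subr0// expr2.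
  by rewrite -mulmxA -dotm_mull dotm_ge0.
rewrite SE spectral_dotm -(frob_sqr U).
have -> : frob U = frob (Q *m U) by rewrite frob_isoL.
rewrite frob_row_sqr; apply: ler_sum => i _.
by rewrite ler_peMl ?sqr_ge0.
Qed.

Lemma gram_sqrt_unit n m (v : 'M[R]_(n, m)) : gram_sqrt v \in unitmx.
Proof.
rewrite -row_free_unit -kermx_eq0 -trmx_eq0 -dotm_eq0 eq_le dotm_ge0 andbT.
apply: le_trans (gram_sqrt_ge1 v _) _.
have -> : gram_sqrt v *m (kermx (gram_sqrt v))^T = 0; last by rewrite dotm0r.
by apply: trmx_inj; rewrite trmx_mul trmxK gram_sqrt_sym mulmx_ker trmx0.
Qed.

Lemma gram_sqrt_expand n m p (v : 'M[R]_(n, m)) (U : 'M[R]_(m, p)) :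
  frob U <= frob (gram_sqrt v *m U).
Proof.
have [->|h0] := eqVneq (frob U) 0; first exact: frob_ge0.
have U0 : 0 < frob U by rewrite lt_def h0 frob_ge0.
rewrite -(ler_pM2l U0) -expr2 frob_sqr.
exact: le_trans (gram_sqrt_ge1 v U) (cauchy_schwarz _ _).
Qed.

Lemma gram_sqrt_invL n m p (v : 'M[R]_(n, m)) (U : 'M[R]_(m, p)) :
  frob (invmx (gram_sqrt v) *m U) <= frob U.
Proof.
by rewrite (le_trans (gram_sqrt_expand v _))// mulKVmx// gram_sqrt_unit.
Qed.

Lemma gram_sqrt_invR n m p (v : 'M[R]_(n, m)) (U : 'M[R]_(p, m)) :
  frob (U *m invmx (gram_sqrt v)) <= frob U.
Proof.
rewrite -frobT trmx_mul trmx_inv gram_sqrt_sym -[leRHS]frobT.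
exact: gram_sqrt_invL.
Qed.

(** Sylvester's argument: with [D] the difference of the roots, the difference of the squares is
    [gram_sqrt v *m D + D *m gram_sqrt w]. Pairing with [D] and using coercivity on both sides gives
    twice the square of [frob D]. *)
Lemma gram_sqrt_lip n m (v w : 'M[R]_(n, m)) :
  2 * frob (gram_sqrt v - gram_sqrt w) <= frob (v^T *m v - w^T *m w).
Proof.
set D := gram_sqrt v - gram_sqrt w.
have [->|h0] := eqVneq (frob D) 0; first by rewrite mulr0 frob_ge0.
have D0 : 0 < frob D by rewrite lt_def h0 frob_ge0.
rewrite -(ler_pM2l D0) mulrCA -expr2.
have E : v^T *m v - w^T *m w = gram_sqrt v *m D + D *m gram_sqrt w.
  by rewrite mulmxBr mulmxBl !gram_sqrtK addrA subrK opprD addrACA subrr add0r.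
rewrite (le_trans _ (cauchy_schwarz _ _))// E dotmDr frob_sqr.
have h1 := gram_sqrt_ge1 v D; have := gram_sqrt_ge1 w D^T.
have -> : gram_sqrt w *m D^T = (D *m gram_sqrt w)^T.
  by rewrite trmx_mul gram_sqrt_sym.
rewrite !dotmT; lra.
Qed.

Lemma gram_sqrt_inv_lip n m (v w : 'M[R]_(n, m)) :
  frob (invmx (gram_sqrt v) - invmx (gram_sqrt w))
    <= frob (v^T *m v - w^T *m w).
Proof.
have -> : invmx (gram_sqrt v) - invmx (gram_sqrt w)
   = invmx (gram_sqrt v) *m (gram_sqrt w - gram_sqrt v) *m invmx (gram_sqrt w).
  rewrite mulmxBr mulmxBl mulVmx ?gram_sqrt_unit// mul1mx.
  by rewrite -mulmxA mulmxV ?gram_sqrt_unit// mulmx1.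
rewrite (le_trans (gram_sqrt_invR _ _))// (le_trans (gram_sqrt_invL _ _))//.
rewrite frobBC; have := gram_sqrt_lip v w.
by have := frob_ge0 (gram_sqrt v - gram_sqrt w); lra.
Qed.

Section AtPoint.
Context n r (X v : 'M[R]_(n, r)).
Hypotheses (hX : stiefel X) (hv : tangent X v).

Lemma polar_gram : (X + v)^T *m (X + v) = 1%:M + v^T *m v.
Proof.
rewrite [(X + v)^T]linearD/= mulmxDl !mulmxDr hX.
by rewrite -addrA; congr (_ + _); rewrite addrA hv add0r.
Qed.

Lemma polar_factor : polar_retraction X v *m gram_sqrt v = X + v.
Proof. by rewrite -mulmxA mulVmx ?gram_sqrt_unit ?mulmx1. Qed.

Lemma polar_stiefel : stiefel (polar_retraction X v).
Proof.
rewrite /stiefel/= /polar_retraction -/(gram_sqrt v) trmx_mul trmx_inv gram_sqrt_sym.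
rewrite mulmxA -(mulmxA _ (X + v)^T) polar_gram -gram_sqrtK mulmxA.
by rewrite mulVmx ?gram_sqrt_unit// mul1mx mulmxV ?gram_sqrt_unit.
Qed.

(** The residual [X + v - P] equals [P *m (gram_sqrt v - 1)], and [gram_sqrt v - 1] is a square
    [T *m T]. Its pairing with [P - Z] is the squared norm of [P *m T] minus the pairing of [P *m T]
    with [Z *m T]. This is nonnegative by Cauchy-Schwarz, since [P] and [Z] are isometries. *)
Lemma polar_nonexpansive Z : stiefel Z ->
  frob (polar_retraction X v - Z) <= frob (X + v - Z).
Proof.
move=> hZ; set P := polar_retraction X v.
have hP : stiefel P by exact: polar_stiefel.
have [T [TT _ TE]] : exists T : 'M[R]_r, [/\ T^T = T,
    forall u : 'cV[R]_r, 0 <= (u^T *m T *m u) 0 0 & T *m T = gram_sqrt v - 1%:M].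
  apply: psd_sqrt; first by rewrite linearB/= gram_sqrt_sym trmx1.
  move=> u; rewrite mulmxBl mul1mx dotmDr dotmNr subr_ge0.
  exact: gram_sqrt_ge1.
have -> : X + v - Z = (P - Z) + P *m (gram_sqrt v - 1%:M).
  by rewrite mulmxBr polar_factor mulmx1 [RHS]addrC addrA subrK.
rewrite -(@ler_pXn2r _ 2) ?nnegrE ?frob_ge0// !frob_sqr.
have h0 : 0 <= dotm (P - Z) (P *m (gram_sqrt v - 1%:M)).
  rewrite -TE mulmxA dotmC dotm_mulr TT mulmxBl dotmDr dotmNr.
  rewrite subr_ge0 dotm_isoL// -frob_sqr expr2.
  by rewrite (le_trans (cauchy_schwarz _ _))// !frob_isoL.
have := dotm_ge0 (P *m (gram_sqrt v - 1%:M)).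
move: (P - Z) (P *m _) h0 => a b h0.
by rewrite !dotm_lin (dotmC b a); lra.
Qed.

End AtPoint.

End PolarRetraction.

(** * Tangent and normal projections on the Stiefel manifold *)

Section StiefelGeometry.
Context {R : realType} {n r : nat}.
Implicit Types X Y Z u : 'M[R]_(n, r).

Definition proj_normal X Y : 'M[R]_(n, r) :=
  2^-1 *: (X *m (X^T *m Y + Y^T *m X)).

Lemma proj_tangentE X Y : proj_tangent X Y = Y - proj_normal X Y.
Proof. by []. Qed.

Lemma proj_normalD X Y Z : proj_normal X (Y + Z) = proj_normal X Y + proj_normal X Z.
Proof.
rewrite /proj_normal -scalerDr -mulmxDr; congr (_ *: (_ *m _)).
by rewrite mulmxDr [(Y + Z)^T]linearD/= mulmxDl addrACA.
Qed.

Lemma proj_normalZ c X Y : proj_normal X (c *: Y) = c *: proj_normal X Y.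
Proof.
rewrite /proj_normal -scalemxAr [(c *: Y)^T]linearZ/= -scalemxAl -scalerDr.
by rewrite -scalemxAr !scalerA mulrC.
Qed.

Lemma proj_tangentD X Y Z :
  proj_tangent X (Y + Z) = proj_tangent X Y + proj_tangent X Z.
Proof. by rewrite !proj_tangentE proj_normalD opprD addrACA. Qed.

Lemma proj_tangentZ c X Y : proj_tangent X (c *: Y) = c *: proj_tangent X Y.
Proof. by rewrite !proj_tangentE proj_normalZ scalerBr. Qed.

Lemma proj_tangentN X Y : proj_tangent X (- Y) = - proj_tangent X Y.
Proof. by rewrite -scaleN1r proj_tangentZ scaleN1r. Qed.

Lemma proj_tangentB X Y Z :
  proj_tangent X (Y - Z) = proj_tangent X Y - proj_tangent X Z.
Proof. by rewrite proj_tangentD proj_tangentN. Qed.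

Lemma proj_tangentP X Y : stiefel X -> tangent X (proj_tangent X Y).
Proof.
move=> hX; rewrite /tangent/= proj_tangentE /proj_normal.
set S := X^T *m Y + Y^T *m X.
have ST : S^T = S.
  by rewrite /S linearD/= !trmx_mul !trmxK addrC.
rewrite mulmxBr [(_ - _)^T]linearB/= mulmxBl -scalemxAr mulmxA hX mul1mx.
rewrite [(_ *: _)^T]linearZ/= trmx_mul ST -scalemxAl -mulmxA hX mulmx1.
rewrite addrACA -/S -opprD -scalerDl.
by rewrite (_ : 2^-1 + 2^-1 = 1 :> R) ?scale1r ?subrr//; field.
Qed.

Lemma tangentZ c X u : tangent X u -> tangent X (c *: u).
Proof.
rewrite /tangent/= => h; rewrite -scalemxAr [(c *: u)^T]linearZ/= -scalemxAl.
by rewrite -scalerDr h scaler0.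
Qed.

Lemma tangentB X u w : tangent X u -> tangent X w -> tangent X (u - w).
Proof.
rewrite /tangent/= => hu hw; rewrite mulmxBr [(u - w)^T]linearB/= mulmxBl.
by rewrite addrACA hu -opprD hw subr0.
Qed.

Lemma tangent_sym_dotm X u (S : 'M[R]_r) : tangent X u -> S^T = S ->
  dotm u (X *m S) = 0.
Proof.
move=> hu hS. rewrite dotmC dotm_mull. rewrite dotmC; set K := X^T *m u.
have KT : K^T = - K.
  by rewrite /K trmx_mul trmxK; apply/eqP; rewrite -addr_eq0 addrC hu.
have := dotmT K S; rewrite KT hS dotmNl; lra.
Qed.

Lemma tangent_normal_dotm X u Y : tangent X u -> dotm u (proj_normal X Y) = 0.
Proof.
move=> hu; rewrite dotmZr (tangent_sym_dotm hu) ?mulr0//.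
by rewrite linearD/= !trmx_mul !trmxK addrC.
Qed.

Lemma dotm_proj_tangent X Y : stiefel X ->
  dotm (proj_tangent X Y) Y = frob (proj_tangent X Y) ^+ 2.
Proof.
move=> hX; rewrite frob_sqr.
rewrite -[LHS](subr0 _) -(tangent_normal_dotm Y (proj_tangentP Y hX)).
by rewrite -dotmNr -dotmDr -proj_tangentE.
Qed.

Lemma proj_tangent_le X Y : stiefel X -> frob (proj_tangent X Y) <= frob Y.
Proof.
move=> hX; have [->|h0] := eqVneq (frob (proj_tangent X Y)) 0.
  exact: frob_ge0.
have h : 0 < frob (proj_tangent X Y) by rewrite lt_def h0 frob_ge0.
by rewrite -(ler_pM2l h) -expr2 -dotm_proj_tangent// cauchy_schwarz.
Qed.

(** Subtracting the tangency equation at [H] replaces [X] by [X - H] in the normal component at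
    [X]. *)
Lemma proj_normal_tangent_le X H u : stiefel X -> tangent H u ->
  frob (proj_normal X u) <= frob (X - H) * frob u.
Proof.
move=> hX hu; rewrite /proj_normal frobZ frob_isoL//.
have -> : X^T *m u + u^T *m X = (X - H)^T *m u + ((X - H)^T *m u)^T.
  rewrite trmx_mul trmxK [(X - H)^T]linearB/= mulmxBl mulmxBr addrACA.
  by rewrite -opprD hu subr0.
rewrite ger0_norm//; have := frobD ((X - H)^T *m u) ((X - H)^T *m u)^T.
have := frobM (X - H)^T u; rewrite !frobT; lra.
Qed.

Lemma proj_tangent_sub_le X H G Y : stiefel X -> tangent H G ->
  frob (proj_tangent X Y - G) <= frob (Y - G) + frob (X - H) * frob G.
Proof.
move=> hX hG.
have -> : proj_tangent X Y - G = proj_tangent X (Y - G) - proj_normal X G.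
  rewrite [X in _ = X - _]proj_tangentB [proj_tangent X G]proj_tangentE.
  by rewrite opprB addrA addrAC addrK.
by rewrite (le_trans (frobB _ _))// lerD ?proj_tangent_le ?proj_normal_tangent_le.
Qed.

(** The source of every quadratic gain: seen from [X], the normal component of another point of the
    manifold is [X] itself up to the Gram matrix of the difference. *)
Lemma stiefel_sub_gram X Y : stiefel X -> stiefel Y ->
  X^T *m Y + Y^T *m X = 2%:M - (X - Y)^T *m (X - Y).
Proof.
move=> hX hY; rewrite [(X - Y)^T]linearB/= mulmxBl !mulmxBr hX hY.
rewrite opprB addrC [in RHS]opprB.
have -> : 2%:M = 1%:M + 1%:M :> 'M[R]_r by rewrite -raddfD.
set a := X^T *m Y; set b := Y^T *m X; set c := 1%:M.
apply/matrixP => i j; rewrite !mxE; ring.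
Qed.

End StiefelGeometry.

(** * The induced arithmetic mean *)

Section InducedMean.
Context {R : realType} {n r N : nat}.
Implicit Types (X : 'I_N -> 'M[R]_(n, r)) (H : 'M[R]_(n, r)).
Hypothesis hN : (0 < N)%N.

Let N0 : (N%:R : R) != 0. Proof. by rewrite pnatr_eq0 -lt0n. Qed.
Let N1 : 0 < (N%:R : R). Proof. by rewrite ltr0n. Qed.

Lemma avg_const (H : 'M[R]_(n, r)) : avg (fun _ : 'I_N => H) = H.
Proof.
by rewrite /avg sumr_const card_ord -[H *+ N]scaler_nat scalerA mulVf ?scale1r.
Qed.

Lemma avgD X (Z : 'I_N -> 'M[R]_(n, r)) : avg (fun i => X i + Z i) = avg X + avg Z.
Proof. by rewrite /avg big_split scalerDr. Qed.

Lemma avgZ c X : avg (fun i => c *: X i) = c *: avg X.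
Proof. by rewrite /avg -scaler_sumr !scalerA mulrC. Qed.

Lemma avgB X (Z : 'I_N -> 'M[R]_(n, r)) : avg (fun i => X i - Z i) = avg X - avg Z.
Proof. by rewrite /avg sumrB scalerBr. Qed.

Lemma frob_avg_le X : frob (avg X) <= N%:R^-1 * \sum_i frob (X i).
Proof.
by rewrite /avg frobZ ger0_norm ?invr_ge0 ?ler0n// ler_wpM2l ?invr_ge0 ?frob_sum.
Qed.

Lemma frob_avg_sqr_le X : frob (avg X) ^+ 2 <= N%:R^-1 * stack_frob2 X.
Proof.
have := @frob_wsum_sqr _ _ _ _ (index_enum 'I_N) (fun=> 1) X (fun=> ler01).
rewrite sumr_const card_ord; under eq_bigr do rewrite scale1r.
under [X in _ * X]eq_bigr do rewrite mul1r.
move=> h; rewrite /avg frobZ exprMn ger0_norm ?invr_ge0 ?ler0n//.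
rewrite expr2 -mulrA ler_pM2l ?invr_gt0//.
by rewrite ler_pdivrMl.
Qed.

Lemma frob_avg_max X c : (forall i, frob (X i) <= c) -> frob (avg X) <= c.
Proof.
move=> h; rewrite (le_trans (frob_avg_le X))// ler_pdivrMl//.
rewrite (le_trans (ler_sum _ (fun i _ => h i)))// sumr_const card_ord.
by rewrite mulr_natl.
Qed.

(** All points of the manifold have the same norm, so the least squares problem is the maximisation
    of a linear functional. *)
Lemma iam_dotm X H : (forall i, stiefel (X i)) -> is_iam X H ->
  forall Y, stiefel Y -> dotm Y (avg X) <= dotm H (avg X).
Proof.
move=> hX [hH hmin] Y hY; rewrite !dotmZr ler_pM2l ?invr_gt0// !dotm_sumr.
have E Z : stiefel Z -> \sum_i frob (Z - X i) ^+ 2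
    = (r%:R + r%:R) *+ N - 2 * \sum_i dotm Z (X i).
  move=> hZ; transitivity (\sum_i (r%:R + r%:R - 2 * dotm Z (X i))); last first.
    by rewrite sumrB sumr_const card_ord mulr_sumr.
  apply: eq_bigr => i _; rewrite frob_sqr !dotm_lin -!frob_sqr.
  by rewrite !frob_stiefel// (dotmC (X i)); ring.
by have := hmin Y hY; rewrite !E//; lra.
Qed.

Lemma iam_critical (M : R) X H : 0 < M ->
  (forall X v : 'M[R]_(n, r), stiefel X -> tangent X v ->
     frob (polar_retraction X v - (X + v)) <= M * frob v ^+ 2) ->
  (forall i, stiefel (X i)) -> is_iam X H -> proj_tangent H (avg X) = 0.
Proof.
move=> M0 hM hX hH; have HS : stiefel H by case: hH.
set u := proj_tangent H (avg X); apply/eqP; rewrite -frob_eq0; apply/eqP.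
have hu : tangent H u by exact: proj_tangentP.
(* Along the step [C^-1 *: u] the functional gains [C^-1 * frob u ^+ 2] at first order, and the
   retraction loses at most [M * C^-1 ^+ 2 * frob u ^+ 2 * frob (avg X)]. Since [C] exceeds
   [M * frob (avg X)], maximality of [H] forces [u = 0]; the [+ 1] also keeps [C] positive. *)
pose C := M * (frob (avg X) + 1).
have C0 : 0 < C by rewrite mulr_gt0// ltr_wpDl// frob_ge0.
have key : dotm (C^-1 *: u) (avg X)
    <= M * frob (C^-1 *: u) ^+ 2 * frob (avg X).
  have ht := tangentZ C^-1 hu.
  have h1 := iam_dotm hX hH (polar_stiefel HS ht).
  rewrite (_ : dotm (C^-1 *: u) (avg X) = dotm (H + C^-1 *: u - polar_retraction H (C^-1 *: u)) (avg X)
     + (dotm (polar_retraction H (C^-1 *: u)) (avg X) - dotm H (avg X))); last first.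
    by rewrite !dotm_lin; ring.
  have h2 : dotm (H + C^-1 *: u - polar_retraction H (C^-1 *: u)) (avg X)
     <= M * frob (C^-1 *: u) ^+ 2 * frob (avg X).
    rewrite (le_trans (cauchy_schwarz _ _))// ler_wpM2r ?frob_ge0//.
    by rewrite frobBC hM.
  by lra.
move: key; rewrite dotmZl dotm_proj_tangent// -/u frobZ ger0_norm ?invr_ge0 ?(ltW C0)//.
have [//|f0] := eqVneq (frob u) 0.
have f2 : 0 < frob u ^+ 2 by rewrite exprn_gt0// lt_def f0 frob_ge0.
rewrite exprMn; have -> : M * (C^-1 ^+ 2 * frob u ^+ 2) * frob (avg X)
   = C^-1 * frob u ^+ 2 * (C^-1 * (M * frob (avg X))) by ring.
rewrite -[leLHS]mulr1 ler_pM2l ?(mulr_gt0 _ f2) ?invr_gt0//.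
by rewrite ler_pdivlMl// mulr1 /C ler_pM2l//; lra.
Qed.

(** By criticality [avg X] equals its own normal component at [H], which [stiefel_sub_gram]
    evaluates to [H] minus half of [H] times the mean Gram matrix of the differences. *)
Lemma iam_avg (M : R) X H : 0 < M ->
  (forall X v : 'M[R]_(n, r), stiefel X -> tangent X v ->
     frob (polar_retraction X v - (X + v)) <= M * frob v ^+ 2) ->
  (forall i, stiefel (X i)) -> is_iam X H ->
  frob (H - avg X) <= 2^-1 * (N%:R^-1 * stack_frob2 (fun i => X i - H)).
Proof.
move=> M0 hM hX hH; have HS : stiefel H by case: hH.
have := iam_critical M0 hM hX hH; rewrite proj_tangentE => /eqP.
rewrite subr_eq0 => /eqP E.
have E2 : H - avg X = 2^-1 *: (H *m (N%:R^-1 *: \sum_i (H - X i)^T *m (H - X i))).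
  rewrite {1}E /proj_normal.
  have -> : H^T *m avg X + (avg X)^T *m H
     = 2%:M - N%:R^-1 *: \sum_i (H - X i)^T *m (H - X i).
    rewrite /avg [(_ *: _)^T]linearZ/= -scalemxAr -scalemxAl -scalerDr.
    rewrite [(\sum_i _)^T]linear_sum/= mulmx_sumr mulmx_suml -big_split/=.
    under eq_bigr do rewrite stiefel_sub_gram//.
    rewrite sumrB scalerBr sumr_const card_ord -[2%:M *+ N]scaler_nat scalerA mulVf//.
    by rewrite scale1r.
  rewrite mulmxBr scalerBr mul_mx_scalar scalerA mulVf ?pnatr_eq0// scale1r.
  by rewrite opprB addrC subrK.
rewrite E2 frobZ ger0_norm// frob_isoL// frobZ ger0_norm ?invr_ge0 ?ler0n//.
rewrite !ler_pM2l ?invr_gt0//.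
rewrite (le_trans (frob_sum _ _ _))//; apply: ler_sum => i _.
by rewrite (le_trans (frobM _ _))// frobT -expr2 frobBC.
Qed.

End InducedMean.

(** * Descent inequality and Lipschitz Riemannian gradients *)

Section SmoothFunctions.
Context {R : realType} {n r : nat}.
Implicit Types (f : 'M[R]_(n, r) -> R) (X Y d : 'M[R]_(n, r)).

Lemma derive_grad f X d : differentiable f X -> 'D_d f X = dotm (grad f X) d.
Proof.
move=> df; rewrite deriveE// [in LHS](matrix_sum_delta d) linear_sum/= dotmE.
apply: eq_bigr => i _; rewrite linear_sum/=; apply: eq_bigr => j _.
by rewrite linearZ/= -deriveE// mxE mulrC.
Qed.

Lemma is_derive_line f X d (s : R) : differentiable f (X + s *: d) ->
  is_derive s 1 (fun u : R => f (X + u *: d)) (dotm (grad f (X + s *: d)) d).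
Proof.
move=> df.
have E : (fun h : R => h^-1 *: ((fun u : R => f (X + u *: d)) (h *: 1 + s)
      - f (X + s *: d)))
   = (fun h : R => h^-1 *: (f (h *: d + (X + s *: d)) - f (X + s *: d))).
  apply/funext => h; congr (_ *: (f _ - _)).
  by rewrite -[h *: 1]/(h * 1) mulr1 scalerDl addrCA addrA addrAC.
have dv : derivable f (X + s *: d) d by exact: diff_derivable.
apply: DeriveDef.
  by rewrite /derivable; move: dv; rewrite /derivable /comp/= E.
by rewrite -derive_grad// /derive; move: E; rewrite /comp/= => ->.
Qed.

(** The mean value theorem is applied to [h], the function on the segment minus its quadratic upper
    model; the Lipschitz gradient makes the derivative of [h] nonpositive at the intermediate
    point. *)
Lemma descent f (L : R) X Y :
  (forall Z, differentiable f Z) ->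
  (forall Z T, frob (grad f Z - grad f T) <= L * frob (Z - T)) ->
  f Y <= f X + dotm (grad f X) (Y - X) + L / 2 * frob (Y - X) ^+ 2.
Proof.
move=> df hL; set d := Y - X.
pose h (s : R) := f (X + s *: d) - (s * dotm (grad f X) d + s ^+ 2 * (L / 2 * frob d ^+ 2)).
pose h' (s : R) := dotm (grad f (X + s *: d)) d
   - (dotm (grad f X) d + (2 * s) * (L / 2 * frob d ^+ 2)).
have hd (s : R) : is_derive s 1 h (h' s).
  apply: is_deriveB; first exact: is_derive_line.
  apply: is_deriveD.
    apply: is_derive_eq; rewrite scaler0 add0r -[_ *: 1]/(_ * 1) mulr1//.
  apply: is_derive_eq; rewrite scaler0 add0r -[_ *: _]/(_ * _).
  by rewrite -[s%:A]/(s * 1); ring.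
have [c c01] : exists2 c, c \in `]0, 1[%R & h 1 - h 0 = h' c * (1 - 0).
  apply: MVT => //.
  apply: derivable_within_continuous => s _.
  by have [] := hd s.
rewrite subr0 mulr1 /h /h' !scale1r scale0r addr0 (_ : X + d = Y); last first.
  by rewrite /d addrC subrK.
have c0 : 0 <= c by move: c01; rewrite in_itv/= => /andP[/ltW].
have := cauchy_schwarz (grad f (X + c *: d) - grad f X) d.
have : frob (grad f (X + c *: d) - grad f X) * frob d <= L * c * frob d ^+ 2.
  rewrite expr2 mulrA ler_wpM2r ?frob_ge0// (le_trans (hL _ _))//.
  by rewrite addrAC subrr add0r frobZ ger0_norm// mulrA.
by rewrite dotmDl dotmNl; lra.
Qed.

Definition op_bound m p (g : 'M[R]_(m, p)) (c : R) :=
  forall u : 'cV[R]_p, frob (g *m u) <= c * frob u.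

Lemma op_bound_mx m p q (g : 'M[R]_(m, p)) c (U : 'M[R]_(p, q)) : 0 <= c ->
  op_bound g c -> frob (g *m U) <= c * frob U.
Proof.
move=> c0 h; rewrite -(@ler_pXn2r _ 2) ?nnegrE ?mulr_ge0 ?frob_ge0//.
rewrite exprMn !frob_col_sqr mulr_sumr; apply: ler_sum => j _.
rewrite -exprMn ler_pXn2r ?nnegrE ?mulr_ge0 ?frob_ge0//.
by rewrite !colE -mulmxA; exact: h.
Qed.

Lemma op_boundT m p (g : 'M[R]_(m, p)) c : 0 <= c -> op_bound g c ->
  op_bound g^T c.
Proof.
move=> c0 h u; have [->|h0] := eqVneq (frob (g^T *m u)) 0.
  by rewrite mulr_ge0 ?frob_ge0.
have f0 : 0 < frob (g^T *m u) by rewrite lt_def h0 frob_ge0.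
rewrite -(ler_pM2r f0) -expr2 frob_sqr dotm_mull trmxK.
rewrite (le_trans (cauchy_schwarz _ _))// [leRHS]mulrAC (mulrC (frob u)).
by rewrite ler_wpM2r ?frob_ge0// h.
Qed.

(** Passing to the Riemannian gradient drops the pairing of the normal part of the gradient with
    [d = Y - X]. It is quadratic, because [X^T *m d + d^T *m X = - (d^T *m d)] for two points of the
    manifold, and it only adds [Ln] to the constant. *)
Lemma riemannian_descent f (L Ln : R) X Y :
  (forall Z, differentiable f Z) ->
  (forall Z T, frob (grad f Z - grad f T) <= L * frob (Z - T)) ->
  0 <= Ln -> (forall X, stiefel X -> op_bound (grad f X) Ln) ->
  stiefel X -> stiefel Y ->
  f Y <= f X + dotm (rgrad f X) (Y - X) + (L + Ln) / 2 * frob (Y - X) ^+ 2.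
Proof.
move=> df hL Ln0 hLn hX hY; apply: le_trans (descent X Y df hL) _.
set g := grad f X; set d := Y - X.
have -> : dotm g d = dotm (rgrad f X) d + dotm (proj_normal X g) d.
  by rewrite -dotmDl /rgrad -/g proj_tangentE subrK.
suff : dotm (proj_normal X g) d <= Ln / 2 * frob d ^+ 2.
  by lra.
rewrite /proj_normal dotmZl dotm_mull.
have sX : X^T *m d + d^T *m X = - (d^T *m d).
  have := stiefel_sub_gram hY hX; rewrite -/d => E.
  have -> : X^T *m d + d^T *m X = X^T *m Y + Y^T *m X - (1%:M + 1%:M).
    by rewrite /d mulmxBr [(Y - X)^T]linearB/= mulmxBl hX addrACA -opprD.
  rewrite (addrC (X^T *m Y)) E.
  have -> : 2%:M = 1%:M + 1%:M :> 'M[R]_r by rewrite -raddfD.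
  by rewrite addrAC subrr add0r.
have -> : dotm (X^T *m g + g^T *m X) (X^T *m d)
   = - dotm (X^T *m g) (d^T *m d).
  have sy : dotm (X^T *m g + g^T *m X) (X^T *m d)
       = dotm (X^T *m g + g^T *m X) (d^T *m X).
    rewrite -dotmT; congr dotm; last by rewrite trmx_mul trmxK.
    by rewrite linearD/= !trmx_mul !trmxK addrC.
  have : 2 * dotm (X^T *m g + g^T *m X) (X^T *m d)
       = - dotm (X^T *m g + g^T *m X) (d^T *m d).
    by rewrite -dotmNr -sX dotmDr -sy; ring.
  have -> : dotm (X^T *m g + g^T *m X) (d^T *m d) = 2 * dotm (X^T *m g) (d^T *m d).
    rewrite dotmDl; have -> : dotm (g^T *m X) (d^T *m d) = dotm (X^T *m g) (d^T *m d).
      by rewrite -dotmT !trmx_mul !trmxK.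
    by ring.
  by lra.
have : - dotm (X^T *m g) (d^T *m d) <= Ln * frob d ^+ 2.
  have -> : dotm (X^T *m g) (d^T *m d) = dotm (g *m d^T) (X *m d^T).
    by rewrite dotm_mull dotm_mulr !trmxK mulmxA.
  rewrite -dotmNr (le_trans (cauchy_schwarz _ _))// frobN (frob_isoL _ hX) frobT.
  rewrite expr2 mulrA ler_wpM2r ?frob_ge0//.
  by rewrite (le_trans (op_bound_mx _ Ln0 (hLn _ hX)))// frobT.
by lra.
Qed.

(** The term [2 * Ln] comes from the change of the normal projection, where the base point occurs as
    an outer and as an inner factor. Replacing each in turn costs [Ln * frob (X - Y)] once the
    factor one half is counted. *)
Lemma rgrad_lip f (L Ln : R) X Y :
  (forall Z T, frob (grad f Z - grad f T) <= L * frob (Z - T)) ->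
  0 <= Ln -> (forall X, stiefel X -> op_bound (grad f X) Ln) ->
  stiefel X -> stiefel Y ->
  frob (rgrad f X - rgrad f Y) <= (L + 2 * Ln) * frob (X - Y).
Proof.
move=> hL Ln0 hLn hX hY; set gX := grad f X; set g := grad f Y; set d := X - Y.
have -> : rgrad f X - rgrad f Y = proj_tangent X (gX - g)
   - 2^-1 *: (d *m (X^T *m g + g^T *m X) + Y *m (d^T *m g + g^T *m d)).
  have -> : 2^-1 *: (d *m (X^T *m g + g^T *m X) + Y *m (d^T *m g + g^T *m d))
      = proj_normal X g - proj_normal Y g.
    rewrite -scalerBr; congr (_ *: _).
    have -> : d^T *m g + g^T *m d
        = X^T *m g + g^T *m X - (Y^T *m g + g^T *m Y).
      by rewrite [d^T]linearB/= mulmxBl mulmxBr addrACA -opprD.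
    by rewrite /d mulmxBl mulmxBr addrA subrK.
  rewrite -[rgrad f X]/(proj_tangent X gX) -[rgrad f Y]/(proj_tangent Y g).
  rewrite proj_tangentB !proj_tangentE.
  move: (proj_normal X gX) (proj_normal X g) (proj_normal Y g) => a b c.
  by apply/matrixP => i j; rewrite !mxE; ring.
rewrite (le_trans (frobB _ _))// mulrDl lerD//.
  by rewrite (le_trans (proj_tangent_le _ hX))// hL.
rewrite frobZ ger0_norm//.
have gB q (U : 'M[R]_(r, q)) : frob (g *m U) <= Ln * frob U.
  exact: op_bound_mx (hLn _ hY).
have gTB q (U : 'M[R]_(n, q)) : frob (g^T *m U) <= Ln * frob U.
  exact: op_bound_mx (op_boundT Ln0 (hLn _ hY)).
have h1 : frob (d *m (X^T *m g)) <= Ln * frob d.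
  rewrite -frobT !trmx_mul trmxK -mulmxA (le_trans (gTB _ _))//.
  by rewrite ler_wpM2l// frob_isoL// frobT.
have h2 : frob (d *m (g^T *m X)) <= Ln * frob d.
  rewrite mulmxA (le_trans (frob_isoR _ hX))//.
  by rewrite -frobT trmx_mul trmxK (le_trans (gB _ _))// frobT.
have h3 : frob (Y *m (d^T *m g + g^T *m d)) <= 2 * (Ln * frob d).
  rewrite frob_isoL// (le_trans (frobD _ _))//.
  have := gTB _ d; have : frob (d^T *m g) <= Ln * frob d; last by lra.
  by rewrite -frobT trmx_mul trmxK.
rewrite mulmxDr; have := frobD (d *m (X^T *m g) + d *m (g^T *m X)) (Y *m (d^T *m g + g^T *m d)).
have := frobD (d *m (X^T *m g)) (d *m (g^T *m X)); lra.
Qed.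

End SmoothFunctions.

Section MaxGradNorm.
Context {R : realType}.

Lemma spectral_norm_bound m p (A : 'M[R]_(m, p)) : op_bound A (spectral_norm A).
Proof.
move=> u; have [->|u0] := eqVneq u 0; first by rewrite mulmx0 !frob0 mulr0.
have fu : 0 < frob u by rewrite lt_def frob_eq0 u0 frob_ge0.
rewrite -ler_pdivrMr// mulrC -[_^-1]ger0_norm ?invr_ge0 ?frob_ge0//.
rewrite -frobZ scalemxAr; apply: ub_le_sup.
  exists (frob A) => _ [w /= w1 <-].
  by rewrite (le_trans (frobM _ _))// w1 mulr1.
exists ((frob u)^-1 *: u) => //=.
by rewrite frobZ ger0_norm ?invr_ge0 ?frob_ge0// mulVf// gt_eqF.
Qed.

Lemma unit_col p : (0 < p)%N -> exists u : 'cV[R]_p, frob u = 1.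
Proof.
case: p => // p _; exists (delta_mx 0 0); apply/eqP.
rewrite -(eqrXn2 (n := 2)) ?frob_ge0// frob_sqr /dotm trmx_delta mul_delta_mx.
by rewrite trace_mx11 mxE !eqxx expr1n.
Qed.

Lemma spectral_norm_le_frob m p (A : 'M[R]_(m, p)) : (0 < p)%N ->
  spectral_norm A <= frob A.
Proof.
move=> /unit_col [u u1]; apply: ge_sup; first by exists (frob (A *m u)), u.
by move=> _ [w /= w1 <-]; rewrite (le_trans (frobM _ _))// w1 mulr1.
Qed.

Context {n r N : nat}.
Implicit Type f : 'I_N -> 'M[R]_(n, r) -> R.

(** Both suprema are meaningful only over nonempty sets with an upper bound; the Frobenius bound [A]
    supplies the upper bound, and [0 < r] a unit vector. *)
Lemma max_grad_norm_bound f (A : R) : (0 < r)%N ->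
  (forall i X, stiefel X -> frob (grad (f i) X) <= A) ->
  forall i X, stiefel X -> op_bound (grad (f i) X) (max_grad_norm f).
Proof.
move=> r0 hA i X hX u; rewrite (le_trans (spectral_norm_bound _ _))//.
rewrite ler_wpM2r ?frob_ge0//; apply: ub_le_sup; last by exists i, X.
exists A => _ [j [Y [hY ->]]].
by rewrite (le_trans (spectral_norm_le_frob _ r0))// hA.
Qed.

Lemma op_bound_ge0 m p (A : 'M[R]_(m, p)) c : (0 < p)%N -> op_bound A c -> 0 <= c.
Proof.
move=> /unit_col [u u1] h; have := h u; rewrite u1 mulr1.
exact: le_trans (frob_ge0 _).
Qed.

End MaxGradNorm.

(** * The ordered spectrum of a symmetric matrix *)

Section SymmetricSpectrum.
Context {R : realType}.

Lemma char_poly_orthogonal m (Q : 'M[R]_m) (d : 'rV[R]_m) :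
  Q^T *m Q = 1%:M ->
  char_poly (Q^T *m diag_mx d *m Q) = \prod_i ('X - (d 0 i)%:P).
Proof.
move=> QTQ; transitivity (char_poly (diag_mx d)); last first.
  rewrite char_poly_trig ?diag_mx_is_trig//.
  by apply: eq_bigr => i _; rewrite mxE eqxx mulr1n.
rewrite /char_poly /char_poly_mx.
have PP : map_mx polyC Q^T *m map_mx polyC Q = 1%:M.
  by rewrite -map_mxM/= QTQ map_mx1.
have -> : 'X%:M - map_mx polyC (Q^T *m diag_mx d *m Q)
   = map_mx polyC Q^T *m ('X%:M - map_mx polyC (diag_mx d)) *m map_mx polyC Q.
  rewrite mulmxBr mulmxBl !map_mxM/=; congr (_ - _).
  by rewrite scalar_mxC -mulmxA PP mulmx1.
by rewrite !det_mulmx mulrAC -det_mulmx PP det1 mul1r.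
Qed.

(** [spectrum] is pinned down only through the characteristic polynomial. Equality of products of
    linear factors makes it a permutation of the diagonal given by [sym_spectral], and the
    permutation matrix is absorbed into [Q]. Sorting that diagonal shows that the default value is
    not taken. *)
Theorem spectrum_diag m (A : 'M[R]_m) : A^T = A ->
  exists Q : 'M[R]_m,
    [/\ Q^T *m Q = 1%:M, Q *m Q^T = 1%:M, size (spectrum A) = m,
        sorted >=%R (spectrum A)
      & A = Q^T *m diag_mx (\row_i (spectrum A)`_i) *m Q].
Proof.
move=> As; have [Q [d [QTQ QQT] AE]] := sym_spectral As.
have cA : char_poly A = \prod_(x <- [seq d 0 i | i <- enum 'I_m]) ('X - x%:P).
  by rewrite AE char_poly_orthogonal// big_map big_enum.
have [s_sorted sE] : sorted >=%R (spectrum A) /\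
    char_poly A = \prod_(x <- spectrum A) ('X - x%:P).
  rewrite /spectrum; case: xgetP => [s _ //|no].
  exfalso; apply: (no (sort >=%R [seq d 0 i | i <- enum 'I_m])); split.
    by apply: sort_sorted => x y; exact: le_total.
  by rewrite cA; apply: perm_big; rewrite perm_sym perm_sort.
have pm : perm_eq (spectrum A) [seq d 0 i | i <- enum 'I_m].
  by apply: prod_XsubC_eq; rewrite -sE.
have sz : size (spectrum A) = m by rewrite (perm_size pm) size_map size_enum_ord.
have [p pE] : exists p : {perm 'I_m}, forall i : 'I_m, (spectrum A)`_i = d 0 (p i).
  have /tuple_permP [p E] : perm_eq (spectrum A) (mktuple (d 0)) by [].
  exists p => i; rewrite E (nth_map i) ?size_enum_ord//.
  by rewrite tnth_mktuple nth_ord_enum.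
exists (perm_mx p *m Q); rewrite trmx_mul tr_perm_mx.
have PP : perm_mx p^-1 *m perm_mx p = 1%:M :> 'M[R]_m.
  by rewrite -perm_mxM mulVg perm_mx1.
have PP' : perm_mx p *m perm_mx p^-1 = 1%:M :> 'M[R]_m.
  by rewrite -perm_mxM mulgV perm_mx1.
split=> //.
- by rewrite mulmxA -(mulmxA Q^T) PP mulmx1.
- by rewrite mulmxA -(mulmxA _ Q) QQT mulmx1.
- rewrite [LHS]AE !mulmxA; congr (_ *m _); rewrite -!mulmxA; congr (_ *m _).
  apply/matrixP => i j; rewrite -[perm_mx p^-1 *m _]row_permE mxE.
  by rewrite mul_diag_mx !mxE pE permKV mulr_natr.
Qed.

End SymmetricSpectrum.

(** * Doubly stochastic matrices and the spectral gap *)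

Section DoublyStochastic.
Context {R : realType} {N : nat}.
Implicit Types (P W : 'M[R]_N) (u : 'cV[R]_N).

(** The part of [mixing_matrix] that is stable under powers. *)
Definition dstoch P := [/\ forall i j, 0 <= P i j, P^T = P &
  P *m const_mx 1 = const_mx 1 :> 'cV[R]_N].

Lemma dstoch_row P : dstoch P -> forall i, \sum_j P i j = 1.
Proof.
move=> [_ _ /matrixP h] i; have := h i 0; rewrite !mxE => <-.
by apply: eq_bigr => j _; rewrite mxE mulr1.
Qed.

Lemma dstoch_sym P i j : dstoch P -> P i j = P j i.
Proof. by move=> [_ /matrixP /(_ i j)]; rewrite mxE. Qed.

Lemma dstoch_col P : dstoch P -> forall j, \sum_i P i j = 1.
Proof.
move=> h j; rewrite -(dstoch_row h j); apply: eq_bigr => i _.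
exact: dstoch_sym.
Qed.

Lemma dstoch_mul P : dstoch P -> dstoch (P *m P).
Proof.
move=> [P0 PT P1]; split=> [i j||].
- by rewrite mxE sumr_ge0// => k _; rewrite mulr_ge0.
- by rewrite trmx_mul !PT.
- by rewrite -mulmxA !P1.
Qed.

Lemma dstochX P t : dstoch P -> dstoch (P ^+ t).
Proof.
move=> [P0 PT P1]; elim: t => [|t [Q0 QT Q1]].
  rewrite expr0; split=> [i j||].
  - by rewrite -[1]/(1%:M) mxE ler0n.
  - by rewrite -[1]/(1%:M) trmx1.
  - by rewrite -[1]/(1%:M) mul1mx.
split=> [i j||].
- by rewrite exprS -mulmxE mxE sumr_ge0// => k _; rewrite mulr_ge0.
- by rewrite exprSr -mulmxE trmx_mul PT QT mulmxE -exprS exprSr.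
- by rewrite exprS -mulmxE -mulmxA Q1 P1.
Qed.

Lemma mixing_dstoch (e : rel 'I_N) W : mixing_matrix e W -> dstoch W.
Proof.
move=> [W1 W2 W3 W4]; split=> // i j.
by case: (boolP (e i j || (i == j))) => h; [exact/ltW/W1 | rewrite W2].
Qed.

Lemma dirichlet P u : dstoch P ->
  dotm u u - dotm u (P *m u)
  = 2^-1 * \sum_i \sum_j P i j * (u i 0 - u j 0) ^+ 2.
Proof.
move=> hP.
have E1 : dotm u u = \sum_i \sum_j P i j * u i 0 ^+ 2.
  rewrite dotmE; apply: eq_bigr => i _.
  by rewrite big_ord1 -mulr_suml dstoch_row// mul1r.
have E2 : dotm u u = \sum_i \sum_j P i j * u j 0 ^+ 2.
  rewrite exchange_big dotmE; apply: eq_bigr => i _.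
  by rewrite big_ord1/= -mulr_suml dstoch_col// mul1r.
have E3 : dotm u (P *m u) = \sum_i \sum_j P i j * (u i 0 * u j 0).
  rewrite dotmE; apply: eq_bigr => i _; rewrite big_ord1 mxE mulr_sumr.
  by apply: eq_bigr => j _; ring.
have -> : \sum_i \sum_j P i j * (u i 0 - u j 0) ^+ 2
   = dotm u u + dotm u u - 2 * dotm u (P *m u); last by lra.
rewrite {1}E1 E2 E3 mulr_sumr -big_split -sumrB/=; apply: eq_bigr => i _.
rewrite mulr_sumr -big_split -sumrB/=; apply: eq_bigr => j _; ring.
Qed.

Lemma dstoch_le P u : dstoch P -> frob (P *m u) <= frob u.
Proof.
move=> hP; rewrite -(@ler_pXn2r _ 2) ?nnegrE ?frob_ge0// !frob_sqr.
rewrite dotm_mull; case: (hP) => _ -> _; rewrite mulmxA -subr_ge0.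
rewrite dirichlet ?mulr_ge0 ?sumr_ge0//; last exact: dstoch_mul.
move=> i _; apply: sumr_ge0 => j _.
by rewrite mulr_ge0 ?sqr_ge0//; case: (dstoch_mul hP).
Qed.

(** Preservation of the norm annihilates the Dirichlet form of [W *m W], which treats the
    eigenvalues 1 and -1 alike. Self-loops keep every edge visible there, as the entry at [i, j]
    contains [W i i * W i j]; connectivity then propagates equality. *)
Lemma mixing_const (e : rel 'I_N) W u : symmetric e ->
  (forall i j, connect e i j) -> mixing_matrix e W ->
  frob (W *m u) = frob u -> forall i j, u i 0 = u j 0.
Proof.
move=> _ hconn hW hu; have hP := mixing_dstoch hW.
have [W1 _ WT _] := hW; have [P2 _ _] := dstoch_mul hP.
have /eqP : dotm u u - dotm u (W *m W *m u) = 0.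
  rewrite -!frob_sqr -hu -mulmxA -{2}WT -dotm_mull -frob_sqr.
  by rewrite hu subrr.
rewrite (dirichlet _ (dstoch_mul hP)) mulf_eq0 invr_eq0 pnatr_eq0/=.
have t0 i j : 0 <= (W *m W) i j * (u i 0 - u j 0) ^+ 2.
  by rewrite mulr_ge0 ?sqr_ge0.
rewrite psumr_eq0 => [/allP h|i _]; last by apply: sumr_ge0 => j _.
have edge i j : e i j -> u i 0 = u j 0.
  move=> eij; have := h i (mem_index_enum _).
  rewrite psumr_eq0// => /allP /(_ j (mem_index_enum _)).
  rewrite mulf_eq0 sqrf_eq0 subr_eq0 => /orP [|/eqP//] /eqP.
  rewrite mxE => /eqP; rewrite psumr_eq0 => [/allP /(_ i (mem_index_enum _))|k _].
    have wii : 0 < W i i by rewrite W1// eqxx orbT.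
    have wij : 0 < W i j by rewrite W1// eij.
    by rewrite gt_eqF// mulr_gt0.
  by have [W0 _ _] := hP; rewrite mulr_ge0.
move=> i j; have /connectP [p pth ->] := hconn i j.
elim: p i pth => [//|k p IH] i /= /andP [eik /IH <-].
exact: edge.
Qed.

Lemma second_singular (e : rel 'I_N) W : (1 < N)%N -> symmetric e ->
  (forall i j, connect e i j) -> mixing_matrix e W ->
  let s2 := (singular_values W)`_1 in
  0 <= s2 < 1 /\
  forall u, \sum_i u i 0 = 0 -> frob (W *m u) <= s2 * frob u.
Proof.
move=> hN hsym hconn hW; have hP := mixing_dstoch hW.
have [_ WT W1] := hP.
have [|Q [QTQ QQT sz srt AE]] := @spectrum_diag _ _ (W^T *m W).
  by rewrite trmx_mul trmxK.
set s := spectrum (W^T *m W) in sz srt AE.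
have WQ u : dotm (W *m u) (W *m u) = \sum_(i < N) s`_i * ((Q *m u) i 0) ^+ 2.
  rewrite dotm_mull mulmxA {1}AE spectral_dotm; apply: eq_bigr => i _.
  by rewrite frob_sqr dotmE !big_ord1 !mxE expr2.
have QN (u : 'cV[R]_N) : dotm u u = \sum_i ((Q *m u) i 0) ^+ 2.
  rewrite -(dotm_isoL u u QTQ) dotmE; apply: eq_bigr => i _.
  by rewrite big_ord1 expr2.
pose q (i : 'I_N) : 'cV[R]_N := Q^T *m delta_mx i 0.
have qE (i j : 'I_N) : (Q *m q i) j 0 = (j == i)%:R.
  by rewrite /q mulmxA QQT mul1mx mxE andbT.
have q1 i : dotm (q i) (q i) = 1.
  rewrite QN (bigD1 i)//= qE eqxx expr1n big1 ?addr0// => j ji.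
  by rewrite qE (negbTE ji) expr0n.
have Wq i : dotm (W *m q i) (W *m q i) = s`_i.
  rewrite WQ (bigD1 i)//= qE eqxx expr1n mulr1 big1 ?addr0// => j ji.
  by rewrite qE (negbTE ji) expr0n mulr0.
have s0 (i : 'I_N) : 0 <= s`_i by rewrite -Wq dotm_ge0.
have s1 (i : 'I_N) : s`_i <= 1.
  by rewrite -Wq -(q1 i) -!frob_sqr ler_pXn2r ?nnegrE ?frob_ge0// dstoch_le.
pose o1 := Ordinal hN; pose o0 := Ordinal (ltnW hN).
have s2E : (singular_values W)`_1 = Num.sqrt s`_1.
  by rewrite /singular_values (nth_map 0) ?sz.
have smono (i : 'I_N) : i != o0 -> s`_i <= s`_1.
  move=> i0; have := sorted_leq_nth (rev_trans le_trans) (@lexx _ _) 0 srt.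
  move=> /(_ 1 i); rewrite !inE sz hN ltn_ord; apply => //.
  by rewrite lt0n; apply: contraNneq i0 => i0; apply/eqP/val_inj.
(* Were this value 1, the first one would be 1 too, and by [mixing_const] the two orthonormal
   eigenvectors [q o0] and [q o1] would both be constant vectors. *)
have s11 : s`_1 < 1.
  rewrite lt_def (s1 o1) andbT; apply/eqP => s1E.
  have s0E : s`_0 = 1.
    apply/eqP; rewrite eq_le (s1 o0)/= s1E.
    have := sorted_leq_nth (rev_trans le_trans) (@lexx _ _) 0 srt.
    by move=> /(_ 0 1); rewrite !inE sz hN (ltnW hN); apply.
  have c0 : forall i j, q o0 i 0 = q o0 j 0.
    by apply: (mixing_const hsym hconn hW); rewrite /frob -!/(dotm _ _) Wq q1 s0E.
  have c1 : forall i j, q o1 i 0 = q o1 j 0.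
    by apply: (mixing_const hsym hconn hW); rewrite /frob -!/(dotm _ _) Wq q1 -s1E.
  have ortho : dotm (q o0) (q o1) = 0.
    by rewrite {1}/q dotm_mull trmxK dotmE big1// => i _; rewrite big_ord1 qE
      mxE andbT; case: eqP => [->|_]; rewrite ?mulr0 ?mul0r.
  have sq (i : 'I_N) : (forall a b, q i a 0 = q i b 0) -> N%:R * q i o0 0 ^+ 2 = 1.
    move=> c; transitivity (\sum_(a < N) q i o0 0 ^+ 2).
      by rewrite sumr_const card_ord mulr_natl.
    rewrite -[RHS](q1 i) dotmE; by apply: eq_bigr => a _; rewrite big_ord1 expr2 (c a o0).
  have : N%:R * (q o0 o0 0 * q o1 o0 0) = 0.
    transitivity (\sum_(a < N) q o0 o0 0 * q o1 o0 0).
      by rewrite sumr_const card_ord mulr_natl.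
    rewrite -[RHS]ortho dotmE; by apply: eq_bigr => a _; rewrite big_ord1 (c0 a o0) (c1 a o0).
  move=> /eqP; rewrite !mulf_eq0 => /or3P [] /eqP z.
  - by have := sq _ c0; rewrite z mul0r => /eqP; rewrite eq_sym oner_eq0.
  - by have := sq _ c0; rewrite z expr0n mulr0 => /eqP; rewrite eq_sym oner_eq0.
  - by have := sq _ c1; rewrite z expr0n mulr0 => /eqP; rewrite eq_sym oner_eq0.
split; first by rewrite s2E sqrtr_ge0 -[X in _ < X]sqrtr1 ltr_sqrt.
move=> u u0; pose one : 'cV[R]_N := const_mx 1.
(* [W] fixes the constant vector, so its coordinates vanish wherever the eigenvalue is below 1. Only
   the coordinate [o0] remains; hence [q o0] spans the constants and a vector of zero sum has no
   component along it. *)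
have one_q (i : 'I_N) : i != o0 -> (Q *m one) i 0 = 0.
  move=> i0; have : \sum_(i < N) (1 - s`_i) * ((Q *m one) i 0) ^+ 2 = 0.
    under eq_bigr do rewrite mulrBl mul1r.
    by rewrite sumrB -QN -WQ W1 subrr.
  move=> /eqP; rewrite psumr_eq0 => [|j _]; last first.
    by rewrite mulr_ge0 ?sqr_ge0// subr_ge0.
  move=> /allP /(_ i (mem_index_enum _)); rewrite mulf_eq0 sqrf_eq0.
  move=> /orP [|/eqP//]; rewrite subr_eq0 => /eqP h.
  by have := smono i i0; rewrite -h leNgt s11.
have Qu0 : (Q *m u) o0 0 = 0.
  have : (Q *m one) o0 0 * (Q *m u) o0 0 = 0.
    rewrite -u0; transitivity (dotm one u); last first.
      by rewrite dotmE; apply: eq_bigr => i _; rewrite big_ord1 mxE mul1r.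
    rewrite -(dotm_isoL one u QTQ) dotmE (bigD1 o0)//= big_ord1 big1 ?addr0//.
    by move=> i i0; rewrite big_ord1 one_q// mul0r.
  move=> /eqP; rewrite mulf_eq0 => /orP [|/eqP//] /eqP z.
  have : dotm one one = 0.
    rewrite QN (bigD1 o0)//= z expr0n add0r big1// => i i0.
    by rewrite one_q// expr0n.
  move=> /eqP; rewrite dotm_eq0 => /eqP /matrixP /(_ o0 0).
  by rewrite !mxE => /eqP; rewrite oner_eq0.
rewrite -(@ler_pXn2r _ 2) ?nnegrE ?mulr_ge0 ?frob_ge0// ?s2E ?sqrtr_ge0//.
rewrite exprMn (sqr_sqrtr (s0 o1)) !frob_sqr WQ QN mulr_sumr.
apply: ler_sum => i _; have [->|i0] := eqVneq i o0.
  by rewrite Qu0 expr0n !mulr0.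
by rewrite ler_wpM2r ?sqr_ge0 ?smono.
Qed.

End DoublyStochastic.

(** * Mixing of stacked matrices *)

Section Mixing.
Context {R : realType} {n r N : nat}.
Implicit Types (X Z : 'I_N -> 'M[R]_(n, r)) (P W : 'M[R]_N).

Definition mix P X i : 'M[R]_(n, r) := \sum_j P i j *: X j.

Lemma frob_sqrD_weight m p (c : R) (A B : 'M[R]_(m, p)) : 0 < c ->
  frob (A + B) ^+ 2 <= (1 + c) * frob A ^+ 2 + (1 + c^-1) * frob B ^+ 2.
Proof.
move=> c0; have := dotm_ge0 (c *: A - B).
rewrite !frob_sqr !dotm_lin (dotmC B A) => h.
have k0 : 0 <= c^-1 by rewrite invr_ge0 ltW.
have := mulr_ge0 k0 h.
rewrite (_ : c^-1 * _ = c * dotm A A - 2 * dotm A B + c^-1 * dotm B B).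
  by lra.
by field; rewrite gt_eqF.
Qed.

Lemma mixD P X Z i : mix P (fun j => X j + Z j) i = mix P X i + mix P Z i.
Proof. by rewrite /mix -big_split; apply: eq_bigr => j _; rewrite scalerDr. Qed.

Lemma mix_const P (C : 'M[R]_(n, r)) i : dstoch P -> mix P (fun=> C) i = C.
Proof. by move=> hP; rewrite /mix -scaler_suml dstoch_row// scale1r. Qed.

Lemma sum_mix P X : dstoch P -> \sum_i mix P X i = \sum_i X i.
Proof.
move=> hP; rewrite /mix exchange_big; apply: eq_bigr => j _/=.
by rewrite -scaler_suml dstoch_col// scale1r.
Qed.

Lemma stack_frob2_ge0 X : 0 <= stack_frob2 X.
Proof. by apply: sumr_ge0 => i _; rewrite sqr_ge0. Qed.

Lemma stack_frob2_ge X i : frob (X i) ^+ 2 <= stack_frob2 X.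
Proof.
rewrite /stack_frob2 (bigD1 i)//= lerDl.
by apply: sumr_ge0 => j _; rewrite sqr_ge0.
Qed.

Lemma stack_frob2_coord X :
  stack_frob2 X = \sum_a \sum_b frob (\col_i X i a b) ^+ 2.
Proof.
rewrite /stack_frob2; under eq_bigr do rewrite frob_sqr dotmE.
rewrite exchange_big; apply: eq_bigr => a _/=.
rewrite exchange_big; apply: eq_bigr => b _/=.
rewrite frob_sqr dotmE; apply: eq_bigr => i _.
by rewrite big_ord1 !mxE.
Qed.

(** Each matrix entry gives a scalar vector indexed by agents. It has zero sum, [W] preserves this,
    and the scalar contraction can be iterated [t] times. *)
Lemma mix_contract W t (s : R) X : dstoch W -> 0 <= s ->
  (forall u : 'cV[R]_N, \sum_i u i 0 = 0 -> frob (W *m u) <= s * frob u) ->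
  \sum_i X i = 0 ->
  stack_frob2 (mix (W ^+ t) X) <= (s ^+ t) ^+ 2 * stack_frob2 X.
Proof.
move=> hW s0 hs X0; rewrite !stack_frob2_coord mulr_sumr; apply: ler_sum => a _.
rewrite mulr_sumr; apply: ler_sum => b _.
rewrite -exprMn ler_pXn2r ?nnegrE ?mulr_ge0 ?exprn_ge0 ?frob_ge0//.
have -> : \col_i mix (W ^+ t) X i a b = W ^+ t *m \col_i X i a b.
  apply/matrixP => i j; rewrite !mxE summxE; apply: eq_bigr => k _.
  by rewrite !mxE.
have u0 : \sum_i (\col_i X i a b) i 0 = 0.
  under eq_bigr do rewrite mxE.
  by rewrite -summxE X0 mxE.
have sum_W v : \sum_i (W *m v) i 0 = \sum_i v i 0 :> R.
  under eq_bigr do rewrite mxE.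
  rewrite exchange_big; apply: eq_bigr => j _.
  by rewrite -mulr_suml dstoch_col// mul1r.
have {}u0 k : \sum_i (W ^+ k *m \col_i X i a b) i 0 = 0.
  elim: k => [|k IH]; first by rewrite expr0 -[1]/(1%:M) mul1mx.
  by rewrite exprS -mulmxE -mulmxA sum_W.
elim: t => [|t IH].
  by rewrite !expr0 -[1 in X in frob X]/(1%:M) mul1mx mul1r.
rewrite exprS -mulmxE -mulmxA (le_trans (hs _ (u0 t)))//.
by rewrite exprS -mulrA ler_wpM2l.
Qed.

Lemma stack_frob2_center X : (0 < N)%N ->
  stack_frob2 (fun i => X i - avg X) <= stack_frob2 X.
Proof.
move=> N0; have Nn : (N%:R : R) != 0 by rewrite pnatr_eq0 -lt0n.
have E : \sum_i dotm (X i) (avg X) = N%:R * frob (avg X) ^+ 2.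
  rewrite -dotm_suml frob_sqr {2}/avg dotmZr dotmC -dotmZl -/(avg X).
  rewrite [X in dotm _ X](_ : _ = N%:R *: avg X); last first.
    by rewrite /avg scalerA mulfV// scale1r.
  by rewrite dotmZr.
have -> : stack_frob2 (fun i => X i - avg X)
   = stack_frob2 X - N%:R * frob (avg X) ^+ 2.
  transitivity (\sum_i (frob (X i) ^+ 2 + frob (avg X) ^+ 2 - 2 * dotm (X i) (avg X))).
    apply: eq_bigr => i _; move: (X i) (avg X) => a b.
    by rewrite !frob_sqr !dotm_lin (dotmC b); ring.
  rewrite sumrB big_split/= -[X in _ - X]mulr_sumr E sumr_const card_ord -[X in _ + X - _]mulr_natl.
  by rewrite -/(stack_frob2 X); ring.
by rewrite gerBl mulr_ge0 ?sqr_ge0.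
Qed.

Lemma sum_centered X : (0 < N)%N -> \sum_i (X i - avg X) = 0.
Proof.
move=> N0; rewrite sumrB sumr_const card_ord /avg -[X in _ - X]scaler_nat.
by rewrite scalerA mulfV ?scale1r ?subrr// pnatr_eq0 -lt0n.
Qed.

End Mixing.

Section SmallestEigenvalue.
Context {R : realType} {N : nat}.

(** Rayleigh quotient at a unit eigenvector, bounded by nonexpansiveness. It serves to obtain
    [Lt <= 2]. *)
Lemma dstoch_spectrum_ge (P : 'M[R]_N) (k : 'I_N) : dstoch P ->
  -1 <= (spectrum P)`_k.
Proof.
move=> hP; have [_ PT _] := hP.
have [Q [QTQ QQT _ _ PE]] := spectrum_diag PT.
pose q : 'cV[R]_N := Q^T *m delta_mx k 0.
have Qq (j : 'I_N) : frob (row j (Q *m q)) ^+ 2 = (j == k)%:R.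
  rewrite /q mulmxA QQT mul1mx frob_sqr dotmE !big_ord1 !mxE andbT.
  by case: (j == k); rewrite ?mulr1 ?mulr0.
have q1 : frob q = 1.
  apply/eqP; rewrite -(eqrXn2 (n := 2)) ?frob_ge0// expr1n.
  rewrite -(frob_isoL q QTQ) frob_row_sqr (bigD1 k)//= Qq eqxx big1 ?addr0//.
  by move=> j jk; rewrite Qq (negbTE jk).
have : dotm q (P *m q) = (spectrum P)`_k.
  rewrite {1}PE spectral_dotm (bigD1 k)//= Qq eqxx mulr1 mxE big1 ?addr0//.
  by move=> j jk; rewrite Qq (negbTE jk) mulr0.
move=> <-; have := cauchy_schwarz_abs q (P *m q).
rewrite ler_norml q1 mul1r => /andP[h _]; apply: le_trans h.
by rewrite lerN2 -q1 dstoch_le.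
Qed.

End SmallestEigenvalue.

(** * The projected averaging step *)

Section ConsensusStep.
Context {R : realType} {n r N : nat}.
Implicit Types (X Z : 'I_N -> 'M[R]_(n, r)) (P : 'M[R]_N) (H : 'M[R]_(n, r)).

(** A symmetric [Q] sees only the symmetric part of [X^T *m (X - Y)], and that part is half of the
    Gram matrix of [X - Y]. *)
Lemma stiefel_cross_dotm (X Y : 'M[R]_(n, r)) (Q : 'M[R]_r) :
  stiefel X -> stiefel Y -> Q^T = Q ->
  dotm (X - Y) (X *m Q) = 2^-1 * dotm ((X - Y)^T *m (X - Y)) Q.
Proof.
move=> hX hY hQ; rewrite dotmC dotm_mull; set K := X^T *m (X - Y).
have KT : dotm Q K^T = dotm Q K by rewrite -{1}hQ dotmT.
have -> : (X - Y)^T *m (X - Y) = K + K^T.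
  have := stiefel_sub_gram hX hY => E.
  have -> : (X - Y)^T *m (X - Y) = 2%:M - (X^T *m Y + Y^T *m X).
    by rewrite E opprB [RHS]addrC subrK.
  have -> : 2%:M = 1%:M + 1%:M :> 'M[R]_r by rewrite -raddfD.
  rewrite /K mulmxBr hX [(1%:M - _)^T]linearB/= trmx1 trmx_mul trmxK.
  by rewrite opprD addrACA.
by rewrite dotmDl (dotmC K Q) (dotmC K^T Q) KT; lra.
Qed.

(** Half of [X i *m pair_gram P X i] is the correction turning [mix P X i - X i] into its tangential
    part. *)
Definition pair_gram P X i : 'M[R]_r :=
  \sum_j P i j *: ((X i - X j)^T *m (X i - X j)).

Definition pair_energy P X i : R := \sum_j P i j * frob (X i - X j) ^+ 2.

Lemma pair_gram_sym P X i : (pair_gram P X i)^T = pair_gram P X i.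
Proof.
rewrite /pair_gram linear_sum; apply: eq_bigr => j _.
by rewrite linearZ/= trmx_mul trmxK.
Qed.

Lemma pair_energy_ge0 P X i : dstoch P -> 0 <= pair_energy P X i.
Proof. by move=> [P0 _ _]; apply: sumr_ge0 => j _; rewrite mulr_ge0 ?sqr_ge0. Qed.

Lemma frob_pair_gram P X i : dstoch P ->
  frob (pair_gram P X i) <= pair_energy P X i.
Proof.
move=> [P0 _ _]; rewrite (le_trans (frob_sum _ _ _))//; apply: ler_sum => j _.
rewrite frobZ ger0_norm// ler_wpM2l// (le_trans (frobM _ _))//.
by rewrite frobT expr2.
Qed.

Lemma mix_sub P X i : dstoch P ->
  mix P X i - X i = \sum_j P i j *: (X j - X i).
Proof.
move=> hP; under eq_bigr do rewrite scalerBr.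
by rewrite sumrB -scaler_suml dstoch_row// scale1r.
Qed.

Lemma proj_mix P X i : dstoch P -> (forall i, stiefel (X i)) ->
  proj_tangent (X i) (mix P X i)
  = (mix P X i - X i) + 2^-1 *: (X i *m pair_gram P X i).
Proof.
move=> hP hX; rewrite /proj_tangent -addrA; congr (_ + _).
have -> : (X i)^T *m mix P X i + (mix P X i)^T *m X i = 2%:M - pair_gram P X i.
  rewrite /mix [(\sum_j _)^T]linear_sum/= mulmx_sumr mulmx_suml -big_split/=.
  have -> : 2%:M = \sum_j P i j *: 2%:M :> 'M[R]_r.
    by rewrite -scaler_suml dstoch_row// scale1r.
  rewrite -sumrB.
  apply: eq_bigr => j _; rewrite [(_ *: _)^T]linearZ/= -scalemxAl -scalemxAr.
  by rewrite -scalerDr stiefel_sub_gram// scalerBr.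
rewrite mulmxBr scalerBr mul_mx_scalar scalerA mulVf ?pnatr_eq0// scale1r.
by rewrite opprB addrC.
Qed.

Lemma proj_mix_sqr P X i : dstoch P -> (forall i, stiefel (X i)) ->
  frob (proj_tangent (X i) (mix P X i)) ^+ 2 <= pair_energy P X i.
Proof.
move=> hP hX; have P0 : forall i j, 0 <= P i j by case: hP.
have -> : proj_tangent (X i) (mix P X i) = proj_tangent (X i) (mix P X i - X i).
  rewrite [RHS]proj_tangentB [proj_tangent (X i) (X i)]/proj_tangent hX.
  rewrite -raddfD/= mul_mx_scalar scalerA mulVf ?pnatr_eq0//.
  by rewrite scale1r subrr subr0.
rewrite mix_sub//.
apply: (@le_trans _ _ (frob (\sum_j P i j *: (X j - X i)) ^+ 2)).
  by rewrite ler_pXn2r ?nnegrE ?frob_ge0// proj_tangent_le.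
have := frob_wsum_sqr (index_enum 'I_N) (fun j => X j - X i) (P0 i).
rewrite dstoch_row// mul1r => /le_trans; apply.
by apply: ler_sum => j _; rewrite frobBC.
Qed.

(** Double stochasticity cancels the linear parts of the projected averages; only the quadratic
    normal corrections survive. *)
Lemma avg_proj_mix P X : dstoch P -> (forall i, stiefel (X i)) ->
  frob (avg (fun i => proj_tangent (X i) (mix P X i)))
  <= 2^-1 * (N%:R^-1 * \sum_i pair_energy P X i).
Proof.
move=> hP hX.
have -> : avg (fun i => proj_tangent (X i) (mix P X i))
    = avg (fun i => 2^-1 *: (X i *m pair_gram P X i)).
  rewrite /avg; congr (_ *: _); under eq_bigr do rewrite proj_mix//.
  by rewrite big_split sumrB/= sum_mix// subrr add0r.
rewrite (le_trans (frob_avg_le _))// mulrCA ler_wpM2l ?invr_ge0 ?ler0n//.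
rewrite mulr_sumr; apply: ler_sum => i _.
by rewrite frobZ ger0_norm// frob_isoL// ler_wpM2l// frob_pair_gram.
Qed.

(** On expanding the square, the pairing of the normal correction with the averaging direction is
    exactly minus half of [dotm Q Q], which outweighs the square of the correction. Its pairing with
    [X i - H] is of fourth order in the distances and is the only cost. *)
Lemma consensus_agent P X H i (a : R) : dstoch P ->
  (forall i, stiefel (X i)) -> stiefel H -> 0 <= a ->
  frob (X i - H + a *: proj_tangent (X i) (mix P X i)) ^+ 2
  <= frob ((1 - a) *: (X i - H) + a *: mix P (fun j => X j - H) i) ^+ 2
     + a / 2 * frob (X i - H) ^+ 2 * pair_energy P X i.
Proof.
move=> hP hX hH a0; rewrite proj_mix//.
have P0 : forall i j, 0 <= P i j by case: hP.
set D := mix P X i - X i; set Q := pair_gram P X i; set Z := X i - H.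
have -> : (1 - a) *: Z + a *: mix P (fun j => X j - H) i = Z + a *: D.
  have -> : mix P (fun j => X j - H) i = D + Z.
    by rewrite mixD mix_const// /D /Z addrA subrK.
  by rewrite (scalerDr a D Z) scalerBl scale1r (addrC (a *: D)) addrA subrK.
have hZ : dotm Z (X i *m Q) <= 2^-1 * frob Z ^+ 2 * pair_energy P X i.
  rewrite stiefel_cross_dotm ?pair_gram_sym// -mulrA ler_wpM2l//.
  rewrite (le_trans (cauchy_schwarz _ _))// ler_pM ?frob_ge0//.
    by rewrite (le_trans (frobM _ _))// frobT expr2.
  exact: frob_pair_gram.
have hD : dotm D (X i *m Q) = - (2^-1 * dotm Q Q).
  rewrite /D mix_sub// dotm_suml {2}/Q dotm_suml mulr_sumr -sumrN.
  apply: eq_bigr => j _; rewrite dotmZl -opprB dotmNl dotmZl.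
  by rewrite stiefel_cross_dotm ?pair_gram_sym//; ring.
have hQ : dotm (X i *m Q) (X i *m Q) = dotm Q Q by exact: dotm_isoL.
have Q0 := dotm_ge0 Q.
have e1 : frob (Z + a *: (D + 2^-1 *: (X i *m Q))) ^+ 2
   = frob (Z + a *: D) ^+ 2 + a * dotm Z (X i *m Q) + a ^+ 2 * dotm D (X i *m Q)
     + a ^+ 2 / 4 * dotm Q Q.
  move: hQ; move: (X i *m Q) (D) (Z) => T d z hT.
  rewrite !frob_sqr !dotm_lin hT (dotmC d z) (dotmC T z) (dotmC T d); lra.
rewrite e1 hD.
have := ler_wpM2l a0 hZ.
have : 0 <= a ^+ 2 * dotm Q Q by rewrite mulr_ge0 ?sqr_ge0.
by lra.
Qed.

Lemma pair_energy_sum P X H : dstoch P ->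
  \sum_i pair_energy P X i
  = 2 * stack_frob2 (fun i => X i - H)
    - 2 * \sum_i dotm (X i - H) (mix P (fun j => X j - H) i).
Proof.
move=> hP; pose Z i := X i - H.
have E1 : stack_frob2 Z = \sum_i \sum_j P i j * frob (Z i) ^+ 2.
  by apply: eq_bigr => i _; rewrite -mulr_suml dstoch_row// mul1r.
have E2 : stack_frob2 Z = \sum_i \sum_j P i j * frob (Z j) ^+ 2.
  rewrite exchange_big; apply: eq_bigr => i _/=.
  by rewrite -mulr_suml dstoch_col// mul1r.
rewrite -/(stack_frob2 Z) mulr2n mulrDl mul1r {1}E1 E2.
rewrite mulr_sumr -big_split -sumrB; apply: eq_bigr => i _/=.
rewrite /mix dotm_sumr mulr_sumr -big_split -sumrB; apply: eq_bigr => j _/=.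
have -> : X i - X j = Z i - Z j by rewrite /Z opprB addrA subrK.
rewrite dotmZr -/(Z i) -/(Z j); move: (Z i) (Z j) => a b.
by rewrite !frob_sqr !dotm_lin (dotmC b a); ring.
Qed.

End ConsensusStep.

(** * The averaged objective *)

Section AverageObjective.
Context {R : realType} {n r N : nat}.
Implicit Types (f : 'I_N -> 'M[R]_(n, r) -> R) (X : 'M[R]_(n, r)).

Lemma avg_obj_differentiable f X :
  (forall i, differentiable (f i) X) -> differentiable (avg_obj f) X.
Proof.
move=> df.
have -> : avg_obj f = N%:R^-1 \*: (\sum_i f i).
  by apply/funext => Y; rewrite /avg_obj/= fct_sumE.
apply: differentiableZ; apply: differentiable_sum => i; exact: df.
Qed.

Lemma grad_avg_obj f X : (forall i, differentiable (f i) X) ->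
  grad (avg_obj f) X = avg (fun i => grad (f i) X).
Proof.
move=> df; apply/matrixP => a b; rewrite !mxE summxE.
have -> : avg_obj f = N%:R^-1 \*: (\sum_i f i).
  by apply/funext => Y; rewrite /avg_obj/= fct_sumE.
have dv i : derivable (f i) X (delta_mx a b) by exact: diff_derivable.
rewrite deriveZ//=; last exact: derivable_sum.
rewrite derive_sum//; congr (_ * _); apply: eq_bigr => i _.
by rewrite mxE.
Qed.

Lemma rgrad_avg_obj f X : (forall i, differentiable (f i) X) ->
  rgrad (avg_obj f) X = avg (fun i => rgrad (f i) X).
Proof.
move=> df; rewrite /rgrad grad_avg_obj// /avg proj_tangentZ; congr (_ *: _).
apply: (big_morph (proj_tangent X)); first exact: proj_tangentD.
by rewrite -[0 in LHS](scale0r (0 : 'M[R]_(n, r))) proj_tangentZ scale0r.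
Qed.

Lemma grad_avg_obj_lip f L : (0 < N)%N ->
  (forall i X, differentiable (f i) X) ->
  (forall i X Y, frob (grad (f i) X - grad (f i) Y) <= L * frob (X - Y)) ->
  forall X Y, frob (grad (avg_obj f) X - grad (avg_obj f) Y) <= L * frob (X - Y).
Proof.
move=> N0 df hL X Y; rewrite !grad_avg_obj// -avgB.
exact: frob_avg_max.
Qed.

Lemma grad_avg_obj_bound f c X : (0 < N)%N ->
  (forall i, differentiable (f i) X) ->
  (forall i, op_bound (grad (f i) X) c) -> op_bound (grad (avg_obj f) X) c.
Proof.
move=> N0 df h u; rewrite grad_avg_obj// /avg -scalemxAl mulmx_suml.
exact: (frob_avg_max N0 (fun i => h i u)).
Qed.

End AverageObjective.

(** * Scalar recursions and inequalities *)

Lemma geometric_recursion_sum {R : realType} (q : R) (x y : nat -> R) m :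
  (forall k, x k.+1 <= q * x k + y k) ->
  (1 - q) * (\sum_(k < m.+1) x k) + q * x m <= x 0%N + \sum_(k < m) y k.
Proof.
move=> h; elim: m => [|m IH]; first by rewrite big_ord_recr !big_ord0/=; lra.
rewrite big_ord_recr [X in _ <= _ + X]big_ord_recr/=.
by have := h m; lra.
Qed.

Lemma frob_sqrD3 {R : realType} m p (A B C : 'M[R]_(m, p)) :
  frob (A + B + C) ^+ 2 <= 3 * (frob A ^+ 2 + frob B ^+ 2 + frob C ^+ 2).
Proof.
have := dotm_ge0 (A - B); have := dotm_ge0 (A - C); have := dotm_ge0 (B - C).
rewrite !frob_sqr !dotm_lin (dotmC B A) (dotmC C A) (dotmC C B); lra.
Qed.

(* The bookkeeping of the convergence proof, for scalar sequences: consensus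
   error [S], step size [V], tracking error [T], sampling noise [nu], squared
   gradient norm [g], tracking bias [D] and objective [F]. *)
Lemma telescoped_bound {R : realType} (a b LG d1 : R)
    (S V T nu g D F : nat -> R) (Fs : R) K :
  0 < a -> a <= 1 -> 0 < b -> 0 < LG -> 800 * (b * LG) <= a ^+ 4 ->
  1000 * d1 ^+ 2 <= 1 ->
  (forall k, 0 <= S k) -> (forall k, 0 <= V k) -> (forall k, 0 <= T k) ->
  (forall k, 0 <= nu k) -> (forall k, 0 <= g k) ->
  (forall k, a * S k.+1 <= a * (1 - a / 2) * S k + 13 / 3 * b ^+ 2 * V k) ->
  (forall k, T k.+1 <= T k / 4
     + 6 * (LG ^+ 2 * (6 * a ^+ 2 * S k + 2 * b ^+ 2 * V k) + nu k + nu k.+1)) ->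
  (forall k, D k <= 4 / 3 * T k + 12 * (nu k + LG ^+ 2 * S k + d1 ^+ 2 * g k)) ->
  (forall k, V k <= 3 / 2 * g k + 3 * D k) ->
  (forall k, 3 / 4 * (b * g k) <= F k - F k.+1 + 2 * (b * D k)
     + 13 / 100 * (b * V k) + a ^+ 2 * LG * (9 / 50 * S k.+1 + 9 / 2 * S k)) ->
  (forall k, Fs <= F k) ->
  b * (\sum_(k < K.+1) g k) <= 16 * (F 0%N - Fs + 3 * LG * S 0%N / a
     + b * T 0%N + 20 * b * (\sum_(k < K.+1) nu k)).
Proof.
move=> a0 a1 b0 LG0 hb hd S0 V0 T0 n0 g0 hS hT hD hV hF hFs.
pose s := \sum_(k < K.+2) S k; pose v := \sum_(k < K.+1) V k.
pose t := \sum_(k < K.+1) T k; pose u := \sum_(k < K.+1) nu k.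
pose G := \sum_(k < K.+1) g k; pose d := \sum_(k < K.+1) D k.
pose s1 := \sum_(k < K.+1) S k; pose s2 := \sum_(k < K.+1) S k.+1.
have s_s1 : s1 <= s by rewrite /s big_ord_recr/= lerDl.
have s_s2 : s2 <= s.
  rewrite /s big_ord_recl/= lerDr//.
have v0 : 0 <= v by exact: sumr_ge0.
have s10 : 0 <= s1 by exact: sumr_ge0.
have u0 : 0 <= u by exact: sumr_ge0.
have t0 : 0 <= t by exact: sumr_ge0.
have G0 : 0 <= G by exact: sumr_ge0.
have s0 : 0 <= s by exact: sumr_ge0.
have hs : a / 2 * (a * s) <= a * S 0%N + 13 / 3 * b ^+ 2 * v.
  have := @geometric_recursion_sum _ (1 - a / 2) (fun k => a * S k)
    (fun k => 13 / 3 * b ^+ 2 * V k) K.+1.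
  rewrite -!mulr_sumr -/s -/v => /(_ _)/le_trans h.
  have : 0 <= (1 - a / 2) * (a * S K.+1).
    by rewrite mulr_ge0 ?mulr_ge0 ?(ltW a0)//; lra.
  have := h _ _ (lexx _); rewrite (_ : 1 - (1 - a / 2) = a / 2); last by ring.
  have hS' k : a * S k.+1 <= (1 - a / 2) * (a * S k) + 13 / 3 * b ^+ 2 * V k.
    by have := hS k; lra.
  by move=> /(_ hS'); lra.
have ht : 3 / 4 * t <= T 0%N
   + 6 * (LG ^+ 2 * (6 * a ^+ 2 * s1 + 2 * b ^+ 2 * v) + 2 * u).
  pose y k := 6 * (LG ^+ 2 * (6 * a ^+ 2 * S k + 2 * b ^+ 2 * V k) + nu k + nu k.+1).
  have hT' k : T k.+1 <= 4^-1 * T k + y k by have := hT k; rewrite /y; lra.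
  have := geometric_recursion_sum K hT'; rewrite -/t.
  have -> : \sum_(k < K) y k = 6 * (LG ^+ 2 * (6 * a ^+ 2 * (\sum_(k < K) S k)
     + 2 * b ^+ 2 * (\sum_(k < K) V k)) + (\sum_(k < K) nu k + \sum_(k < K) nu k.+1)).
    rewrite -mulr_sumr; congr (_ * _).
    under eq_bigr do rewrite -addrA.
    by rewrite big_split/= -mulr_sumr big_split/= -!mulr_sumr big_split.
  have e1 : \sum_(k < K) S k <= s1 by rewrite /s1 big_ord_recr/= lerDl.
  have e2 : \sum_(k < K) V k <= v by rewrite /v big_ord_recr/= lerDl.
  have e3 : \sum_(k < K) nu k <= u by rewrite /u big_ord_recr/= lerDl.
  have e4 : \sum_(k < K) nu k.+1 <= u by rewrite /u big_ord_recl/= lerDr.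
  have e5 : LG ^+ 2 * (6 * a ^+ 2 * (\sum_(k < K) S k) + 2 * b ^+ 2 * (\sum_(k < K) V k))
     <= LG ^+ 2 * (6 * a ^+ 2 * s1 + 2 * b ^+ 2 * v).
    by rewrite ler_wpM2l ?sqr_ge0// lerD//; apply: ler_wpM2l => //;
       rewrite mulr_ge0 ?sqr_ge0.
  have := T0 K; move: e3 e4 e5; clear; lra.
have hd' : d <= 4 / 3 * t + 12 * (u + LG ^+ 2 * s1 + d1 ^+ 2 * G).
  rewrite /d /t /u /s1 /G !mulr_sumr -!big_split/= mulr_sumr -big_split/=.
  by apply: ler_sum => k _; exact: hD.
have hv : v <= 3 / 2 * G + 3 * d.
  rewrite /v /G /d !mulr_sumr -!big_split/=.
  by apply: ler_sum => k _; exact: hV.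
have hf : 3 / 4 * (b * G) <= F 0%N - F K.+1 + 2 * (b * d) + 13 / 100 * (b * v)
    + a ^+ 2 * LG * (9 / 50 * s2 + 9 / 2 * s1).
  have tele m : F 0%N - F m = \sum_(k < m) (F k - F k.+1).
    elim: m => [|m IH]; first by rewrite big_ord0 subrr.
    by rewrite big_ord_recr/= -IH addrA subrK.
  rewrite tele.
  rewrite /G /d /v /s1 /s2 !mulr_sumr -!big_split/= mulr_sumr -!big_split/=.
  by apply: ler_sum => k _; exact: hF.
have a2 : a ^+ 2 <= 1 by rewrite expr_le1 ?(ltW a0).
have a20 : 0 <= a ^+ 2 by exact: sqr_ge0.
have bL : 0 < b * LG by exact: mulr_gt0.
have a42 : a ^+ 4 <= a ^+ 2.
  by rewrite (exprM _ 2 2) expr2 -[leRHS]mulr1 ler_wpM2l.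
have hbL : 800 * (b * LG) <= a ^+ 2 by exact: le_trans a42.
(* [q] is the size at which consensus errors enter the descent inequality. By the summed recursion
   [hs] it costs only the initial error plus a small multiple of [b * v], and since
   [800 * (b * LG) <= a ^+ 2] it also dominates the consensus part of the tracking bias. *)
pose q := a ^+ 2 * (LG * s).
have Ls0 : 0 <= LG * s by rewrite mulr_ge0// ltW.
have hq : q <= 2 * (a * (LG * S 0%N)) + 13 / 1200 * (b * v).
  have h800 : 800 * (b * LG) <= 1 by exact: le_trans hbL a2.
  have : 0 <= (1 - 800 * (b * LG)) * (b * v).
    by rewrite mulr_ge0 ?subr_ge0 ?(mulr_ge0 (ltW b0)).
  have := ler_wpM2l (ltW LG0) hs; rewrite /q; clear; rewrite !exprS !expr0; lra.
have hp : 800 * (b * (LG ^+ 2 * s1)) <= q.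
  have h1 : b * LG * (LG * s1) <= b * LG * (LG * s).
    by rewrite ler_wpM2l ?(ltW bL)// ler_wpM2l// ltW.
  move: h1; have := ler_wpM2r Ls0 hbL; rewrite /q; clear.
  by rewrite !exprS !expr0; lra.
have hp6 : LG ^+ 2 * (6 * a ^+ 2 * s1) <= 6 * (LG ^+ 2 * s1).
  have : 0 <= (1 - a ^+ 2) * (LG ^+ 2 * s1).
    by rewrite mulr_ge0 ?(mulr_ge0 (sqr_ge0 _))// subr_ge0.
  by clear; lra.
have hbv : 1000 * (b * (LG ^+ 2 * (2 * b ^+ 2 * v))) <= b * v.
  have h1 : b * LG <= 1 / 800.
    by move: hbL a2; clear; lra.
  have h2 : b * LG * (b * LG) <= 1 / 800 * (1 / 800).
    by rewrite ler_pM// ltW.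
  have := ler_wpM2r (mulr_ge0 (ltW b0) v0) h2.
  have := mulr_ge0 (ltW b0) v0; clear; rewrite !exprS !expr0; lra.
have hdG : 1000 * (b * (d1 ^+ 2 * G)) <= b * G.
  have := ler_wpM2r (mulr_ge0 (ltW b0) G0) hd; clear; lra.
have bT := ler_wpM2l (ltW b0) ht.
have bD := ler_wpM2l (ltW b0) hd'.
have bV := ler_wpM2l (ltW b0) hv.
have bp6 := ler_wpM2l (ltW b0) hp6.
have q1 : a ^+ 2 * LG * (9 / 50 * s2 + 9 / 2 * s1) <= 117 / 25 * q.
  have h0 : 0 <= a ^+ 2 * LG by rewrite mulr_ge0// ltW.
  have := ler_wpM2l h0 s_s1; have := ler_wpM2l h0 s_s2; rewrite /q; clear; lra.
have bu : 0 <= b * u by rewrite mulr_ge0// ltW.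
have bt0 : 0 <= b * T 0%N by rewrite mulr_ge0// ltW.
have LS : 0 <= LG * S 0%N by rewrite mulr_ge0// ltW.
have haS : a * (LG * S 0%N) <= LG * S 0%N / a.
  rewrite ler_pdivlMr// mulrAC -expr2 ler_piMl//.
have LSa : 0 <= LG * S 0%N / a by rewrite divr_ge0// ltW.
have bG0 : 0 <= b * G by rewrite mulr_ge0// ltW.
rewrite -/G -/u.
have -> : 3 * LG * S 0%N / a = 3 * (LG * S 0%N / a) by ring.
move: (hFs 0%N) (hFs K.+1).
move: hf q1 hq hp hbv hdG bT bD bV bp6 bu bt0 LSa haS bG0; clear.
by lra.
Qed.

(** Weight 1/3 in Young's inequality gives the factors 4/3 and 4; squaring a sum of three terms
    turns 4 into 12. *)
Lemma young_bias {R : realType} (V x1 x2 y w : R) : 0 <= V ->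
  V <= y + (x1 + x2 + w) ->
  V ^+ 2 <= 4 / 3 * y ^+ 2 + 12 * (x1 ^+ 2 + x2 ^+ 2 + w ^+ 2).
Proof.
move=> V0 h; have := ler_pM V0 V0 h h.
have := sqr_ge0 (y - 3 * (x1 + x2 + w)).
have := sqr_ge0 (x1 - x2); have := sqr_ge0 (x1 - w); have := sqr_ge0 (x2 - w).
by clear; rewrite !exprS !expr0; lra.
Qed.

(** [p] and [q] bound the consensus part and the retraction part of the deviation of the mean from
    its gradient step. Assumption [c3] makes [q] small against the step, and [c1] bounds [p ^+ 2] by
    [b] times the consensus errors that the conclusion tolerates. Products with [g] are then split
    by Young's inequality. *)
Lemma descent_scalar {R : realType} (a b LG A M d1 S S' V D g F F' dot dn : R) :
  let p := S' / 2 + 8 * S in let q := 2 * (M * b ^+ 2 * V) in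
  0 < a -> 0 < b -> 0 < LG -> 0 <= A -> 0 <= M -> 0 <= S -> 0 <= S' -> 0 <= V ->
  0 <= g -> g <= A -> S <= d1 ^+ 2 -> S' <= d1 ^+ 2 -> V <= 81 * A ^+ 2 ->
  32 * d1 ^+ 2 <= a ^+ 2 * (b * LG) -> 16 * (b * M * A) <= 1 ->
  800 * (b * LG) <= 1 ->
  F' <= F + dot + LG / 2 * dn ^+ 2 ->
  dot <= g * (p + q) - b * (7 / 8 * g ^+ 2 - 2 * D) ->
  dn ^+ 2 <= 2 * (p + q) ^+ 2 + 2 * (b ^+ 2 * V) ->
  3 / 4 * (b * g ^+ 2) <= F - F' + 2 * (b * D) + 13 / 100 * (b * V)
    + a ^+ 2 * LG * (9 / 50 * S' + 9 / 2 * S).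
Proof.
move=> p q a0 b0 LG0 A0 M0 S0 S0' V0 g0 gA hS hS' hV c1 c3 bL800 desc i1 i2.
have q0 : 0 <= q by rewrite /q !mulr_ge0 ?(ltW b0).
have bMA0 : 0 <= b * M * A by rewrite mulr_ge0 ?mulr_ge0 ?(ltW b0).
have i3 : g * q <= b * V / 8.
  have h1 : g * q <= A * q by rewrite ler_wpM2r.
  have h2 := ler_wpM2r (mulr_ge0 (ltW b0) V0) c3.
  by move: h1 h2; rewrite /q; clear; rewrite !exprS !expr0; lra.
have i4 : q ^+ 2 <= 81 / 64 * (b ^+ 2 * V).
  have h1 : 16 * (b * M * A) * (16 * (b * M * A)) <= 1 * 1.
    by rewrite ler_pM// mulr_ge0.
  have bv0 : 0 <= b ^+ 2 * V by rewrite mulr_ge0 ?sqr_ge0.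
  have m0 : 0 <= (M * b) ^+ 2 by rewrite sqr_ge0.
  have h2 := ler_wpM2r bv0 h1.
  have h3 := ler_wpM2l (mulr_ge0 m0 bv0) hV.
  by move: h2 h3; rewrite /q; clear; rewrite !exprS !expr0; lra.
have c0 : 0 <= 11 / 4 * S' + 352 / 5 * S by move: S0 S0'; clear; lra.
have i5 : 32 * p ^+ 2 <= b * (a ^+ 2 * LG * (11 / 4 * S' + 352 / 5 * S)).
  have h1 : p ^+ 2 <= 11 / 4 * S' ^+ 2 + 352 / 5 * S ^+ 2.
    have := sqr_ge0 (5 * S' - 8 * S).
    by rewrite /p; clear; rewrite !exprS !expr0; lra.
  have h2 : 11 / 4 * S' ^+ 2 + 352 / 5 * S ^+ 2
     <= (11 / 4 * S' + 352 / 5 * S) * d1 ^+ 2.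
    have := ler_wpM2l S0 hS; have := ler_wpM2l S0' hS'.
    by rewrite !expr2; clear; lra.
  have h3 := ler_wpM2l c0 c1.
  by move: h1 h2 h3; clear; lra.
have aL0 : 0 <= a ^+ 2 * LG by rewrite mulr_ge0 ?sqr_ge0 ?(ltW LG0).
have i6 : g * p <= b * g ^+ 2 / 8
    + a ^+ 2 * LG / 16 * (11 / 4 * S' + 352 / 5 * S).
  rewrite -(ler_pM2l b0); move: i5; have := sqr_ge0 (b * g - 4 * p).
  by clear; rewrite !exprS !expr0; lra.
have i7 : LG * p ^+ 2 <= a ^+ 2 * LG / 32 / 800 * (11 / 4 * S' + 352 / 5 * S).
  have := ler_wpM2l (ltW LG0) i5; have := ler_wpM2r (mulr_ge0 aL0 c0) bL800.
  by clear; rewrite !exprS !expr0; lra.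
have i8 : LG * (b ^+ 2 * V) <= b * V / 800.
  have := ler_wpM2r (mulr_ge0 (ltW b0) V0) bL800.
  by clear; rewrite !exprS !expr0; lra.
have i9 := ler_wpM2l (ltW LG0) i2.
have i10 : (p + q) ^+ 2 <= 2 * p ^+ 2 + 2 * q ^+ 2.
  by have := sqr_ge0 (p - q); clear; rewrite !exprS !expr0; lra.
have i11 := ler_wpM2l (ltW LG0) i10.
have i12 := ler_wpM2l (ltW LG0) i4.
have bg0 : 0 <= b * g ^+ 2 by rewrite mulr_ge0 ?sqr_ge0 ?(ltW b0).
have bV0 : 0 <= b * V by rewrite mulr_ge0 ?(ltW b0).
have aS0 := mulr_ge0 aL0 S0; have aS0' := mulr_ge0 aL0 S0'.
move: desc i1 i3 i6 i7 i8 i9 i11 i12 bg0 bV0 aS0 aS0'.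
by clear; lra.
Qed.

(** * One iteration, and then the whole trajectory *)

Section OneStep.
Context {R : realType} {n r N : nat}.
Implicit Types (X Y Z v : 'I_N -> 'M[R]_(n, r)) (H : 'M[R]_(n, r)).

Definition msq Z : R := N%:R^-1 * stack_frob2 Z.

Lemma msq_ge0 Z : 0 <= msq Z.
Proof. by rewrite mulr_ge0 ?invr_ge0 ?ler0n ?stack_frob2_ge0. Qed.

Lemma msq_le Z Z' (c : R) : (forall i, frob (Z i) ^+ 2 <= c * frob (Z' i) ^+ 2) ->
  msq Z <= c * msq Z'.
Proof.
move=> h; rewrite /msq mulrCA ler_wpM2l ?invr_ge0 ?ler0n//.
by rewrite mulr_sumr; apply: ler_sum => i _.
Qed.

Lemma msqD_le Z Z' (c : R) : 0 < c ->
  msq (fun i => Z i + Z' i) <= (1 + c) * msq Z + (1 + c^-1) * msq Z'.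
Proof.
move=> c0; rewrite /msq mulrCA (mulrCA (1 + c^-1)) -mulrDr.
rewrite ler_wpM2l ?invr_ge0 ?ler0n// !mulr_sumr -big_split/=.
by apply: ler_sum => i _; exact: frob_sqrD_weight.
Qed.

Variables (hN : (1 < N)%N) (P : 'M[R]_N) (k2 M a b LG A d1 d2 : R).
Hypotheses (hP : dstoch P)
  (hk : forall Z, \sum_i Z i = 0 -> stack_frob2 (mix P Z) <= k2 * stack_frob2 Z)
  (k20 : 0 <= k2) (k28 : k2 <= 1 / 8) (k2N : N%:R * k2 <= 1 / 4)
  (M0 : 0 < M)
  (hM : forall X v : 'M[R]_(n, r), stiefel X -> tangent X v ->
     frob (polar_retraction X v - (X + v)) <= M * frob v ^+ 2)
  (a0 : 0 < a) (a1 : a <= 1) (aM : a * M <= 1) (b0 : 0 < b) (LG0 : 0 < LG)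
  (A0 : 0 <= A) (d10 : 0 < d1) (d12 : 5 * d1 <= d2) (d26 : d2 <= 1 / 6)
  (c1 : 32 * d1 ^+ 2 <= a ^+ 2 * (b * LG)) (c3 : 16 * (b * M * A) <= 1)
  (c4 : 5 * (b * LG) + 50 * (b * A) <= a * d1).

Ltac slra := move: (A0) (c1) (c3) (c4) (a0) (a1) (d10) (d12) (d26); lra.
Let N0 : (0 < N)%N. Proof. exact: ltnW. Qed.
Let Np : 0 < (N%:R : R). Proof. by rewrite ltr0n. Qed.

Let Ni0 : 0 <= (N%:R : R)^-1. Proof. by rewrite invr_ge0 ltW. Qed.

Lemma regime_bLG : 0 < b * LG. Proof. exact: mulr_gt0. Qed.
Lemma regime_bA : 0 <= b * A. Proof. by rewrite mulr_ge0// ltW. Qed.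

(** [c1] bounds [d1 ^+ 2] above by [b * LG] and [c4] bounds [b * LG] above by [d1]; chaining the two
    and dividing by [d1] leaves a pure smallness condition in [a]. *)
Lemma regime_d1 : 160 * d1 <= a ^+ 3.
Proof.
have h : 5 * (b * LG) <= a * d1 by have := regime_bA; slra.
have : a ^+ 2 * (5 * (b * LG)) <= a ^+ 2 * (a * d1) by rewrite ler_wpM2l ?sqr_ge0.
move=> h2; rewrite -(ler_pM2r d10); slra.
Qed.

Lemma regime_d1a : 160 * d1 <= a.
Proof.
have : a ^+ 2 <= 1 by rewrite expr_le1 ?(ltW a0).
have := regime_d1; rewrite exprS => h /(ler_wpM2l (ltW a0)); slra.
Qed.

Lemma regime_b : 800 * (b * LG) <= a ^+ 4.
Proof.
have : a * (160 * d1) <= a * a ^+ 3 by rewrite ler_wpM2l ?regime_d1 ?ltW.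
by rewrite -exprS; have := regime_bA; slra.
Qed.

Lemma regime_d1sq : 160 * d1 ^+ 2 <= a * d1.
Proof. by rewrite expr2 mulrA ler_wpM2r ?regime_d1a ?ltW. Qed.

Lemma regime_d1_small : 1000 * d1 ^+ 2 <= 1.
Proof.
have h : 160 * d1 <= 1 by have := regime_d1a; slra.
have h0 : 0 <= 160 * d1 by exact: mulr_ge0 (ler0n _ _) (ltW d10).
have := ler_pM h0 h0 h h.
by rewrite expr2; slra.
Qed.

Section AtState.
Variables (X Y : 'I_N -> 'M[R]_(n, r)) (H : 'M[R]_(n, r)).
Hypotheses (hX : forall i, stiefel (X i)) (hH : is_iam X H).
Let Z i := X i - H.
Let S := msq Z.
Let v i := proj_tangent (X i) (Y i).
Let V := msq v.
Let w i := proj_tangent (X i) (mix P X i).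
Let X' i := polar_retraction (X i) (a *: w i - b *: v i).

Let HS : stiefel H. Proof. by case: hH. Qed.

Let ht i : tangent (X i) (a *: w i - b *: v i).
Proof. by apply: tangentB; apply: tangentZ; exact: proj_tangentP. Qed.

Lemma step_stiefel i : stiefel (X' i).
Proof. exact: polar_stiefel. Qed.

Hypotheses (hS : S <= d1 ^+ 2) (hZ : forall i, frob (Z i) <= d2)
  (hY : forall i, frob (Y i) <= 9 * A).

Lemma step_avgZ : frob (avg Z) <= S / 2.
Proof.
rewrite /Z avgB avg_const// frobBC mulrC.
exact: iam_avg M0 hM hX hH.
Qed.

Lemma step_S_ge0 : 0 <= S. Proof. exact: msq_ge0. Qed.

Lemma step_avgZ_sqr : 4000 * frob (avg Z) ^+ 2 <= S.
Proof.
have h0 := frob_ge0 (avg Z).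
have h1 : frob (avg Z) * frob (avg Z) <= S / 2 * (S / 2).
  by rewrite ler_pM// step_avgZ.
have h2 : S * S <= S * d1 ^+ 2 by rewrite ler_wpM2l ?step_S_ge0.
have h3 : S * (1000 * d1 ^+ 2) <= S * 1.
  by rewrite ler_wpM2l ?step_S_ge0 ?regime_d1_small.
by have := step_S_ge0; rewrite expr2; slra.
Qed.

(** Mixing contracts only the centred part, while [avg Z] passes through unchanged but is already
    quadratic. With weight 1/10 the sum is [11/10 * 1/8 + 11/4000], below 71/500. *)
Lemma step_mixZ : msq (mix P Z) <= 71 / 500 * S.
Proof.
pose Z0 i := Z i - avg Z.
have -> : msq (mix P Z) = msq (fun i => mix P Z0 i + avg Z).
  congr (_ * _); apply: eq_bigr => i _; congr (frob _ ^+ 2).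
  by rewrite -[in RHS](mix_const (avg Z) i hP) -mixD; apply: eq_bigr => j _;
     rewrite /Z0 subrK.
have h := @msqD_le (mix P Z0) (fun=> avg Z) (1/10) _.
rewrite (le_trans (h _))//.
have h1 : msq (mix P Z0) <= 1 / 8 * S.
  rewrite /S /msq mulrCA ler_wpM2l ?Ni0//.
  apply: (le_trans (hk (sum_centered Z N0))).
  by rewrite ler_pM ?stack_frob2_ge0// stack_frob2_center.
have h2 : msq (fun=> avg Z) = frob (avg Z) ^+ 2.
  rewrite /msq /stack_frob2 sumr_const card_ord -[X in _ * X]mulr_natl mulKf//.
  by rewrite gt_eqF.
have := step_avgZ_sqr; have := step_S_ge0.
by rewrite h2 invf_div; slra.
Qed.

Lemma step_energy : N%:R^-1 * \sum_i pair_energy P X i <= 3 * S.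
Proof.
rewrite (pair_energy_sum X H hP) mulrBr mulrCA -/(msq _) -/S.
have : - (N%:R^-1 * (2 * \sum_i dotm (X i - H) (mix P (fun j => X j - H) i)))
   <= 2 / 5 * S + 5 / 2 * msq (mix P Z).
  rewrite /S /msq (mulrCA (2 / 5)) (mulrCA (5 / 2)) -mulrDr -mulrN.
  rewrite ler_wpM2l ?Ni0// !mulr_sumr -sumrN -big_split/=.
  apply: ler_sum => i _; rewrite -/(Z i) -/Z; move: (Z i) (mix P Z i) => z m.
  have := dotm_ge0 (2 *: z + 5 *: m).
  by rewrite !frob_sqr !dotm_lin (dotmC m z); slra.
by have := step_mixZ; have := step_S_ge0; slra.
Qed.

Lemma step_v i : frob (v i) <= 9 * A.
Proof. by rewrite (le_trans (proj_tangent_le _ (hX i))). Qed.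

Lemma step_V_ge0 : 0 <= V. Proof. exact: msq_ge0. Qed.

Lemma step_V : V <= 81 * A ^+ 2.
Proof.
rewrite /V /msq ler_pdivrMl//.
have -> : N%:R * (81 * A ^+ 2) = \sum_(i < N) 81 * A ^+ 2.
  by rewrite sumr_const card_ord mulr_natl.
apply: ler_sum => i _; have := step_v i; have := frob_ge0 (v i) => h0 h1.
have := ler_pM h0 h0 h1 h1; rewrite -expr2; slra.
Qed.

Lemma step_u : msq (fun i => a *: w i - b *: v i) <= 6 * a ^+ 2 * S + 2 * b ^+ 2 * V.
Proof.
have h := @msqD_le (fun i => a *: w i) (fun i => - (b *: v i)) 1 ltr01.
rewrite (le_trans h)//.
have h1 : msq (fun i => a *: w i) <= a ^+ 2 * (3 * S).
  apply: (@le_trans _ _ (a ^+ 2 * msq w)).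
    by apply: msq_le => i; rewrite frobZ exprMn real_normK ?num_real.
  rewrite ler_wpM2l ?sqr_ge0//; apply: le_trans step_energy.
  rewrite ler_wpM2l ?Ni0//; apply: ler_sum => i _.
  exact: proj_mix_sqr.
have h2 : msq (fun i => - (b *: v i)) <= b ^+ 2 * V.
  by apply: msq_le => i; rewrite frobN frobZ exprMn real_normK ?num_real.
by rewrite invr1; slra.
Qed.

Lemma step_disp : msq (fun i => X' i - X i) <= 6 * a ^+ 2 * S + 2 * b ^+ 2 * V.
Proof.
apply: le_trans step_u; rewrite -[leRHS]mul1r; apply: msq_le => i.
rewrite mul1r ler_pXn2r ?nnegrE ?frob_ge0//.
rewrite (le_trans (polar_nonexpansive (hX i) (ht i) (hX i)))//.
by rewrite addrAC subrr add0r.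
Qed.

(** Since [d2 <= 1 / 6], the fourth-order term is at most [a / 72] times the pair energy. The gain
    is [1 - 71/500 - 3/72], which exceeds 4/5. *)
Lemma step_mix_contract :
  msq (fun i => Z i + a *: w i) <= (1 - 4 / 5 * a) * S.
Proof.
have key i : frob (Z i + a *: w i) ^+ 2
   <= (1 - a) * frob (Z i) ^+ 2 + a * frob (mix P Z i) ^+ 2
      + a / 72 * pair_energy P X i.
  rewrite (le_trans (consensus_agent i hP hX HS (ltW a0)))// -/Z -/(Z i).
  have E0 := pair_energy_ge0 X i hP.
  have zd : frob (Z i) ^+ 2 <= 1 / 36.
    have z0 := frob_ge0 (Z i); have z1 : frob (Z i) <= 1 / 6 by rewrite (le_trans (hZ i)).
    by have := ler_pM z0 z0 z1 z1; rewrite -expr2; slra.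
  have : a / 2 * frob (Z i) ^+ 2 * pair_energy P X i <= a / 72 * pair_energy P X i.
    rewrite ler_wpM2r//; have := ler_wpM2l (ltW a0) zd; slra.
  have : frob ((1 - a) *: Z i + a *: mix P Z i) ^+ 2
     <= (1 - a) * frob (Z i) ^+ 2 + a * frob (mix P Z i) ^+ 2.
    move: (Z i) (mix P Z i) => z m.
    have := dotm_ge0 (z - m); rewrite !frob_sqr !dotm_lin (dotmC m z) => h.
    have : 0 <= (1 - a) * a * (dotm z z - dotm z m - (dotm z m - dotm m m)).
      rewrite mulr_ge0 ?mulr_ge0 ?subr_ge0 ?(ltW a0)//; slra.
    by slra.
  by slra.
have : msq (fun i => Z i + a *: w i) <= (1 - a) * S + a * msq (mix P Z)
    + a / 72 * (N%:R^-1 * \sum_i pair_energy P X i).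
  rewrite /S /msq !(mulrCA _ N%:R^-1) -!mulrDr ler_wpM2l ?Ni0//.
  rewrite !mulr_sumr -!big_split/=; apply: ler_sum => i _; exact: key.
have := ler_wpM2l (ltW a0) step_mixZ; have := ler_wpM2l (ltW a0) step_energy.
by have := mulr_ge0 (ltW a0) step_S_ge0; slra.
Qed.

Section NextMean.
Variable H' : 'M[R]_(n, r).
Hypothesis hH' : is_iam X' H'.
Let S' := msq (fun i => X' i - H').

Let HS' : stiefel H'. Proof. by case: hH'. Qed.

Lemma step_consensus : a * S' <= a * (1 - a / 2) * S + 13 / 3 * b ^+ 2 * V.
Proof.
(* Minimality of the new mean allows comparison with the old one, so its motion need not be
   controlled here. *)
have h1 : S' <= msq (fun i => X' i - H).
  rewrite /S' /msq ler_wpM2l ?Ni0//.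
  case: hH' => _ /(_ _ HS); rewrite /stack_frob2.
  under eq_bigr do rewrite frobBC.
  by under [leRHS]eq_bigr do rewrite frobBC.
have h2 : msq (fun i => X' i - H)
    <= msq (fun i => (Z i + a *: w i) + - (b *: v i)).
  rewrite -[leRHS]mul1r; apply: msq_le => i.
  rewrite mul1r ler_pXn2r ?nnegrE ?frob_ge0//.
  rewrite (le_trans (polar_nonexpansive (hX i) (ht i) HS))//.
  by rewrite /Z addrAC addrA.
(* With this weight [(1 + 3/10 * a) * (1 - 4/5 * a) <= 1 - a / 2], and the other factor, multiplied
   by [a], is [a + 10/3 <= 13/3]. *)
have a3 : 0 < 3 / 10 * a by rewrite mulr_gt0.
have h3 := msqD_le (fun i => Z i + a *: w i) (fun i => - (b *: v i)) a3.
have h4 : msq (fun i => - (b *: v i)) <= b ^+ 2 * V.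
  by apply: msq_le => i; rewrite frobN frobZ exprMn real_normK ?num_real.
have h5 : S' <= (1 + 3 / 10 * a) * ((1 - 4 / 5 * a) * S)
            + (1 + (3 / 10 * a)^-1) * (b ^+ 2 * V).
  have i0 : 0 <= (3 / 10 * a)^-1 by rewrite invr_ge0 ltW.
  apply: (le_trans h1); apply: (le_trans h2); apply: (le_trans h3).
  rewrite lerD// ler_wpM2l ?addr_ge0 ?step_mix_contract//.
  by rewrite ltW.
have := ler_wpM2l (ltW a0) h5; rewrite mulrDr.
have -> : a * ((1 + (3 / 10 * a)^-1) * (b ^+ 2 * V)) = (a + 10 / 3) * (b ^+ 2 * V).
  by field; rewrite gt_eqF.
have bV : 0 <= b ^+ 2 * V by rewrite mulr_ge0 ?sqr_ge0 ?step_V_ge0.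
have := ler_wpM2r bV a1.
have aaS : 0 <= a ^+ 2 * S by rewrite mulr_ge0 ?sqr_ge0 ?step_S_ge0.
have aaaS : 0 <= a * (a ^+ 2 * S) by rewrite mulr_ge0// ltW.
by rewrite !exprS expr0 in aaaS aaS *; slra.
Qed.

(** The contraction frees [a ^+ 2 * d1 ^+ 2 / 2], while the gradient step uses at most
    [351 * (b * A) ^+ 2], and [50 * (b * A) <= a * d1]. *)
Lemma step_region1 : S' <= d1 ^+ 2.
Proof.
rewrite -(ler_pM2l a0) (le_trans step_consensus)//.
have h1 : a * (1 - a / 2) * S <= a * (1 - a / 2) * d1 ^+ 2.
  by rewrite ler_wpM2l// mulr_ge0 ?(ltW a0)//; slra.
have h2 : b ^+ 2 * V <= 81 * (b * A) ^+ 2.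
  by rewrite exprMn [leRHS]mulrCA ler_wpM2l ?sqr_ge0// step_V.
have h3 : 50 * (b * A) <= a * d1 by have := regime_bLG; slra.
have p0 : 0 <= 50 * (b * A) by rewrite mulr_ge0// regime_bA.
have := ler_pM p0 p0 h3 h3.
have : 0 <= (a * d1) * (a * d1) by rewrite -expr2 sqr_ge0.
by rewrite !exprS !expr0 in h1 h2 *; slra.
Qed.

(** Four quadratic errors add up: the offsets between induced and arithmetic mean after and before
    the step ([S' / 2] and [S / 2]), the averaged consensus drift ([3 / 2 * S]) and the retraction
    error, in which [a * M <= 1] absorbs [M] from the consensus part. *)
Lemma step_mean : frob (H' - H + b *: avg v)
  <= S' / 2 + 8 * S + 2 * (M * b ^+ 2 * V).
Proof.
pose e i := X' i - (X i + (a *: w i - b *: v i)).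
have E : H' - H + b *: avg v = (H' - avg X') + avg Z + (a *: avg w) + avg e.
  have -> : avg e = avg X' - (avg X + (a *: avg w - b *: avg v)).
    by rewrite avgB avgD avgB !avgZ.
  rewrite [avg Z]avgB avg_const//.
  move: (avg X') (avg X) (avg w) (avg v) => p q s t.
  by apply/matrixP => i j; rewrite !mxE; ring.
have e1 : frob (H' - avg X') <= S' / 2.
  by rewrite mulrC; exact: iam_avg M0 hM step_stiefel hH'.
have e2 := step_avgZ.
have e3 : frob (a *: avg w) <= 3 / 2 * S.
  rewrite frobZ gtr0_norm//; apply: (@le_trans _ _ (1 * (2^-1 * (3 * S)))); last by slra.
  rewrite ler_pM ?frob_ge0 ?(ltW a0)//.
  rewrite (le_trans (avg_proj_mix hP hX))// ler_wpM2l//.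
  exact: step_energy.
have e4 : frob (avg e) <= 6 * S + 2 * (M * b ^+ 2 * V).
  have h1 : frob (avg e) <= M * msq (fun i => a *: w i - b *: v i).
    rewrite (le_trans (frob_avg_le _))// /msq mulrCA ler_wpM2l ?Ni0//.
    by rewrite mulr_sumr; apply: ler_sum => i _; exact: hM.
  apply: (le_trans h1); apply: (le_trans (ler_wpM2l (ltW M0) step_u)).
  rewrite mulrDr -!mulrA; apply: lerD; last by rewrite !mulrA (mulrC M).
  have aa : a * M * a <= 1 by rewrite mulr_ile1// ?mulr_ge0// ltW.
  have := ler_wpM2r step_S_ge0 aa; slra.
rewrite E; have := frobD (H' - avg X' + avg Z + a *: avg w) (avg e).
have := frobD (H' - avg X' + avg Z) (a *: avg w).
have := frobD (H' - avg X') (avg Z); slra.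
Qed.

(** The old distance keeps the weight [1 - a], and every new contribution is [a] times a fraction of
    [d2]: the mixed neighbours are within [11 / 20 * d1] of the mean, curvature costs at most
    [d2 / 3], and the gradient step and the motion of the mean cost fractions of [d1 <= d2 / 5]. *)
Lemma step_region2 i : frob (X' i - H') <= d2.
Proof.
have ad1 : a * (5 * d1) <= a * d2 by rewrite ler_wpM2l// ltW.
have ad0 : 0 < a * d1 by rewrite mulr_gt0.
have bA := regime_bA; have bL := regime_bLG; have dd := regime_d1sq.
have bv : b * frob (v i) <= b * (9 * A) by rewrite ler_wpM2l ?step_v// ltW.
have hHH : frob (H' - H) <= 9 / 20 * (a * d1).
  have h1 : frob (H' - H) <= frob (H' - H + b *: avg v) + b * (9 * A).
    rewrite -{1}[H' - H](addrK (b *: avg v)) (le_trans (frobB _ _))// lerD//.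
    rewrite frobZ gtr0_norm// ler_wpM2l ?(ltW b0)//.
    exact: (frob_avg_max N0 step_v).
  have h2 : M * b ^+ 2 * V <= 81 / 16 * (b * A).
    have : M * b ^+ 2 * V <= M * b ^+ 2 * (81 * A ^+ 2).
      by rewrite ler_wpM2l ?step_V// mulr_ge0 ?sqr_ge0// ltW.
    have := ler_wpM2r bA c3; rewrite !exprS !expr0; slra.
  have := step_mean; have := step_region1; have := hS; slra.
have hE : pair_energy P X i <= 4 * d2 ^+ 2.
  have -> : 4 * d2 ^+ 2 = \sum_j P i j * (4 * d2 ^+ 2).
    by rewrite -mulr_suml dstoch_row// mul1r.
  apply: ler_sum => j _.
  rewrite ler_wpM2l//; first by case: hP.
  have -> : X i - X j = Z i - Z j by rewrite /Z opprB addrA subrK.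
  have h0 := frob_ge0 (Z i - Z j).
  have h1 : frob (Z i - Z j) <= 2 * d2.
    by have := frobB (Z i) (Z j); have := hZ i; have := hZ j; slra.
  by have := ler_pM h0 h0 h1 h1; rewrite !exprS !expr0; slra.
have hm : frob (mix P Z i) <= 11 / 20 * d1.
  have -> : mix P Z i = mix P (fun j => Z j - avg Z) i + avg Z.
    by rewrite -[X in _ + X](mix_const (avg Z) i hP) -mixD; apply: eq_bigr => j _;
       rewrite subrK.
  rewrite (le_trans (frobD _ _))//.
  (* One agent is bounded by the whole stack; the resulting factor [N] is paid by [k2N]. *)
  have h1 : frob (mix P (fun j => Z j - avg Z) i) <= d1 / 2.
    rewrite -(@ler_pXn2r _ 2) ?nnegrE ?frob_ge0//; last by rewrite divr_ge0// ltW.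
    apply: (le_trans (stack_frob2_ge _ i)); apply: (le_trans (hk (sum_centered Z N0))).
    have hs : stack_frob2 (fun j => Z j - avg Z) <= N%:R * d1 ^+ 2.
      by rewrite (le_trans (stack_frob2_center _ N0))// -ler_pdivrMl.
    rewrite (le_trans (ler_wpM2l k20 hs))// mulrA (mulrC k2).
    have := ler_wpM2r (sqr_ge0 d1) k2N; rewrite !exprS !expr0; slra.
  have := step_avgZ; have := hS; have : a * d1 <= d1 by rewrite ler_piMl// ltW.
  by slra.
have hw : frob (Z i + a *: w i)
   <= (1 - a) * d2 + a * (11 / 20 * d1) + a * (2 * d2 ^+ 2).
  have -> : Z i + a *: w i
     = (1 - a) *: Z i + a *: mix P Z i + a *: (2^-1 *: (X i *m pair_gram P X i)).
    rewrite /w proj_mix//.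
    have -> : mix P X i - X i = mix P Z i - Z i.
      rewrite !mix_sub//; apply: eq_bigr => j _.
      by rewrite /Z opprB addrA subrK.
    move: (Z i) (mix P Z i) (X i *m _) => p q s.
    by apply/matrixP => i' j; rewrite !mxE; ring.
  have t1 : frob ((1 - a) *: Z i) <= (1 - a) * d2.
    by rewrite frobZ ger0_norm ?ler_wpM2l ?subr_ge0.
  have t2 : frob (a *: mix P Z i) <= a * (11 / 20 * d1).
    by rewrite frobZ gtr0_norm ?ler_wpM2l ?(ltW a0).
  have t3 : frob (a *: (2^-1 *: (X i *m pair_gram P X i))) <= a * (2 * d2 ^+ 2).
    rewrite frobZ gtr0_norm// ler_wpM2l ?(ltW a0)// frobZ ger0_norm// frob_isoL//.
    by have := frob_pair_gram X i hP; slra.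
  have := frobD ((1 - a) *: Z i + a *: mix P Z i) (a *: (2^-1 *: (X i *m pair_gram P X i))).
  have := frobD ((1 - a) *: Z i) (a *: mix P Z i); slra.
have hx : frob (X' i - H) <= frob (Z i + a *: w i) + b * frob (v i).
  rewrite (le_trans (polar_nonexpansive (hX i) (ht i) HS))//.
  have -> : X i + (a *: w i - b *: v i) - H = (Z i + a *: w i) - b *: v i.
    by rewrite /Z addrAC addrA.
  by rewrite (le_trans (frobB _ _))// frobZ (gtr0_norm b0).
have dd2 : a * (2 * d2 ^+ 2) <= a * d2 / 3.
  have := ler_wpM2l (ltW (mulr_gt0 a0 (lt_le_trans (mulr_gt0 (ltr0n _ 5) d10) d12))) d26.
  by rewrite expr2; slra.
have := frobB (X' i - H) (H' - H).
by rewrite opprB addrA subrK; slra.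
Qed.

End NextMean.
End AtState.

(** The contraction in maximum norm: passing from the stack to one agent costs a factor [N], and
    [N%:R * k2 <= 1 / 4] still leaves one half. *)
Lemma mix_centered (W : 'I_N -> 'M[R]_(n, r)) c i : \sum_j W j = 0 -> 0 <= c ->
  (forall j, frob (W j) <= c) -> frob (mix P W i) <= c / 2.
Proof.
move=> W0 c0 hc; rewrite -(@ler_pXn2r _ 2) ?nnegrE ?frob_ge0 ?divr_ge0//.
apply: (le_trans (stack_frob2_ge _ i)); apply: (le_trans (hk W0)).
have : stack_frob2 W <= N%:R * c ^+ 2.
  have -> : N%:R * c ^+ 2 = \sum_(i < N) c ^+ 2.
    by rewrite sumr_const card_ord mulr_natl.
  by apply: ler_sum => j _; rewrite ler_pXn2r ?nnegrE ?frob_ge0.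
move=> /(ler_wpM2l k20) h; apply: (le_trans h).
have := ler_wpM2r (sqr_ge0 c) k2N; rewrite expr_div_n.
by move: (c ^+ 2) => c'; lra.
Qed.

Section Trajectory.
Variables (f_ : 'I_N -> 'M[R]_(n, r) -> R) (L Ln : R).
Hypotheses (df : forall i (U : 'M[R]_(n, r)), differentiable (f_ i) U)
  (hL : forall i U W, frob (grad (f_ i) U - grad (f_ i) W) <= L * frob (U - W))
  (Ln0 : 0 <= Ln) (hLn : forall i U, stiefel U -> op_bound (grad (f_ i) U) Ln)
  (LGE : LG = L + 2 * Ln)
  (hA : forall i U, stiefel U -> frob (grad (f_ i) U) <= A).
Let f := avg_obj f_.

Lemma agent_rgrad_lip i U W : stiefel U -> stiefel W ->
  frob (rgrad (f_ i) U - rgrad (f_ i) W) <= LG * frob (U - W).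
Proof. by move=> hU hW; rewrite LGE; exact: (rgrad_lip (hL i) Ln0 (hLn i)). Qed.

Lemma rgrad_le U : stiefel U -> frob (rgrad f U) <= A.
Proof.
move=> hX; rewrite (le_trans (proj_tangent_le _ hX))// grad_avg_obj//.
by apply: frob_avg_max => // i; exact: hA.
Qed.

Lemma objective_descent U W : stiefel U -> stiefel W ->
  f W <= f U + dotm (rgrad f U) (W - U) + LG / 2 * frob (W - U) ^+ 2.
Proof.
move=> hX hY.
have dff U0 : differentiable f U0 by exact: avg_obj_differentiable.
have hLnf U0 : stiefel U0 -> op_bound (grad f U0) Ln.
  by move=> hZ; apply: grad_avg_obj_bound => // i; exact: hLn.
have h := riemannian_descent dff (grad_avg_obj_lip N0 df hL) Ln0 hLnf hX hY.
apply: (le_trans h); rewrite lerD2l ler_wpM2r ?sqr_ge0//.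
by rewrite LGE; move: Ln0; lra.
Qed.

Variables (X Y F : nat -> 'I_N -> 'M[R]_(n, r)) (H : nat -> 'M[R]_(n, r)).
Hypotheses (hH : forall k, (forall i, stiefel (X k i)) -> is_iam (X k) (H k))
  (X0St : forall i, stiefel (X 0%N i))
  (X0S : msq (fun i => X 0%N i - H 0%N) <= d1 ^+ 2)
  (X0Z : forall i, frob (X 0%N i - H 0%N) <= d2)
  (Y0 : forall i, Y 0%N i = F 0%N i)
  (Xs : forall k i, X k.+1 i = polar_retraction (X k i)
     (a *: proj_tangent (X k i) (mix P (X k) i) - b *: proj_tangent (X k i) (Y k i)))
  (Ys : forall k i, Y k.+1 i = mix P (Y k) i + F k.+1 i - F k i)
  (hF : forall k i, frob (F k i) <= A).

Let v k i := proj_tangent (X k i) (Y k i).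
Let G k := rgrad f (H k).
Let S k := msq (fun i => X k i - H k).
Let V k := msq (v k).
Let T k := msq (fun i => Y k i - avg (F k)).
Let nu k := msq (fun i => F k i - rgrad (f_ i) (X k i)).
Let D k := msq (fun i => v k i - G k).

Let Xfun k : X k.+1 = fun i => polar_retraction (X k i)
     (a *: proj_tangent (X k i) (mix P (X k) i) - b *: proj_tangent (X k i) (Y k i)).
Proof. exact/funext. Qed.

Lemma traj_stiefel k i : stiefel (X k i).
Proof.
elim: k i => [//|k IH] i; rewrite Xs.
exact: (step_stiefel (Y k) IH i).
Qed.

Lemma traj_iam k : is_iam (X k) (H k).
Proof. by apply: hH; exact: traj_stiefel. Qed.

Lemma traj_iam_stiefel k : stiefel (H k).
Proof. by have [] := traj_iam k. Qed.

Lemma traj_avg k : avg (Y k) = avg (F k).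
Proof.
elim: k => [|k IH]; first by congr avg; exact/funext.
rewrite /avg; congr (_ *: _).
under eq_bigr do rewrite Ys; rewrite sumrB big_split/= sum_mix//.
move: IH => /(congr1 (fun M => N%:R *: M)).
rewrite /avg !scalerA mulfV ?gt_eqF// !scale1r => ->.
by rewrite addrAC subrr add0r.
Qed.

Lemma traj_track_step k i : Y k.+1 i - avg (F k.+1)
  = mix P (fun j => Y k j - avg (F k)) i
    + ((F k.+1 i - F k i) - avg (fun j => F k.+1 j - F k j)).
Proof.
rewrite Ys avgB [mix P (fun j => Y k j - avg (F k)) i]mixD mix_const//.
move: (mix P (Y k) i) (F k.+1 i) (F k i) (avg (F k.+1)) (avg (F k)) => p q s t u.
by apply/matrixP => x y; rewrite !mxE; ring.
Qed.

Lemma traj_centered k : \sum_j (Y k j - avg (F k)) = 0.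
Proof. by rewrite -traj_avg sum_centered. Qed.

(** [8 * A] is the fixed point of halving and adding [4 * A], the latter bounding an increment of
    the samples minus its average. *)
Lemma traj_track k i : frob (Y k i - avg (F k)) <= 8 * A.
Proof.
elim: k i => [|k IH] i.
  have h1 := frob_avg_max N0 (hF 0%N).
  by have := frobB (Y 0%N i) (avg (F 0%N)); have := hF 0%N i; rewrite -Y0; slra.
rewrite traj_track_step (le_trans (frobD _ _))//.
have A8 : 0 <= 8 * A by rewrite mulr_ge0.
have h1 := mix_centered i (traj_centered k) A8 IH.
have hd j : frob (F k.+1 j - F k j) <= 2 * A.
  by have := frobB (F k.+1 j) (F k j); have := hF k j; have := hF k.+1 j; slra.
have h2 := frob_avg_max N0 hd.
have := frobB (F k.+1 i - F k i) (avg (fun j => F k.+1 j - F k j)).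
by have := hd i; slra.
Qed.

Lemma traj_Y k i : frob (Y k i) <= 9 * A.
Proof.
have h1 := frob_avg_max N0 (hF k); have := traj_track k i.
have := frobD (Y k i - avg (F k)) (avg (F k)); rewrite subrK; slra.
Qed.

(** The two bounds must be carried together: contraction of the mean square uses the distance of
    each agent, whose preservation in turn uses the mean square through the motion of the mean. *)
Lemma traj_region k : S k <= d1 ^+ 2 /\ forall i, frob (X k i - H k) <= d2.
Proof.
elim: k => [//|k [IHS IHZ]].
have hH' := traj_iam k.+1; rewrite Xfun in hH'.
rewrite /S Xfun; split.
  exact: (step_region1 (traj_stiefel k) (traj_iam k) IHS IHZ (traj_Y k) hH').
move=> i.
exact: (step_region2 (traj_stiefel k) (traj_iam k) IHS IHZ (traj_Y k) hH').
Qed.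

Lemma traj_S k : a * S k.+1 <= a * (1 - a / 2) * S k + 13 / 3 * b ^+ 2 * V k.
Proof.
have hH' := traj_iam k.+1; rewrite Xfun in hH'; have [IHS IHZ] := traj_region k.
rewrite {1}/S Xfun.
exact: (step_consensus (traj_stiefel k) (traj_iam k) IHS IHZ hH').
Qed.

Lemma traj_disp k :
  msq (fun i => X k.+1 i - X k i) <= 6 * a ^+ 2 * S k + 2 * b ^+ 2 * V k.
Proof.
have [IHS IHZ] := traj_region k; rewrite Xfun.
exact: (step_disp (Y k) (traj_stiefel k) (traj_iam k) IHS).
Qed.

Lemma traj_mean k : frob (H k.+1 - H k + b *: avg (v k))
  <= S k.+1 / 2 + 8 * S k + 2 * (M * b ^+ 2 * V k).
Proof.
have hH' := traj_iam k.+1; rewrite Xfun in hH'; have [IHS IHZ] := traj_region k.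
rewrite {1}/S Xfun.
exact: (step_mean (traj_stiefel k) (traj_iam k) IHS hH').
Qed.

Lemma traj_V81 k : V k <= 81 * A ^+ 2.
Proof. exact: (step_V (traj_stiefel k) (traj_Y k)). Qed.

Lemma traj_T k : T k.+1 <= T k / 4
  + 6 * (LG ^+ 2 * (6 * a ^+ 2 * S k + 2 * b ^+ 2 * V k) + nu k + nu k.+1).
Proof.
pose dF i := F k.+1 i - F k i.
have -> : T k.+1 = msq (fun i => mix P (fun j => Y k j - avg (F k)) i + (dF i - avg dF)).
  by congr msq; apply/funext => i; exact: traj_track_step.
have h := msqD_le (mix P (fun j => Y k j - avg (F k))) (fun i => dF i - avg dF) ltr01.
apply: (le_trans h); rewrite invr1.
have h1 : msq (mix P (fun j => Y k j - avg (F k))) <= 1 / 8 * T k.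
  rewrite /T /msq [leRHS]mulrCA ler_wpM2l ?Ni0//.
  apply: (le_trans (hk (traj_centered k))).
  by rewrite ler_wpM2r ?stack_frob2_ge0.
have h2 : msq (fun i => dF i - avg dF) <= msq dF.
  by rewrite ler_wpM2l ?Ni0// stack_frob2_center.
have h3 : msq dF <= 3 * (LG ^+ 2 * msq (fun i => X k.+1 i - X k i) + nu k.+1 + nu k).
  rewrite /nu /msq (mulrCA (LG ^+ 2)) -!mulrDr mulrCA ler_wpM2l ?Ni0//.
  rewrite mulr_sumr -!big_split/= mulr_sumr; apply: ler_sum => i _.
  have -> : dF i = (rgrad (f_ i) (X k.+1 i) - rgrad (f_ i) (X k i))
      + (F k.+1 i - rgrad (f_ i) (X k.+1 i)) + (rgrad (f_ i) (X k i) - F k i).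
    rewrite /dF; move: (rgrad _ _) (rgrad _ _) (F _ _) (F _ _) => p q s t.
    by apply/matrixP => x y; rewrite !mxE; ring.
  apply: (le_trans (frob_sqrD3 _ _ _)); rewrite (frobBC (rgrad _ _) (F k i)).
  rewrite ler_wpM2l// lerD2r lerD2r -exprMn ler_pXn2r ?nnegrE ?(mulr_ge0 (ltW LG0)) ?frob_ge0//.
  by apply: agent_rgrad_lip; exact: traj_stiefel.
have h4 := ler_wpM2l (sqr_ge0 LG) (traj_disp k).
move: h1 h2 h3 h4; move: (msq (mix P _)) (msq (fun i => dF i - avg dF)) (msq dF).
move: (msq _) (T k) (S k) (V k) (nu k) (nu k.+1) => x1 x2 x3 x4 x5 x6 x7 x8 x9.
by lra.
Qed.

Lemma mean_const (c : R) : N%:R^-1 * (\sum_(i < N) c) = c.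
Proof. by rewrite sumr_const card_ord -[X in _ * X = _]mulr_natl mulKf ?gt_eqF. Qed.

(** [G k] is tangent at the mean and not at the agents. The mismatch costs
    [frob (X k i - H k) * frob (G k)], which becomes the [d1 ^+ 2] term after averaging. *)
Lemma traj_D k : D k <= 4 / 3 * T k
  + 12 * (nu k + LG ^+ 2 * S k + d1 ^+ 2 * frob (G k) ^+ 2).
Proof.
have sc (x1 x2 x3 x4 x y : R) : x1 <= x3 -> x2 <= x4 ->
    12 * (x1 + x2 + x * y) <= 12 * (x3 + x4) + 12 * y * x by lra.
have sc' (x1 x2 x3 x4 x y : R) : x1 <= x2 + 12 * (x3 + x4) + 12 * x * y ->
    x * y <= x * d1 ^+ 2 -> x1 <= x2 + 12 * (x3 + x4 + d1 ^+ 2 * x) by lra.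
have HG : tangent (H k) (G k) by apply: proj_tangentP; exact: traj_iam_stiefel.
have [hS _] := traj_region k.
pose e1 := avg (fun i => F k i - rgrad (f_ i) (X k i)).
pose e2 := avg (fun i => rgrad (f_ i) (X k i) - rgrad (f_ i) (H k)).
have he1 : frob e1 ^+ 2 <= nu k by exact: frob_avg_sqr_le.
have he2 : frob e2 ^+ 2 <= LG ^+ 2 * S k.
  apply: (le_trans (frob_avg_sqr_le N0 _)); rewrite -/(msq _).
  apply: msq_le => i; rewrite -exprMn ler_pXn2r ?nnegrE ?(mulr_ge0 (ltW LG0)) ?frob_ge0//.
  by apply: agent_rgrad_lip; [exact: traj_stiefel | exact: traj_iam_stiefel].
have FG : avg (F k) - G k = e1 + e2.
  have -> : G k = avg (fun i => rgrad (f_ i) (H k)) by exact: rgrad_avg_obj.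
  by rewrite [e1]avgB [e2]avgB addrA subrK.
have key i : frob (v k i - G k) ^+ 2 <= 4 / 3 * frob (Y k i - avg (F k)) ^+ 2
   + 12 * (nu k + LG ^+ 2 * S k) + 12 * frob (G k) ^+ 2 * frob (X k i - H k) ^+ 2.
  have h : frob (v k i - G k) <= frob (Y k i - avg (F k))
     + (frob e1 + frob e2 + frob (X k i - H k) * frob (G k)).
    apply: (le_trans (proj_tangent_sub_le _ (traj_stiefel k i) HG)).
    rewrite [leRHS]addrA lerD2r.
    have -> : Y k i - G k = (Y k i - avg (F k)) + (e1 + e2) by rewrite -FG addrA subrK.
    by apply: (le_trans (frobD _ _)); rewrite lerD2l; exact: frobD.
  apply: (le_trans (young_bias (frob_ge0 _) h)); rewrite exprMn -[leRHS]addrA lerD2l.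
  exact: sc.
have : D k <= 4 / 3 * T k + 12 * (nu k + LG ^+ 2 * S k)
     + 12 * frob (G k) ^+ 2 * S k.
  have h : D k <= N%:R^-1 * \sum_i (4 / 3 * frob (Y k i - avg (F k)) ^+ 2
      + 12 * (nu k + LG ^+ 2 * S k) + 12 * frob (G k) ^+ 2 * frob (X k i - H k) ^+ 2).
    by rewrite ler_wpM2l ?Ni0//; apply: ler_sum => i _; exact: key.
  apply: (le_trans h); rewrite !big_split/= -!mulr_sumr !mulrDr.
  rewrite [N%:R^-1 * (4 / 3 * _)]mulrCA [N%:R^-1 * (12 * frob (G k) ^+ 2 * _)]mulrCA.
  by rewrite [N%:R^-1 * (12 * _)]mulrCA mean_const// mulrDr.
by move=> h; exact: (sc' _ _ _ _ _ _ h (ler_wpM2l (sqr_ge0 _) hS)).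
Qed.

Lemma traj_V k : V k <= 3 / 2 * frob (G k) ^+ 2 + 3 * D k.
Proof.
have half : 0 < 2^-1 :> R by rewrite invr_gt0.
have h := msqD_le (fun=> G k) (fun i => v k i - G k) half.
have -> : V k = msq (fun i => G k + (v k i - G k)).
  by congr msq; apply/funext => i; rewrite addrC subrK.
apply: (le_trans h); rewrite invrK.
have -> : msq (fun _ : 'I_N => G k) = frob (G k) ^+ 2.
  rewrite /msq /stack_frob2 sumr_const card_ord -[X in _ * X]mulr_natl mulKf//.
  by rewrite gt_eqF.
rewrite -/(D k); move: (frob (G k) ^+ 2) (D k) => x1 x2; lra.
Qed.

Lemma traj_descent k : 3 / 4 * (b * frob (G k) ^+ 2) <= f (H k) - f (H k.+1)
   + 2 * (b * D k) + 13 / 100 * (b * V k)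
   + a ^+ 2 * LG * (9 / 50 * S k.+1 + 9 / 2 * S k).
Proof.
have [hS _] := traj_region k; have [hS' _] := traj_region k.+1.
set d := H k.+1 - H k; set R' := d + b *: avg (v k).
have hd : d = R' - b *: avg (v k) by rewrite /R' addrK.
have hR' := traj_mean k; rewrite -/d -/R' in hR'.
have desc := objective_descent (traj_iam_stiefel k) (traj_iam_stiefel k.+1).
rewrite -/d -/(G k) in desc.
set g := frob (G k) in desc *.
have g0 : 0 <= g by exact: frob_ge0.
have gA : g <= A by exact/rgrad_le/traj_iam_stiefel.
have hE : frob (avg (v k) - G k) ^+ 2 <= D k.
  by rewrite -(avg_const N0 (G k)) -avgB; exact: frob_avg_sqr_le.
have hv : frob (avg (v k)) ^+ 2 <= V k by exact: frob_avg_sqr_le.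
pose p := S k.+1 / 2 + 8 * S k; pose q := 2 * (M * b ^+ 2 * V k).
rewrite -/p -/q in hR'.
have Sk0 : 0 <= S k by exact: msq_ge0.
have Sk0' : 0 <= S k.+1 by exact: msq_ge0.
have Vk0 : 0 <= V k by exact: msq_ge0.
have p0 : 0 <= p.
  by rewrite /p addr_ge0//; [exact: divr_ge0 | exact: mulr_ge0].
have q0 : 0 <= q.
  apply: mulr_ge0 => //; apply: mulr_ge0 => //.
  by apply: mulr_ge0; [exact: ltW | exact: sqr_ge0].
have i1 : dotm (G k) d <= g * (p + q) - b * (7 / 8 * g ^+ 2 - 2 * D k).
  rewrite hd dotmDr dotmNr dotmZr; apply: lerD.
    by rewrite (le_trans (cauchy_schwarz _ _))// ler_wpM2l.
  rewrite lerN2 ler_wpM2l ?(ltW b0)//.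
  (* This square yields [7/8 * g ^+ 2 - 2 * D k] as a lower bound for the pairing of [G k] with the
     mean direction. *)
  have := dotm_ge0 ((1 / 2) *: G k + 2 *: (avg (v k) - G k)).
  move: hE; rewrite /g !frob_sqr; move: (avg (v k)) (G k) => x y.
  rewrite !dotm_lin (dotmC y x).
  move: (dotm x x) (dotm x y) (dotm y y) (D k) => x1 x2 x3 x4; lra.
have i2 : frob d ^+ 2 <= 2 * (p + q) ^+ 2 + 2 * (b ^+ 2 * V k).
  rewrite hd (le_trans (frob_sqrD2 _ _))// lerD//.
    by rewrite ler_wpM2l// ler_pXn2r ?nnegrE ?frob_ge0 ?(addr_ge0 p0 q0).
  rewrite ler_wpM2l// frobN frobZ exprMn real_normK ?num_real//.
  by rewrite ler_wpM2l ?sqr_ge0.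
have bL800 : 800 * (b * LG) <= 1.
  by apply: (le_trans regime_b); rewrite expr_le1 ?(ltW a0).
exact: (descent_scalar a0 b0 LG0 A0 (ltW M0) Sk0 Sk0' Vk0 g0 gA hS hS'
  (traj_V81 k) c1 c3 bL800 desc i1 i2).
Qed.

Theorem traj_bound (Fs : R) K : (forall U, stiefel U -> Fs <= f U) ->
  b * (\sum_(k < K.+1) frob (rgrad f (H k)) ^+ 2)
  <= 16 * (f (H 0%N) - Fs + 3 * LG * msq (fun i => X 0%N i - H 0%N) / a
     + b * msq (fun i => Y 0%N i - avg (F 0%N))
     + 20 * b * \sum_(k < K.+1) msq (fun i => F k i - rgrad (f_ i) (X k i))).
Proof.
move=> hFs.
have hD k := traj_D k; have hF' k := traj_descent k.
have S0 k : 0 <= S k by exact: msq_ge0.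
have V0 k : 0 <= V k by exact: msq_ge0.
have T0 k : 0 <= T k by exact: msq_ge0.
have n0 k : 0 <= nu k by exact: msq_ge0.
have g0 k : 0 <= frob (G k) ^+ 2 by exact: sqr_ge0.
have f0 k : Fs <= f (H k) by apply: hFs; exact: traj_iam_stiefel.
exact: (@telescoped_bound R a b LG d1 S V T nu
  (fun k => frob (G k) ^+ 2) D (fun k => f (H k)) Fs K a0 a1 b0 LG0 regime_b
  regime_d1_small S0 V0 T0 n0 g0 traj_S traj_T hD traj_V hF' f0).
Qed.

End Trajectory.
End OneStep.

(** * Measurability of matrix-valued maps and of the iterates *)

Section MatrixMeasurability.
Context {R : realType} {d : measure_display} {T : measurableType d}.

Definition mx_measurable p q (X : T -> 'M[R]_(p, q)) :=
  forall a b, measurable_fun [set: T] (fun w => X w a b).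

Lemma mx_measurable_cst p q (A : 'M[R]_(p, q)) : mx_measurable (fun=> A).
Proof. by move=> a b; exact: measurable_cst. Qed.

Lemma mx_measurableD p q (X Y : T -> 'M[R]_(p, q)) :
  mx_measurable X -> mx_measurable Y -> mx_measurable (fun w => X w + Y w).
Proof.
move=> hX hY a b; under eq_fun do rewrite mxE.
exact: measurable_funD.
Qed.

Lemma mx_measurableZ p q (c : R) (X : T -> 'M[R]_(p, q)) :
  mx_measurable X -> mx_measurable (fun w => c *: X w).
Proof.
move=> hX a b; under eq_fun do rewrite mxE.
by apply: measurable_funM => //; exact: measurable_cst.
Qed.

Lemma mx_measurableN p q (X : T -> 'M[R]_(p, q)) :
  mx_measurable X -> mx_measurable (fun w => - X w).
Proof.
move=> hX; under eq_fun do rewrite -scaleN1r.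
exact: mx_measurableZ.
Qed.

Lemma mx_measurableB p q (X Y : T -> 'M[R]_(p, q)) :
  mx_measurable X -> mx_measurable Y -> mx_measurable (fun w => X w - Y w).
Proof. by move=> hX hY; apply: mx_measurableD => //; exact: mx_measurableN. Qed.

Lemma mx_measurableM p q s (X : T -> 'M[R]_(p, q)) (Y : T -> 'M[R]_(q, s)) :
  mx_measurable X -> mx_measurable Y -> mx_measurable (fun w => X w *m Y w).
Proof.
move=> hX hY a b; under eq_fun do rewrite mxE.
by apply: measurable_sum => k; exact: measurable_funM.
Qed.

Lemma mx_measurableT p q (X : T -> 'M[R]_(p, q)) :
  mx_measurable X -> mx_measurable (fun w => (X w)^T).
Proof. by move=> hX a b; under eq_fun do rewrite mxE; exact: hX. Qed.

Lemma mx_measurable_sum p q I (s : seq I) (X : I -> T -> 'M[R]_(p, q)) :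
  (forall i, mx_measurable (X i)) -> mx_measurable (fun w => \sum_(i <- s) X i w).
Proof.
move=> hX a b; under eq_fun do rewrite summxE.
by apply: measurable_sum => i; exact: hX.
Qed.

Lemma measurable_dotm p q (X Y : T -> 'M[R]_(p, q)) :
  mx_measurable X -> mx_measurable Y ->
  measurable_fun [set: T] (fun w => dotm (X w) (Y w)).
Proof.
move=> hX hY; under eq_fun do rewrite dotmE.
by do 2!apply: measurable_sum => ?; exact: measurable_funM.
Qed.

Lemma measurable_frob_sqr p q (X : T -> 'M[R]_(p, q)) :
  mx_measurable X -> measurable_fun [set: T] (fun w => frob (X w) ^+ 2).
Proof. by move=> hX; under eq_fun do rewrite frob_sqr; exact: measurable_dotm. Qed.

Lemma mx_measurable_borel n r (X : T -> 'M[R]_(n, r)) : mx_measurable X ->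
  measurable_fun [set: T] (X : T -> @borel_mx R n r).
Proof.
move=> hX; apply: (@measurability _ _ T (g_sigma_algebraType (@mx_cylinder R n r)) _ _ (@mx_cylinder R n r)) => //.
move=> _ [_ [a [b [B [mB ->]]]] <-].
have := hX a b measurableT B mB.
by rewrite !setTI.
Qed.

(* The functions of interest are merely continuous, while the sigma-algebra on
   matrices is generated by coordinates; rounding the entries makes the image
   countable, where measurability is immediate. *)
Lemma measurable_frob_continuous p q (X : T -> 'M[R]_(p, q)) (f : 'M[R]_(p, q) -> R) :
  mx_measurable X ->
  (forall A e, 0 < e -> exists2 s, 0 < s &
     forall B, frob (B - A) <= s -> `|f B - f A| <= e) ->
  measurable_fun [set: T] (fun w => f (X w)).
Proof.
move=> hX hf.
pose dec m (z : 'M[int]_(p, q)) : 'M[R]_(p, q) := \matrix_(a, b) ((z a b)%:~R / m.+1%:R).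
pose enc m w : 'M[int]_(p, q) := \matrix_(a, b) Num.floor (m.+1%:R * X w a b).
apply: (@measurable_fun_cvg _ _ _ _ (fun m w => f (dec m (enc m w)))).
  move=> m _ B mB; rewrite setTI.
  have -> : (fun w => f (dec m (enc m w))) @^-1` B
     = \bigcup_(z in [set: 'M[int]_(p, q)])
         (if f (dec m z) \in B then enc m @^-1` [set z] else set0).
    apply/seteqP; split => w /=.
      move=> h; exists (enc m w) => //=; case: ifPn => //.
      by move=> /negP; rewrite inE.
    by move=> [z _]; case: ifPn => // /set_mem hz /= ->.
  apply: countable_bigcupT_measurable => [|z]; first exact: countableP.
  case: ifPn => // _.
  have -> : enc m @^-1` [set z] = \bigcap_(ab in [set: 'I_p * 'I_q])
      ((fun w => m.+1%:R * X w ab.1 ab.2) @^-1`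
        [set` `[(z ab.1 ab.2)%:~R, (z ab.1 ab.2 + 1)%:~R[ ]).
    apply/seteqP; split => w /=.
      by move=> <- [a b] _ /=; rewrite in_itv/= mxE; exact: floor_itv.
    move=> h; apply/matrixP => a b; rewrite mxE; apply: floor_def.
    by have := h (a, b) I; rewrite /= in_itv.
  apply: fin_bigcap_measurable => [|[a b] _ /=]; first exact: finite_finset.
  have mx : measurable_fun [set: T] (fun w => m.+1%:R * X w a b).
    by apply: measurable_funM; [exact: measurable_cst | exact: hX].
  by have := mx measurableT _ (measurable_itv `[(z a b)%:~R, (z a b + 1)%:~R[);
     rewrite setTI.
move=> w _; apply/cvgrPdist_le => e e0.
have [s s0 hs] := hf (X w) e e0.
have hd m : frob (dec m (enc m w) - X w) <= (p%:R * q%:R) / m.+1%:R.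
  have m0 : 0 < m.+1%:R :> R by [].
  have pq0 : 0 <= p%:R * q%:R :> R by rewrite mulr_ge0.
  rewrite -(@ler_pXn2r _ 2) ?nnegrE ?frob_ge0 ?divr_ge0// frob_sqr dotmE.
  apply: (@le_trans _ _ (\sum_(i < p) \sum_(j < q) m.+1%:R^-2)).
    apply: ler_sum => i _; apply: ler_sum => j _; rewrite !mxE -expr2.
    have /andP[h1 h2] := floor_itv (m.+1%:R * X w i j).
    rewrite -[leLHS]real_normK ?num_real// -exprVn ler_pXn2r ?nnegrE ?invr_ge0//.
    have -> : (Num.floor (m.+1%:R * X w i j))%:~R / m.+1%:R - X w i j
      = ((Num.floor (m.+1%:R * X w i j))%:~R - m.+1%:R * X w i j) / m.+1%:R.
      by field; rewrite gt_eqF.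
    rewrite normrM [X in _ * X]gtr0_norm ?invr_gt0// ler_piMl ?invr_ge0//.
    rewrite intrD in h2; rewrite ler_norml; apply/andP; split; lra.
  rewrite !sumr_const !card_ord -mulrnA -[_ *+ (q * p)]mulr_natl expr_div_n.
  rewrite ler_wpM2r ?invr_ge0 ?exprn_ge0// -natrM -natrX ler_nat mulnC.
  by case: (p * q)%N => // k; rewrite leq_pmulr.
exists (Num.truncn (p%:R * q%:R / s)).+1 => // m /= hm.
rewrite distrC; apply: hs; apply: (le_trans (hd m)).
rewrite ler_pdivrMr// (mulrC s) -ler_pdivrMr//.
rewrite (le_trans (ltW (truncnS_gt _)))// ler_nat; exact: leqW.
Qed.

End MatrixMeasurability.

Section AlgorithmMeasurability.
Context {R : realType} {d : measure_display} {T : measurableType d}.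

Lemma entry_le_frob p q (A : 'M[R]_(p, q)) a b : `|A a b| <= frob A.
Proof.
rewrite -(@ler_pXn2r _ 2) ?nnegrE ?normr_ge0 ?frob_ge0// real_normK ?num_real//.
rewrite frob_sqr dotmE (bigD1 a)//= (bigD1 b)//= -expr2 -addrA lerDl.
apply: addr_ge0; apply: sumr_ge0 => ? _; rewrite -?expr2 ?sqr_ge0//.
by apply: sumr_ge0 => ? _; rewrite -expr2 sqr_ge0.
Qed.

Lemma mx_measurable_lip p q s u (X : T -> 'M[R]_(p, q)) (c : R)
    (g : 'M[R]_(p, q) -> 'M[R]_(s, u)) :
  mx_measurable X ->
  (forall A B, frob (g A - g B) <= c * frob (A - B)) ->
  mx_measurable (fun w => g (X w)).
Proof.
move=> hX hg a b.
apply: (@measurable_frob_continuous _ _ _ _ _ X (fun A => g A a b)) => // A e e0.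
exists (e / (`|c| + 1)); first by rewrite divr_gt0// ltr_pwDr.
move=> B hB.
have -> : g B a b - g A a b = (g B - g A) a b by rewrite !mxE.
rewrite (le_trans (entry_le_frob _ _ _))// (le_trans (hg _ _))//.
have c1 : 0 < `|c| + 1 by rewrite ltr_pwDr.
rewrite (@le_trans _ _ ((`|c| + 1) * frob (B - A)))//.
  by rewrite ler_wpM2r ?frob_ge0// ler_wpDr ?ler01// ler_norm.
by rewrite mulrC -ler_pdivlMr.
Qed.

Lemma mx_measurable_gram_inv p q (v : T -> 'M[R]_(p, q)) :
  mx_measurable v -> mx_measurable (fun w => invmx (gram_sqrt (v w))).
Proof.
move=> hv a b.
apply: (@measurable_frob_continuous _ _ _ _ _ v (fun A => invmx (gram_sqrt A) a b)) => // A e e0.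
have c1 : 0 < 2 * frob A + 1 by rewrite ltr_pwDr// mulr_ge0// frob_ge0.
(* The Gram matrix is quadratic in [B]. Capping the radius at 1 gives [frob B <= frob A + 1], hence
   the local Lipschitz constant [2 * frob A + 1]. *)
exists (Num.min 1 (e / (2 * frob A + 1))); first by rewrite lt_min ltr01 divr_gt0.
move=> B; rewrite le_min => /andP[hB1 hB].
have -> : invmx (gram_sqrt B) a b - invmx (gram_sqrt A) a b
  = (invmx (gram_sqrt B) - invmx (gram_sqrt A)) a b by rewrite !mxE.
rewrite (le_trans (entry_le_frob _ _ _))// (le_trans (gram_sqrt_inv_lip _ _))//.
have -> : B^T *m B - A^T *m A = (B - A)^T *m B + A^T *m (B - A).
  by rewrite linearB/= mulmxBl mulmxBr addrA subrK.
rewrite (le_trans (frobD _ _))//.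
have hBA : frob B <= frob A + 1.
  by rewrite -(subrK A B) (le_trans (frobD _ _))// addrC lerD2l.
have h1 := frobM (B - A)^T B; have h2 := frobM A^T (B - A).
rewrite frobT in h1; rewrite frobT in h2.
have A0 := frob_ge0 A.
have h3 : frob (B - A) * frob B <= frob (B - A) * (frob A + 1).
  by rewrite ler_wpM2l ?frob_ge0.
rewrite ler_pdivlMr// in hB.
move: (frob_ge0 (B - A)) h1 h2 h3 hB; move: (frob _) (frob _) (frob (B - A)).
move=> x y z; lra.
Qed.

Lemma mx_measurable_polar n r (X v : T -> 'M[R]_(n, r)) :
  mx_measurable X -> mx_measurable v ->
  mx_measurable (fun w => polar_retraction (X w) (v w)).
Proof.
move=> hX hv; apply: mx_measurableM; first exact: mx_measurableD.
exact: mx_measurable_gram_inv.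
Qed.

Lemma mx_measurable_proj n r (X Y : T -> 'M[R]_(n, r)) :
  mx_measurable X -> mx_measurable Y ->
  mx_measurable (fun w => proj_tangent (X w) (Y w)).
Proof.
move=> hX hY; apply: mx_measurableB => //; apply: mx_measurableZ.
apply: mx_measurableM => //; apply: mx_measurableD; apply: mx_measurableM => //;
  exact: mx_measurableT.
Qed.

Lemma mx_measurable_mix n r N (P : 'M[R]_N) (X : T -> 'I_N -> 'M[R]_(n, r)) i :
  (forall i, mx_measurable (fun w => X w i)) ->
  mx_measurable (fun w => mix P (X w) i).
Proof.
by move=> hX; apply: mx_measurable_sum => j; exact: mx_measurableZ.
Qed.

Lemma mx_measurable_rgrad n r (X : T -> 'M[R]_(n, r)) (f : 'M[R]_(n, r) -> R) L :
  mx_measurable X ->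
  (forall Z W, frob (grad f Z - grad f W) <= L * frob (Z - W)) ->
  mx_measurable (fun w => rgrad f (X w)).
Proof.
by move=> hX hL; apply: mx_measurable_proj => //; exact: mx_measurable_lip hL.
Qed.

End AlgorithmMeasurability.

Lemma borel_mx_entry {R : realType} n r :
  mx_measurable (fun X : @borel_mx R n r => X : 'M[R]_(n, r)).
Proof.
move=> a b _ B mB; rewrite setTI; apply: sub_sigma_algebra.
by exists a, b, B.
Qed.

(** Joint measurability of the oracle is given only over the manifold, so composing with it requires
    a measurable domain. *)
Lemma measurable_stiefel {R : realType} n r :
  measurable (stiefel : set (@borel_mx R n r)).
Proof.
have hX := @borel_mx_entry R n r.
have hG : mx_measurable (fun X : @borel_mx R n r =>
    (X : 'M[R]_(n, r))^T *m (X : 'M[R]_(n, r)) - 1%:M).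
  apply: mx_measurableB; last exact: mx_measurable_cst.
  by apply: mx_measurableM => //; exact: mx_measurableT.
have -> : (stiefel : set (@borel_mx R n r)) = setT `&`
   (fun X : @borel_mx R n r => frob ((X : 'M[R]_(n, r))^T *m (X : 'M[R]_(n, r)) - 1%:M) ^+ 2)
     @^-1` [set 0].
  rewrite setTI; apply/seteqP; split => X; rewrite /stiefel /=.
    by move=> ->; rewrite subrr frob0 expr0n.
  by move=> /eqP; rewrite sqrf_eq0 frob_eq0 subr_eq0 => /eqP.
exact: (measurable_frob_sqr hG).
Qed.

Section PastMeasurability.
Context {R : realType} {n r N : nat} {dX : measure_display}
  {Xi : 'I_N -> measurableType dX} {dO : measure_display}
  {Omega : measurableType dO}.
Variables (Nk : nat -> nat) (xi : forall i : 'I_N, nat -> nat -> Omega -> Xi i).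

(** The generator of [past], named so that [Omega] can carry the past as its sigma-algebra; a
    measurable set of [past_space k] is then by conversion an event of [past Nk xi k]. *)
Definition past_generator (k : nat) : set (set Omega) :=
  [set E | exists i l j (B : set (Xi i)),
     [/\ (l < k)%N, (j < Nk l)%N, measurable B & E = xi i l j @^-1` B]].

Definition past_space k := g_sigma_algebraType (past_generator k).

Lemma past_xi i k j : (j < Nk k)%N ->
  measurable_fun [set: past_space k.+1] (xi i k j : past_space k.+1 -> Xi i).
Proof.
move=> jk _ B mB; rewrite setTI; apply: sub_sigma_algebra.
by exists i, k, j, B.
Qed.

Lemma past_mono k d (U : measurableType d) (g : Omega -> U) :
  measurable_fun [set: past_space k] (g : past_space k -> U) ->
  measurable_fun [set: past_space k.+1] (g : past_space k.+1 -> U).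
Proof.
move=> hg _ B mB; rewrite setTI; have := hg measurableT B mB; rewrite setTI.
apply: sub_sigma_algebra2 => E [i [l [j [C [lk jl mC ->]]]]].
by exists i, l, j, C; split => //; exact: leqW.
Qed.

Lemma past_ambient k d (U : measurableType d) (g : Omega -> U) :
  (forall i l j, (j < Nk l)%N -> measurable_fun [set: Omega] (xi i l j)) ->
  measurable_fun [set: past_space k] (g : past_space k -> U) ->
  measurable_fun [set: Omega] g.
Proof.
move=> hxi hg _ B mB; have := hg measurableT B mB; rewrite setTI.
have hgen : past_generator k `<=` @measurable _ Omega.
  move=> E [i [l [j [C [lk jl mC ->]]]]].
  by have := hxi i l j jl measurableT C mC; rewrite setTI.
exact: (smallest_sub (sigma_algebra_measurable Omega) hgen).
Qed.

Variables (G : forall i, 'M[R]_(n, r) -> Xi i -> 'M[R]_(n, r)).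
Arguments G : clear implicits.
Hypothesis hG : forall i, jointly_measurable (G i).

Lemma mx_measurable_oracle d (T : measurableType d) i (U : T -> 'M[R]_(n, r))
    (z : T -> Xi i) :
  (forall w, stiefel (U w)) -> mx_measurable U -> measurable_fun [set: T] z ->
  mx_measurable (fun w => G i (U w) (z w)).
Proof.
move=> USt hU hz a b.
apply: (@measurable_comp _ _ _ T (@borel_mx R n r * Xi i)%type _
  ((stiefel : set (@borel_mx R n r)) `*` setT)
  (fun p => G i p.1 p.2 a b) _ (fun w => (U w : @borel_mx R n r, z w))).
- by apply: measurableX => //; exact: measurable_stiefel.
- by move=> _ [w _ <-]; split => //=; exact: USt.
- exact: hG.
- by apply: measurable_fun_pair => //; exact: mx_measurable_borel.
Qed.

Variables (W : 'M[R]_N) (t : nat) (alpha beta : R) (X0 : 'I_N -> 'M[R]_(n, r))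
  (X Y : nat -> Omega -> 'I_N -> 'M[R]_(n, r)).
Hypotheses (halg : algorithm1 W t alpha beta G Nk xi X0 X Y)
  (XSt : forall k w i, stiefel (X k w i)).

Lemma past_batch k : (forall i, @mx_measurable R _ (past_space k) n r (fun w => X k w i)) ->
  forall i, @mx_measurable R _ (past_space k.+1) n r (fun w => batch_grad G Nk xi X k w i).
Proof.
move=> hX i; apply: mx_measurableZ; apply: mx_measurable_sum => j.
have hX' : @mx_measurable R _ (past_space k.+1) n r (fun w => X k w i).
  by move=> a b; apply: past_mono; exact: hX.
have hz := @past_xi i k j (ltn_ord j).
exact: (@mx_measurable_oracle _ (past_space k.+1) _ _ _
  (fun w => XSt k w i) hX' hz).
Qed.

(** The shift of index is essential: [Y k] contains batch [k] and is known one step later than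
    [X k], while [X k.+1] needs both. *)
Lemma past_iterates k :
  (forall i, @mx_measurable R _ (past_space k) n r (fun w => X k w i)) /\
  (forall i, @mx_measurable R _ (past_space k.+1) n r (fun w => Y k w i)).
Proof.
elim: k => [|k [IHX IHY]].
  have hX i : @mx_measurable R _ (past_space 0) n r (fun w => X 0%N w i).
    have -> : (fun w => X 0%N w i) = fun=> X0 i.
      by apply/funext => w; have [] := halg w i.
    exact: mx_measurable_cst.
  split=> // i.
  have -> : (fun w => Y 0%N w i) = (fun w => batch_grad G Nk xi X 0 w i).
    by apply/funext => w; have [] := halg w i.
  exact: past_batch.
have IHX' i : @mx_measurable R _ (past_space k.+1) n r (fun w => X k w i).
  by move=> a b; apply: past_mono; exact: IHX.
have hX i : @mx_measurable R _ (past_space k.+1) n r (fun w => X k.+1 w i).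
  have -> : (fun w => X k.+1 w i) = (fun w => polar_retraction (X k w i)
     (alpha *: proj_tangent (X k w i) (mix (W ^+ t) (X k w) i)
       - beta *: proj_tangent (X k w i) (Y k w i))).
    by apply/funext => w; have [] := halg w i.
  apply: mx_measurable_polar => //; apply: mx_measurableB;
    apply: mx_measurableZ; apply: mx_measurable_proj => //.
  exact: mx_measurable_mix.
split=> // i.
have -> : (fun w => Y k.+1 w i) = (fun w => mix (W ^+ t) (Y k w) i
    + batch_grad G Nk xi X k.+1 w i - batch_grad G Nk xi X k w i).
  by apply/funext => w; have [_ _ _ ->] := halg w i.
apply: mx_measurableB; first apply: mx_measurableD.
- by apply: mx_measurable_mix => j a b; apply: past_mono; exact: IHY.
- exact: past_batch.
- by move=> a b; apply: past_mono; exact: past_batch.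
Qed.

End PastMeasurability.

(** * Independence and the variance of a batch *)

Section IndependentPair.
Context {R : realType} {d d1 d2 : measure_display} {Omega : measurableType d}
  {S : measurableType d1} {T : measurableType d2}.
Variables (P : probability Omega R) (nu : probability T R).
Local Open Scope ereal_scope.

Definition indep_law (V : Omega -> S) (Z : Omega -> T) :=
  forall A B, measurable A -> measurable B ->
    P (V @^-1` A `&` Z @^-1` B) = P (V @^-1` A) * nu B.

(** Rectangles determine the law of the pair, which is thus the product measure, and Tonelli's
    theorem applies. *)
Lemma indep_law_ge0_integral (V : Omega -> S) (Z : Omega -> T) (g : S * T -> \bar R) :
  measurable_fun setT V -> measurable_fun setT Z -> indep_law V Z ->
  measurable_fun setT g -> (forall p, 0 <= g p) ->
  \int[P]_w g (V w, Z w) = \int[P]_w \int[nu]_y g (V w, y).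
Proof.
move=> mV mZ hVZ mg g0.
pose V' : {mfun Omega >-> S} := HB.pack V (isMeasurableFun.Build _ _ _ _ V mV).
pose p w := (V w, Z w).
have mp : measurable_fun setT p by exact: measurable_fun_pair.
pose p' : {mfun Omega >-> (S * T)%type} :=
  HB.pack p (isMeasurableFun.Build _ _ _ _ p mp).
rewrite -(ge0_integral_distribution p' mg g0).
transitivity (\int[distribution P V' \x nu]_z g z).
  apply: eq_measure_integral => A mA _; apply/esym.
  by apply: product_measure_unique => // B C mB mC; exact: hVZ.
rewrite fubini_tonelli1//.
rewrite -(ge0_integral_distribution V' (f := fun x => \int[nu]_y g (x, y)))//.
- exact: measurable_fun_fubini_tonelli_F.
- by move=> x; exact: integral_ge0.
Qed.

(** Tonelli is applied to the positive and negative parts separately. Mean zero on each fibre says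
    that their inner integrals agree, and boundedness keeps them finite so that they can be
    subtracted. *)
Lemma indep_law_centered (V : Omega -> S) (Z : Omega -> T) (g : S * T -> R) c :
  measurable_fun setT V -> measurable_fun setT Z -> indep_law V Z ->
  measurable_fun setT g -> (forall p, `|g p| <= c)%R ->
  (forall x, \int[nu]_y (g (x, y))%:E = 0) ->
  \int[P]_w (g (V w, Z w))%:E = 0.
Proof.
move=> mV mZ hVZ mg gc g0.
pose G := EFin \o g; have mG : measurable_fun setT G by exact/measurable_EFinP.
have bnd d' (T' : measurableType d') (Q : probability T' R) (f : T' -> \bar R) :
    measurable_fun setT f -> (forall x, 0 <= f x <= c%:E) ->
    0 <= \int[Q]_x f x <= c%:E.
  move=> mf hf; apply/andP; split.
    by apply: integral_ge0 => x _; case/andP: (hf x).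
  rewrite -[leRHS]mule1 -(probability_setT Q) -integral_cst//.
  by apply: ge0_le_integral => // x _; case/andP: (hf x).
have Gp : forall p, 0 <= G^\+ p <= c%:E.
  move=> p; rewrite funepos_ge0 funeposE /= ge_max lee_fin; apply/andP; split.
    exact: le_trans (ler_norm _) (gc p).
  by rewrite lee_fin; exact: le_trans (normr_ge0 _) (gc p).
have Gn : forall p, 0 <= G^\- p <= c%:E.
  move=> p; rewrite funeneg_ge0 funenegE /= ge_max lee_fin; apply/andP; split.
    by rewrite (le_trans _ (gc p))// -normrN ler_norm.
  by rewrite lee_fin; exact: le_trans (normr_ge0 _) (gc p).
have mGp := measurable_funepos mG; have mGn := measurable_funeneg mG.
have finc x : 0 <= x <= c%:E -> x \is a fin_num.
  by case: x => [x| |]//; rewrite leye_eq andbF.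
have sec (f : S * T -> \bar R) x : measurable_fun setT f ->
    measurable_fun setT (fun y => f (x, y)).
  by move=> mf; exact: measurableT_comp mf (pair1_measurable x).
have eqx x : \int[nu]_y G^\+ (x, y) = \int[nu]_y G^\- (x, y).
  have h1 := bnd _ _ nu _ (sec _ x mGp) (fun y => Gp (x, y)).
  have h2 := bnd _ _ nu _ (sec _ x mGn) (fun y => Gn (x, y)).
  have := g0 x; rewrite -[LHS]/(\int[nu]_y (fun y => G (x, y)) y) integralE.
  rewrite (funepos_comp G (fun y => (x, y))) (funeneg_comp G (fun y => (x, y))).
  move: h1 h2 => /finc + /finc /=.
  move: (integral _ _ _) (integral _ _ _) => [a| |] [b| |]// _ _ [] /eqP.
  by rewrite subr_eq0 => /eqP ->.
have mpair : measurable_fun setT (fun w => (V w, Z w)) by exact: measurable_fun_pair.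
have h1 := indep_law_ge0_integral mV mZ hVZ mGp (fun p => funepos_ge0 G p).
have h2 := indep_law_ge0_integral mV mZ hVZ mGn (fun p => funeneg_ge0 G p).
have h3 := bnd _ _ P _ (measurableT_comp mGn mpair) (fun w => Gn (V w, Z w)).
rewrite -[LHS]/(\int[P]_w (fun w => G (V w, Z w)) w) integralE.
rewrite (funepos_comp G (fun w => (V w, Z w))) (funeneg_comp G (fun w => (V w, Z w))) /=.
rewrite h1; under eq_integral do rewrite eqx.
by rewrite -h2 subee//; exact: finc h3.
Qed.

End IndependentPair.

Section BatchVariance.
Context {R : realType} {d d1 d2 : measure_display} {Omega : measurableType d}
  {S : measurableType d1} {T : measurableType d2}.
Variables (P : probability Omega R) (nu : probability T R).
Local Open Scope ereal_scope.

(** The hypothesis is the product formula on rectangles; Dynkin's theorem extends it to all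
    measurable sets of the product. *)
Lemma indep_law_pair (U : Omega -> S) (Z1 Z : Omega -> T) :
  measurable_fun setT U -> measurable_fun setT Z1 -> measurable_fun setT Z ->
  (forall A B1 B, measurable A -> measurable B1 -> measurable B ->
     P (U @^-1` A `&` Z1 @^-1` B1 `&` Z @^-1` B)
     = P (U @^-1` A `&` Z1 @^-1` B1) * nu B) ->
  indep_law P nu (fun w => (U w, Z1 w)) Z.
Proof.
move=> mU mZ1 mZ hind C B mC mB; set V := fun w => (U w, Z1 w).
have mV : measurable_fun setT V by exact: measurable_fun_pair.
have mpre d' (T' : measurableType d') (f : Omega -> T') D :
    measurable_fun setT f -> measurable D -> measurable (f @^-1` D).
  by move=> mf mD; rewrite -[X in measurable X]setTI; exact: mf.
have mD := mpre _ _ _ _ mZ mB; set D := Z @^-1` B in mD *.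
have hT : P D = nu B.
  have := hind setT setT B measurableT measurableT mB.
  by rewrite !preimage_setT !setTI probability_setT mul1e.
rewrite measurable_prod_measurableType in mC.
apply: (dynkin_induction (G := [set A `*` B0 | A in measurable & B0 in measurable])
   (P := fun C => P (V @^-1` C `&` D) = P (V @^-1` C) * nu B) (T := (S * T)%type)).
- exact: measurable_prod_measurableType.
- move=> _ _ [A1 mA1 [B1 mB1 <-]] [A2 mA2 [B2 mB2 <-]].
  exists (A1 `&` A2); first exact: measurableI.
  by exists (B1 `&` B2); [exact: measurableI | rewrite setXI].
- by rewrite preimage_setT setTI probability_setT mul1e.
- move=> _ [A1 mA1 [B1 mB1 <-]]; exact: hind.
- move=> E mE IH; have -> : V @^-1` (~` E) `&` D = D `\` (V @^-1` E) by rewrite setDE setIC.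
  have -> : V @^-1` (~` E) = ~` (V @^-1` E) by [].
  have mVE := mpre _ _ _ _ mV mE.
  have Dfin : P D < +oo by rewrite -ge0_fin_numE// fin_num_measure.
  have hD : P (D `\` V @^-1` E) = P D - P (V @^-1` E `&` D).
    by rewrite (setIC _ D); exact: (measureD mD mVE Dfin).
  rewrite hD (IH : P (V @^-1` E `&` D) = _) (probability_setC P mVE) hT.
  have : P (V @^-1` E) \is a fin_num by exact: fin_num_measure.
  have : nu B \is a fin_num by exact: fin_num_measure.
  move: (nu B) (P _) => [x| |]// [y| |]// _ _.
  by rewrite -EFinM -!EFinB -EFinM mulrBl mul1r.
- move=> F mF tF IH; rewrite preimage_bigcup setI_bigcupl.
  have tVF : trivIset setT (fun k => V @^-1` F k).
    by move=> k l _ _ [w [wk wl]]; apply: tF => //; exists (V w).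
  rewrite !measure_bigcup//.
  + rewrite muleC -(fineK (fin_num_measure nu _ mB)) -nneseriesZl//.
    apply: eq_eseriesr => k _.
    by rewrite fineK ?fin_num_measure// muleC; exact: IH.
  + by move=> k _; exact: mpre.
  + by move=> k _; apply: measurableI => //; exact: mpre.
  + exact: trivIset_setIr.
- exact: mC.
Qed.


Variables (U : Omega -> S) (z : nat -> Omega -> T) (Q : nat).
Hypotheses (Q0 : (0 < Q)%N) (mU : measurable_fun setT U)
  (mz : forall j, (j < Q)%N -> measurable_fun setT (z j))
  (hind : forall A (B : nat -> set T), measurable A -> (forall j, measurable (B j)) ->
     P (U @^-1` A `&` \bigcap_(j < Q) (z j @^-1` B j))
     = P (U @^-1` A) * \prod_(j < Q) nu (B j)).

Lemma batch_indep1 j : (j < Q)%N -> indep_law P nu U (z j).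
Proof.
move=> jQ A B mA mB.
(* Full events at the other indices marginalise the joint product formula. *)
pose B' l := if l == j then B else setT.
have mB' l : measurable (B' l) by rewrite /B'; case: ifP.
have := hind mA mB'.
have -> : \bigcap_(l < Q) (z l @^-1` B' l) = z j @^-1` B.
  apply/seteqP; split => w; first by move=> /(_ j jQ); rewrite /B' eqxx.
  by move=> h l _; rewrite /B'; case: ifP => // /eqP ->.
rewrite (bigD1 (Ordinal jQ))//= /B' eqxx big1 ?mule1// => l.
by rewrite -val_eqE /= => /negPf ->; exact: probability_setT.
Qed.

Lemma batch_indep2 j l : (j < Q)%N -> (l < Q)%N -> j != l ->
  indep_law P nu (fun w => (U w, z j w)) (z l).
Proof.
move=> jQ lQ jl; apply: indep_law_pair; [exact: mU|exact: mz|exact: mz|].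
move=> A B1 B mA mB1 mB; rewrite (batch_indep1 jQ mA mB1).
pose B' m := if m == j then B1 else if m == l then B else setT.
have mB' m : measurable (B' m) by rewrite /B'; do 2?case: ifP.
have := hind mA mB'.
have -> : \bigcap_(m < Q) (z m @^-1` B' m) = z j @^-1` B1 `&` z l @^-1` B.
  apply/seteqP; split => w.
    move=> h; have := h j jQ; have := h l lQ.
    by rewrite /B' eqxx /= eqxx eq_sym (negPf jl).
  move=> [h1 h2] m _; rewrite /B'; case: ifP => [/eqP ->//|_].
  by case: ifP => // /eqP ->.
rewrite setIA => ->; rewrite (bigD1 (Ordinal jQ))//= /B' eqxx.
rewrite (bigD1 (Ordinal lQ))/=; last by rewrite -val_eqE /= eq_sym.
rewrite (eq_sym l) (negPf jl) eqxx big1 ?mule1 ?muleA// => m.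
rewrite -!val_eqE /= => /andP[/negPf -> /negPf ->]; exact: probability_setT.
Qed.

(** Expanding the square gives [Q * Q] pairs of samples. Off the diagonal, sample [l] is independent
    of [U] together with sample [j], and centring in the fibre kills the term; the [Q] diagonal
    terms give at most [s2 / Q ^+ 2] each. *)
Lemma batch_variance (I : finType) (h : I -> S * T -> R) (c s2 : R) :
  (forall i, measurable_fun setT (h i)) -> (forall i p, `|h i p| <= c)%R ->
  (forall i x, \int[nu]_y (h i (x, y))%:E = 0) ->
  (forall x, \int[nu]_y (\sum_i h i (x, y) ^+ 2)%:E <= s2%:E) ->
  \int[P]_w (\sum_i (Q%:R^-1 * \sum_(j < Q) h i (U w, z j w)) ^+ 2)%:E
  <= (s2 / Q%:R)%:E.
Proof.
move=> mh hc h0 hs.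
pose a i (j : 'I_Q) w := h i (U w, z j w).
have ma i j : measurable_fun setT (a i j).
  apply: (measurableT_comp (mh i)); apply: measurable_fun_pair => //; exact: mz.
have int (g : Omega -> R) (c' : R) : measurable_fun setT g ->
    (forall w, `|g w| <= c')%R -> P.-integrable setT (EFin \o g).
  move=> mg hg; apply: measurable_bounded_integrable => //.
    by rewrite -ge0_fin_numE// fin_num_measure.
  exists c'; split; first exact: num_real.
  by move=> x cx w _; exact: le_trans (hg w) (ltW cx).
have iaa i j l : P.-integrable setT (EFin \o (fun w => a i j w * a i l w)%R).
  apply: (int _ (c * c)%R); first by apply: measurable_funM.
  move=> w; rewrite normrM ler_pM//; exact: hc.
have cross i j l : j != l -> \int[P]_w (a i j w * a i l w)%:E = 0.
  move=> jl.
  apply: (@indep_law_centered _ _ _ _ _ (S * T)%type T P nu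
    (fun w => (U w, z j w)) (z l) (fun p => h i p.1 * h i (p.1.1, p.2))%R (c * c)%R).
  - by apply: measurable_fun_pair => //; exact: mz.
  - exact: mz.
  - exact: batch_indep2.
  - apply: measurable_funM.
      exact: (measurableT_comp (mh i) measurable_fst).
    apply: (measurableT_comp (mh i)); apply: measurable_fun_pair => //.
    exact: (measurableT_comp measurable_fst measurable_fst).
  - by move=> p; rewrite normrM ler_pM.
  - move=> [x y] /=; under eq_integral do rewrite EFinM.
    rewrite integralZl ?h0 ?mule0//.
    apply: measurable_bounded_integrable => //.
    + by rewrite -ge0_fin_numE// fin_num_measure.
    + exact: (measurableT_comp (mh i) (pair1_measurable x)).
    + exists c; split; first exact: num_real.
      by move=> t ct y' _; exact: le_trans (hc _ _) (ltW ct).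
have mdiag j : \int[P]_w (\sum_i a i j w ^+ 2)%:E <= s2%:E.
  pose g p := (\sum_i h i p ^+ 2)%:E.
  have mg : measurable_fun setT g.
    by apply/measurable_EFinP; apply: measurable_sum => i; exact: measurable_funX.
  have g0 p : 0 <= g p by rewrite lee_fin sumr_ge0// => i _; exact: sqr_ge0.
  have := indep_law_ge0_integral mU (mz (ltn_ord j)) (batch_indep1 (ltn_ord j)) mg g0.
  rewrite /g => ->.
  rewrite -[leRHS]mule1 -(probability_setT P) -integral_cst//.
  apply: ge0_le_integral => //.
  - by move=> w _; apply: integral_ge0 => y _; exact: (g0 (U w, y)).
  - apply: (measurableT_comp (f := fun x => \int[nu]_y g (x, y))) => //.
    exact: measurable_fun_fubini_tonelli_F.
pose b (p : 'I_Q * 'I_Q) w := (Q%:R^-2 * \sum_i a i p.1 w * a i p.2 w)%R.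
have ib p : P.-integrable setT (EFin \o b p).
  apply: (int _ (`|Q%:R^-2| * (#|I|%:R * (c * c)))%R).
    apply: measurable_funM; first exact: measurable_cst.
    by apply: measurable_sum => i; apply: measurable_funM.
  move=> w; rewrite normrM ler_wpM2l// (le_trans (ler_norm_sum _ _ _))//.
  rewrite mulr_natl -sumr_const; apply: ler_sum => i _.
  by rewrite normrM ler_pM//; exact: hc.
have bE p : \int[P]_w (b p w)%:E
    = (Q%:R^-2)%:E * \int[P]_w (\sum_i a i p.1 w * a i p.2 w)%:E.
  under eq_integral do rewrite EFinM.
  rewrite integralZl//.
  apply: (int _ (#|I|%:R * (c * c))%R).
    by apply: measurable_sum => i; apply: measurable_funM.
  move=> w; rewrite (le_trans (ler_norm_sum _ _ _))//.
  rewrite mulr_natl -sumr_const; apply: ler_sum => i _.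
  by rewrite normrM ler_pM//; exact: hc.
have -> : \int[P]_w (\sum_i (Q%:R^-1 * \sum_(j < Q) h i (U w, z j w)) ^+ 2)%:E
    = \int[P]_w (\sum_p b p w)%:E.
  apply: eq_integral => w _; congr EFin.
  rewrite -(pair_bigA _ (fun j l => b (j, l) w))/= /b/=.
  under [RHS]eq_bigr do rewrite -mulr_sumr exchange_big/=.
  rewrite -mulr_sumr exchange_big/= mulr_sumr; apply: eq_bigr => i _.
  rewrite exprMn exprVn; congr (_ * _)%R; rewrite expr2 mulr_suml.
  by apply: eq_bigr => j _; rewrite mulr_sumr.
under eq_integral do rewrite -sumEFin.
rewrite integral_sum// -(pair_bigA _ (fun j l => \int[P]_w (b (j, l) w)%:E))/=.
have Qr : (0 < Q%:R :> R)%R by rewrite ltr0n.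
have -> : (s2 / Q%:R)%:E = \sum_(j < Q) (Q%:R^-2 * s2)%:E :> \bar R.
  rewrite sumEFin sumr_const card_ord -mulr_natl; congr EFin.
  by field; rewrite gt_eqF.
apply: lee_sum => j _; rewrite (bigD1 j)//= big1 => [|l lj].
  rewrite adde0 bE /= EFinM lee_wpmul2l ?lee_fin ?invr_ge0 ?sqr_ge0//.
  exact: mdiag.
rewrite bE /=; under eq_integral do rewrite -sumEFin.
rewrite integral_sum//; last by move=> i; exact: iaa.
by rewrite big1 ?mule0// => i _; apply: cross; rewrite eq_sym.
Qed.

End BatchVariance.

Lemma expectationE {R : realType} d (T : measurableType d) (P : probability T R)
  (g : T -> R) : ('E_P[g] = \int[P]_w (g w)%:E)%E.
Proof. by rewrite unlock. Qed.

(** * Sampling noise of the oracle *)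

Section OracleNoise.
Context {R : realType} {n r N : nat} {dX : measure_display}
  {Xi : 'I_N -> measurableType dX} {dO : measure_display}
  {Omega : measurableType dO}.
Variables (P : probability Omega R) (mu : forall i, probability (Xi i) R)
  (f : 'I_N -> 'M[R]_(n, r) -> R) (L A2 : R)
  (G : forall i, 'M[R]_(n, r) -> Xi i -> 'M[R]_(n, r)) (sigma A1 : R).
Arguments mu : clear implicits.
Arguments G : clear implicits.
Hypotheses (hL : forall i Z W, frob (grad (f i) Z - grad (f i) W) <= L * frob (Z - W))
  (hA2 : forall i U, stiefel U -> frob (grad (f i) U) <= A2)
  (hG : forall i, stochastic_oracle mu f G sigma A1 i).

Definition clip (c y : R) : R := Num.max (- c) (Num.min c y).

Lemma clip_id c y : `|y| <= c -> clip c y = y.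
Proof. by rewrite ler_norml => /andP[h1 h2]; rewrite /clip min_r// max_r. Qed.

Lemma clip_le c y : `|clip c y| <= `|c|.
Proof.
rewrite /clip ler_norml le_max lerN2 ler_norm/= ge_max ge_min ler_norm/= andbT.
by rewrite -normrN ler_norm.
Qed.

Lemma measurable_clip d (T : measurableType d) (D : set T) c (g : T -> R) :
  measurable_fun D g -> measurable_fun D (fun x => clip c (g x)).
Proof.
move=> mg; apply: measurable_maxr; first exact: measurable_cst.
by apply: measurable_minr => //; exact: measurable_cst.
Qed.

(* The oracle is controlled on the Stiefel manifold and almost surely only; this
   is a bounded, everywhere defined and centred version of one entry of its noise. *)
Definition centered_entry i (ab : 'I_n * 'I_r) (p : @borel_mx R n r * Xi i) : R :=
  (fun p => clip A1 (G i p.1 p.2 ab.1 ab.2) - rgrad (f i) p.1 ab.1 ab.2)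
  \_ ((stiefel : set (@borel_mx R n r)) `*` setT) p.

Lemma centered_entryE i ab U y : stiefel U ->
  centered_entry ab (U : @borel_mx R n r, y : Xi i)
  = clip A1 (G i U y ab.1 ab.2) - rgrad (f i) U ab.1 ab.2.
Proof. by move=> US; rewrite /centered_entry patchE mem_set. Qed.

Lemma centered_entry0 i ab U y : ~ stiefel U ->
  centered_entry ab (U : @borel_mx R n r, y : Xi i) = 0.
Proof. by move=> US; rewrite /centered_entry patchE memNset// => -[]. Qed.

Lemma rgrad_entry_le i U a b : stiefel U -> `|rgrad (f i) U a b| <= `|A2|.
Proof.
move=> US; rewrite (le_trans (entry_le_frob _ _ _))//.
rewrite (le_trans (proj_tangent_le _ US))// (le_trans (hA2 i US))//; exact: ler_norm.
Qed.

Lemma centered_entry_le i ab p : `|@centered_entry i ab p| <= `|A1| + `|A2|.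
Proof.
case: p => U y; case: (pselect (stiefel U)) => US; last first.
  by rewrite centered_entry0// normr0 addr_ge0.
rewrite centered_entryE// (le_trans (ler_normB _ _))// lerD ?clip_le//.
exact: rgrad_entry_le.
Qed.

Lemma measurable_centered_entry i ab : measurable_fun setT (@centered_entry i ab).
Proof.
have mD : measurable ((stiefel : set (@borel_mx R n r)) `*` [set: Xi i]).
  by apply: measurableX => //; exact: measurable_stiefel.
apply: (measurable_restrictT _ mD).1; apply: measurable_funB.
  by apply: measurable_clip; have [mG _ _ _] := hG i; exact: mG.
apply: measurable_funTS.
have h := mx_measurable_rgrad (@borel_mx_entry R n r) (hL i) ab.1 ab.2.
exact: (measurableT_comp h measurable_fst).
Qed.

Lemma oracle_ae_clip i U : stiefel U -> {ae mu i, forall y, forall ab,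
  clip A1 (G i U y ab.1 ab.2) = G i U y ab.1 ab.2}.
Proof.
move=> US; have [_ hae _ _] := hG i; apply: filterS hae => y hy ab.
have [_ h] := hy _ US; apply: clip_id; exact: le_trans (entry_le_frob _ _ _) h.
Qed.

Lemma measurable_oracle_section i U a b : stiefel U ->
  measurable_fun setT (fun y => G i U y a b).
Proof.
move=> US.
have mG j : jointly_measurable (G j) by have [] := hG j.
have mU := @mx_measurable_cst R _ (Xi i) n r U.
exact: (@mx_measurable_oracle _ _ _ _ _ _ _ mG _ (Xi i) i (fun=> U) id
  (fun=> US) mU (@measurable_id _ _ _) a b).
Qed.

Lemma centered_entry_mean i ab (U : @borel_mx R n r) :
  (\int[mu i]_y (centered_entry ab (U, y))%:E = 0)%E.
Proof.
case: (pselect (stiefel (U : 'M[R]_(n, r)))) => US; last first.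
  by apply: integral0_eq => y _; rewrite centered_entry0.
have [_ _ hE _] := hG i.
under eq_integral do rewrite centered_entryE// EFinB.
have mc : measurable_fun setT (fun y => clip A1 (G i U y ab.1 ab.2)).
  by apply: measurable_clip; exact: measurable_oracle_section.
have fin : (mu i setT < +oo)%E by rewrite -ge0_fin_numE// fin_num_measure.
rewrite integralB//; first last.
- apply: measurable_bounded_integrable => //.
  exists `|rgrad (f i) U ab.1 ab.2|; split; first exact: num_real.
  by move=> x cx w _; exact: ltW cx.
- apply: measurable_bounded_integrable => //.
  exists `|A1|; split; first exact: num_real.
  by move=> x cx w _; exact: le_trans (clip_le _ _) (ltW cx).
have -> : (\int[mu i]_y (rgrad (f i) U ab.1 ab.2)%:E = (rgrad (f i) U ab.1 ab.2)%:E)%E.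
  rewrite integral_cst// [X in (_ * X)%E](_ : _ = 1%E) ?mule1//.
  exact: probability_setT.
have := hE U US ab.1 ab.2; rewrite expectationE => <-.
rewrite (@ae_eq_integral _ _ _ (mu i) setT (fun y => (G i U y ab.1 ab.2)%:E))//.
- rewrite subee//.
  by have := hE U US ab.1 ab.2; rewrite expectationE => ->.
- exact/measurable_EFinP.
- by apply/measurable_EFinP; exact: measurable_oracle_section.
- by apply: (filterS _ (oracle_ae_clip i US)) => y h _; rewrite h.
Qed.

Lemma frob_sqr_entries (B : 'M[R]_(n, r)) :
  frob B ^+ 2 = \sum_(ab : 'I_n * 'I_r) B ab.1 ab.2 ^+ 2.
Proof.
rewrite frob_sqr dotmE pair_bigA/=; apply: eq_bigr => ab _; exact: esym (expr2 _).
Qed.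

Lemma centered_entry_var i (U : @borel_mx R n r) : 0 <= sigma ^+ 2 ->
  (\int[mu i]_y (\sum_ab centered_entry ab (U, y) ^+ 2)%:E <= (sigma ^+ 2)%:E)%E.
Proof.
move=> s0; case: (pselect (stiefel (U : 'M[R]_(n, r)))) => US; last first.
  rewrite integral0_eq ?lee_fin// => y _; rewrite big1// => ab _.
  by rewrite centered_entry0// expr0n.
have [_ _ _ hV] := hG i.
apply: (le_trans _ (hV U US)); rewrite expectationE.
rewrite (@ae_eq_integral _ _ _ (mu i) setT (fun y => (frob (G i U y - rgrad (f i) U) ^+ 2)%:E))//.
- apply/measurable_EFinP; apply: measurable_sum => ab; apply: measurable_funX.
  exact: (measurableT_comp (measurable_centered_entry ab) (pair1_measurable _)).
- apply/measurable_EFinP; apply: measurable_frob_sqr.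
  apply: mx_measurableB; last exact: mx_measurable_cst.
  by move=> a b; exact: measurable_oracle_section.
- apply: (filterS _ (oracle_ae_clip i US)) => y h _.
  rewrite frob_sqr_entries; congr EFin; apply: eq_bigr => ab _.
  by rewrite centered_entryE// h !mxE.
Qed.

Variables (Nk : nat -> nat) (xi : forall i : 'I_N, nat -> nat -> Omega -> Xi i)
  (X : nat -> Omega -> 'I_N -> 'M[R]_(n, r)).
Arguments xi : clear implicits.
Hypotheses (hNk : forall k, (0 < Nk k)%N) (hxi : iid_sampling P mu Nk xi)
  (XSt : forall k w i, stiefel (X k w i))
  (Xpast : forall k i, @mx_measurable R _ (past_space Nk xi k) n r (fun w => X k w i)).

Let xim i l j : (j < Nk l)%N -> measurable_fun [set: Omega] (xi i l j).
Proof. by move=> jl; have [h _ _ _] := hxi i l; exact: h. Qed.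

(** The exceptional set lives on the sample space and is uniform in the matrix argument, so the
    bound may later be used at a random iterate. Its preimage under a sample is null because the
    sample has law [mu i], and there are countably many samples. *)
Lemma sample_bounds_ae : {ae P, forall w, forall i k j, (j < Nk k)%N ->
  forall U, stiefel U -> tangent U (G i U (xi i k j w)) /\ frob (G i U (xi i k j w)) <= A1}.
Proof.
suff h i k j : {ae P, forall w, (j < Nk k)%N -> forall U, stiefel U ->
    tangent U (G i U (xi i k j w)) /\ frob (G i U (xi i k j w)) <= A1}.
  apply: filter_forall => i.
  by apply: ae_foralln => k; apply: ae_foralln => j; exact: h.
case: (boolP (j < Nk k)%N) => jk; last by apply: aeW => w.
have [_ [B [mB B0 hB]] _ _] := hG i.
exists (xi i k j @^-1` B); split.
- by have := xim jk measurableT mB; rewrite setTI.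
- by have [_ h _ _] := hxi i k; rewrite h.
- move=> w /= hw; apply: hB => hB'; apply: hw => _; exact: hB'.
Qed.

Lemma batch_grad_le_ae : {ae P, forall w, forall i k,
  frob (batch_grad G Nk xi X k w i) <= A1}.
Proof.
apply: filterS sample_bounds_ae => w h i k.
have Q0 : 0 < (Nk k)%:R :> R by rewrite ltr0n.
rewrite /batch_grad frobZ ger0_norm ?invr_ge0 ?(ltW Q0)// mulrC ler_pdivrMr//.
apply: (le_trans (frob_sum _ _ _)).
rewrite -[in leRHS](card_ord (Nk k)) mulr_natr -sumr_const.
by apply: ler_sum => j _; have [] := h i k j (ltn_ord j) _ (XSt k w i).
Qed.

Lemma batch_noise i k :
  (\int[P]_w (frob (batch_grad G Nk xi X k w i - rgrad (f i) (X k w i)) ^+ 2)%:E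
    <= (sigma ^+ 2 / (Nk k)%:R)%:E)%E.
Proof.
have mX : mx_measurable (fun w => X k w i).
  move=> a b; have hX := @Xpast k i a b; exact: (past_ambient (@xim) hX).
have mU := mx_measurable_borel mX.
have mF : mx_measurable (fun w => batch_grad G Nk xi X k w i).
  apply: mx_measurableZ; apply: mx_measurable_sum => j.
  have mz := xim (i := i) (ltn_ord j).
  apply: (mx_measurable_oracle _ _ mX mz) => //.
  by move=> i'; have [] := hG i'.
have [_ hlaw hprod hpast] := hxi i k.
have hind A (B : nat -> set (Xi i)) : measurable A -> (forall j, measurable (B j)) ->
   (P ((fun w => X k w i : @borel_mx R n r) @^-1` A
       `&` \bigcap_(j < Nk k) (xi i k j @^-1` B j))
    = P ((fun w => X k w i : @borel_mx R n r) @^-1` A) * \prod_(j < Nk k) mu i (B j))%E.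
  move=> mA mB; rewrite hpast//.
    rewrite hprod//; congr (_ * _)%E; apply: eq_bigr => j _.
    exact: hlaw.
  have := @mx_measurable_borel R _ (past_space Nk xi k) n r _ (@Xpast k i) measurableT A mA.
  by rewrite setTI.
have := @batch_variance _ _ _ _ _ _ _ P (mu i) _ _ _ (hNk k) mU (@xim i k) hind
  ('I_n * 'I_r)%type (@centered_entry i) (`|A1| + `|A2|) (sigma ^+ 2)
  (@measurable_centered_entry i) (@centered_entry_le i) (@centered_entry_mean i)
  (fun U => @centered_entry_var i U (sqr_ge0 _)).
apply: le_trans.
(* Almost surely no sample is clipped, so the surrogate entries average to the true noise of the
   batch. *)
rewrite (@ae_eq_integral _ _ _ P setT (fun w => (\sum_ab ((Nk k)%:R^-1 *
   \sum_(j < Nk k) centered_entry ab (X k w i : @borel_mx R n r, xi i k j w)) ^+ 2)%:E))//.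
- apply/measurable_EFinP; apply: measurable_frob_sqr; apply: mx_measurableB => //.
  exact: mx_measurable_rgrad (hL i).
- apply/measurable_EFinP; apply: measurable_sum => ab; apply: measurable_funX.
  apply: measurable_funM; first exact: measurable_cst.
  apply: measurable_sum => j; apply: (measurableT_comp (measurable_centered_entry ab)).
  by apply: measurable_fun_pair => //; exact: xim.
- apply: filterS sample_bounds_ae => w h _; congr EFin.
  rewrite frob_sqr_entries; apply: eq_bigr => ab _; congr (_ ^+ 2).
  have Q0 : (Nk k)%:R != 0 :> R by rewrite pnatr_eq0 -lt0n.
  have subE (A B : 'M[R]_(n, r)) a b : (A - B) a b = A a b - B a b by rewrite !mxE.
  rewrite subE /batch_grad mxE summxE.
  rewrite -[X in _ - X](mulKf Q0) -mulrBr; congr (_ * _).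
  rewrite -[in X in _ - X](card_ord (Nk k)) mulr_natl -sumr_const -sumrB.
  apply: eq_bigr => j _; rewrite centered_entryE//; congr (_ - _).
  have [_ hj] := h i k j (ltn_ord j) _ (XSt k w i).
  by rewrite clip_id// (le_trans (entry_le_frob _ _ _)).
Qed.

End OracleNoise.

(* The integrands need not be measurable: the projection onto the mean is an
   arbitrary selection.  The integral of a nonnegative function is then a lower
   integral, which is superadditive. *)
Section LowerIntegral.
Context {R : realType} {d : measure_display} {T : measurableType d}.
Variable P : probability T R.
Local Open Scope ereal_scope.
Import HBNNSimple.

Lemma lower_integral_le (g : T -> R) (c : \bar R) : (forall x, 0 <= g x)%R ->
  (forall h : {nnsfun T >-> R}, (forall x, h x <= g x)%R -> \int[P]_x (h x)%:E <= c) ->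
  \int[P]_x (g x)%:E <= c.
Proof.
move=> g0 hc; rewrite ge0_integralTE; last by move=> x; rewrite lee_fin.
apply: ge_ereal_sup => _ [h hg <-]; rewrite -integralT_nnsfun.
by apply: hc => x; rewrite -lee_fin; exact: hg.
Qed.

Lemma le_lower_integral (g1 g2 : T -> R) : (forall x, 0 <= g1 x <= g2 x)%R ->
  \int[P]_x (g1 x)%:E <= \int[P]_x (g2 x)%:E.
Proof.
move=> hg; apply: lower_integral_le => [x|h hh]; first by case/andP: (hg x).
rewrite integralT_nnsfun [leRHS]ge0_integralTE; last first.
  by move=> x; rewrite lee_fin; case/andP: (hg x); exact: le_trans.
apply: ereal_sup_ubound; exists h => // x; rewrite lee_fin.
by case/andP: (hg x) => _; exact: le_trans.
Qed.

Lemma lower_integralD (g1 g2 : T -> R) :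
  (forall x, 0 <= g1 x)%R -> (forall x, 0 <= g2 x)%R ->
  \int[P]_x (g1 x)%:E + \int[P]_x (g2 x)%:E <= \int[P]_x (g1 x + g2 x)%:E.
Proof.
move=> g10 g20; set C := \int[P]_x (g1 x + g2 x)%:E.
have C0 : 0 <= C by apply: integral_ge0 => x _; rewrite lee_fin addr_ge0.
have hle (g g' : T -> R) : (forall x, 0 <= g x)%R -> (forall x, 0 <= g' x)%R ->
    \int[P]_x (g x)%:E <= \int[P]_x (g x + g' x)%:E.
  by move=> h h'; apply: le_lower_integral => x; rewrite h lerDl h'.
have l1 : \int[P]_x (g1 x)%:E <= C by exact: hle.
have l2 : \int[P]_x (g2 x)%:E <= C.
  rewrite /C; under [leRHS]eq_integral do rewrite addrC; exact: hle.
have p1 : 0 <= \int[P]_x (g1 x)%:E by apply: integral_ge0 => x _; rewrite lee_fin.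
have p2 : 0 <= \int[P]_x (g2 x)%:E by apply: integral_ge0 => x _; rewrite lee_fin.
(* Finiteness of [C] allows each integral in turn to be moved to the other side and tested on simple
   functions, for which additivity holds. *)
case: (ltP C +oo) => [Cfin|]; last by rewrite leye_eq => /eqP ->; exact: leey.
have f1 : \int[P]_x (g1 x)%:E \is a fin_num.
  by rewrite ge0_fin_numE//; exact: le_lt_trans Cfin.
rewrite -leeBrDl//; apply: lower_integral_le => // h2 hh2.
have q2 : 0 <= \int[P]_x (h2 x)%:E by apply: integral_ge0 => x _; rewrite lee_fin.
have f2 : \int[P]_x (h2 x)%:E \is a fin_num.
  rewrite ge0_fin_numE//; apply: le_lt_trans Cfin; apply: le_trans l2.
  by apply: le_lower_integral => x; rewrite hh2 andbT.
rewrite leeBrDl// -leeBrDr//; apply: lower_integral_le => // h1 hh1.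
rewrite leeBrDr// -ge0_integralD//; first last.
- exact/measurable_EFinP.
- by move=> x _; rewrite lee_fin.
- exact/measurable_EFinP.
- by move=> x _; rewrite lee_fin.
apply: (le_lower_integral (g1 := fun x => h1 x + h2 x)%R) => x.
by rewrite addr_ge0//= lerD.
Qed.

Lemma sum_lower_integral_le K (g : nat -> T -> R) (H : T -> R) :
  (forall k x, 0 <= g k x)%R -> (forall x, 0 <= H x)%R -> measurable_fun setT H ->
  {ae P, forall x, \sum_(k < K) g k x <= H x}%R ->
  \sum_(k < K) \int[P]_x (g k x)%:E <= \int[P]_x (H x)%:E.
Proof.
move=> g0 H0 mH hae.
apply: (@le_trans _ _ (\int[P]_x (\sum_(k < K) g k x)%:E)).
  elim: K {hae} => [|K IH].
    rewrite big_ord0; apply: integral_ge0 => x _.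
    by rewrite lee_fin sumr_ge0.
  rewrite big_ord_recr/=; under [leRHS]eq_integral do rewrite big_ord_recr/=.
  apply: le_trans (lower_integralD _ _); last by move=> x; exact: g0.
    by rewrite leeD2r.
  by move=> x; rewrite sumr_ge0.
apply: lower_integral_le => [x|h hh]; first by rewrite sumr_ge0.
apply: ae_ge0_le_integral => //.
- by move=> x _; rewrite lee_fin.
- exact/measurable_EFinP.
- by move=> x _; rewrite lee_fin.
- exact/measurable_EFinP.
- by apply: filterS hae => x hx _; rewrite lee_fin (le_trans (hh x)).
Qed.

End LowerIntegral.

(** * The trajectory bound in expectation *)

Section ExpectedBound.
Context {R : realType} {n r N : nat} {dX : measure_display}
  {Xi : 'I_N -> measurableType dX} {dO : measure_display}
  {Omega : measurableType dO}.
Variables (Pr : probability Omega R) (mu : forall i, probability (Xi i) R)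
  (f_ : 'I_N -> 'M[R]_(n, r) -> R) (L Ln A1 A2 sigma : R)
  (G : forall i, 'M[R]_(n, r) -> Xi i -> 'M[R]_(n, r))
  (hat : ('I_N -> 'M[R]_(n, r)) -> 'M[R]_(n, r))
  (Nk : nat -> nat) (xi : forall i : 'I_N, nat -> nat -> Omega -> Xi i)
  (W : 'M[R]_N) (t : nat) (X0 : 'I_N -> 'M[R]_(n, r))
  (X Y : nat -> Omega -> 'I_N -> 'M[R]_(n, r)) (k2 M a b LG d1 d2 Fs : R).
Arguments mu : clear implicits.
Arguments G : clear implicits.
Arguments xi : clear implicits.
Let A := Num.max A1 A2.
Let F := batch_grad G Nk xi X.
Let f := avg_obj f_.

Hypotheses (hN : (1 < N)%N) (hP : dstoch (W ^+ t))
  (hk : forall Z : 'I_N -> 'M[R]_(n, r), \sum_i Z i = 0 ->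
     stack_frob2 (mix (W ^+ t) Z) <= k2 * stack_frob2 Z)
  (k20 : 0 <= k2) (k28 : k2 <= 1 / 8) (k2N : N%:R * k2 <= 1 / 4)
  (M0 : 0 < M)
  (hM : forall X v : 'M[R]_(n, r), stiefel X -> tangent X v ->
     frob (polar_retraction X v - (X + v)) <= M * frob v ^+ 2)
  (a0 : 0 < a) (a1 : a <= 1) (aM : a * M <= 1) (b0 : 0 < b) (LG0 : 0 < LG)
  (d10 : 0 < d1) (d12 : 5 * d1 <= d2) (d26 : d2 <= 1 / 6)
  (c1 : 32 * d1 ^+ 2 <= a ^+ 2 * (b * LG)) (c3 : 16 * (b * M * A) <= 1)
  (c4 : 5 * (b * LG) + 50 * (b * A) <= a * d1)
  (df : forall i (U : 'M[R]_(n, r)), differentiable (f_ i) U)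
  (hL : forall i U V, frob (grad (f_ i) U - grad (f_ i) V) <= L * frob (U - V))
  (Ln0 : 0 <= Ln) (hLn : forall i U, stiefel U -> op_bound (grad (f_ i) U) Ln)
  (LGE : LG = L + 2 * Ln)
  (hA2 : forall i U, stiefel U -> frob (grad (f_ i) U) <= A2)
  (hhat : forall Z : 'I_N -> 'M[R]_(n, r), (forall i, stiefel (Z i)) -> is_iam Z (hat Z))
  (hX0 : local_region hat d1 d2 X0)
  (hG : forall i, stochastic_oracle mu f_ G sigma A1 i)
  (hNk : forall k, (0 < Nk k)%N) (hxi : iid_sampling Pr mu Nk xi)
  (halg : algorithm1 W t a b G Nk xi X0 X Y)
  (hFs : forall U, stiefel U -> Fs <= f U).

Let i0 : 'I_N. Proof. exact: Ordinal (ltnW hN). Qed.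

Let A0 : 0 <= A.
Proof.
have [hS _ _] := hX0; have h := hA2 i0 (hS i0).
by rewrite le_max (le_trans (frob_ge0 _) h) orbT.
Qed.

Let XSt k w i : stiefel (X k w i).
Proof.
have [hS _ _] := hX0.
have h0 j : stiefel (X 0%N w j) by have [-> _ _ _] := halg w j; exact: hS.
apply: (@traj_stiefel _ _ _ _ (W ^+ t) a b (fun k => X k w) (fun k => Y k w)) => // l j.
by have [_ _ h _] := halg w j; exact: h.
Qed.

Let T0 w := msq (fun i => Y 0%N w i - avg (F 0%N w)).
Let nu k w := msq (fun i => F k w i - rgrad (f_ i) (X k w i)).
Let S0 := msq (fun i => X0 i - hat X0).

Lemma mean_trajectory_ae K : {ae Pr, forall w,
  b * (\sum_(k < K.+1) frob (rgrad f (hat (X k w))) ^+ 2)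
  <= 16 * (f (hat X0) - Fs + 3 * LG * S0 / a + b * T0 w
           + 20 * b * \sum_(k < K.+1) nu k w)}.
Proof.
apply: filterS (batch_grad_le_ae hG hNk hxi XSt) => w hF.
have [hS hd1 hd2] := hX0.
have X0E : X 0%N w = X0 by apply/funext => i; have [] := halg w i.
have N0 : 0 < N%:R :> R by rewrite ltr0n ltnW.
have e0 : msq (fun i => X 0%N w i - hat (X 0%N w)) <= d1 ^+ 2.
  by rewrite X0E /msq mulrC ler_pdivrMr// mulrC.
have e1 i : frob (X 0%N w i - hat (X 0%N w)) <= d2 by rewrite X0E.
have e2 i : Y 0%N w i = F 0%N w i by have [] := halg w i.
have e3 k i : X k.+1 w i = polar_retraction (X k w i)
    (a *: proj_tangent (X k w i) (mix (W ^+ t) (X k w) i)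
     - b *: proj_tangent (X k w i) (Y k w i)).
  by have [_ _ h _] := halg w i; exact: h.
have e4 k i : Y k.+1 w i = mix (W ^+ t) (Y k w) i + F k.+1 w i - F k w i.
  by have [_ _ _ h] := halg w i; exact: h.
have e5 k i : frob (F k w i) <= A by rewrite (le_trans (hF i k))// le_max lexx.
have e6 i U : stiefel U -> frob (grad (f_ i) U) <= A.
  by move=> hU; rewrite (le_trans (hA2 i hU))// le_max lexx orbT.
have := @traj_bound R n r N hN (W ^+ t) k2 M a b LG A d1 d2 hP hk k20 k28 k2N M0 hM
  a0 a1 aM b0 LG0 A0 d10 d12 d26 c1 c3 c4 f_ L Ln df hL Ln0 hLn LGE e6
  (fun k => X k w) (fun k => Y k w) (fun k => F k w) (fun k => hat (X k w))
  (fun k h => hhat h) (XSt 0 w) e0 e1 e2 e3 e4 e5 Fs K hFs.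
by rewrite X0E.
Qed.

Let mX k i : mx_measurable (fun w => X k w i).
Proof.
have mG i' : jointly_measurable (G i') by have [] := hG i'.
have xim i' l j : (j < Nk l)%N -> measurable_fun [set: Omega] (xi i' l j).
  by move=> jl; have [h _ _ _] := hxi i' l; exact: h.
have [h _] := past_iterates mG halg XSt k.
by move=> p q; have hi := @h i p q; exact: (past_ambient xim hi).
Qed.

Let mF k i : mx_measurable (fun w => F k w i).
Proof.
have mG i' : jointly_measurable (G i') by have [] := hG i'.
apply: mx_measurableZ; apply: mx_measurable_sum => j.
have mz : measurable_fun setT (xi i k j).
  by have [h _ _ _] := hxi i k; exact: (h j (ltn_ord j)).
exact: (mx_measurable_oracle mG (fun w => XSt k w i) (mX k i) mz).
Qed.

Let measurable_msq (Z : Omega -> 'I_N -> 'M[R]_(n, r)) :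
  (forall i, mx_measurable (fun w => Z w i)) ->
  measurable_fun setT (fun w => msq (Z w)).
Proof.
move=> mZ; apply: measurable_funM; first exact: measurable_cst.
by apply: measurable_sum => i; exact: measurable_frob_sqr.
Qed.

Let mT0 : measurable_fun setT T0.
Proof.
apply: measurable_msq => i.
have -> : (fun w => Y 0%N w i - avg (F 0%N w)) = (fun w => F 0%N w i - avg (F 0%N w)).
  by apply/funext => w; have [_ -> _ _] := halg w i.
apply: mx_measurableB => //; apply: mx_measurableZ; apply: mx_measurable_sum => j.
exact: mF.
Qed.

Let mnu k : measurable_fun setT (nu k).
Proof.
apply: measurable_msq => i; apply: mx_measurableB => //.
exact: (mx_measurable_rgrad (mX k i) (hL i)).
Qed.

Lemma noise_mean k : (\int[Pr]_w (nu k w)%:E <= (sigma ^+ 2 / (Nk k)%:R)%:E)%E.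
Proof.
have N0 : 0 < N%:R :> R by rewrite ltr0n ltnW.
have xpast k' i : @mx_measurable R _ (past_space Nk xi k') n r (fun w => X k' w i).
  have mG i' : jointly_measurable (G i') by have [] := hG i'.
  by have [h _] := past_iterates mG halg XSt k'; exact: h.
rewrite /nu /msq /stack_frob2; under eq_integral do rewrite EFinM -sumEFin.
have mi i : measurable_fun setT
    (fun w => (frob (F k w i - rgrad (f_ i) (X k w i)) ^+ 2)%:E).
  apply/measurable_EFinP; apply: measurable_frob_sqr; apply: mx_measurableB => //.
  exact: (mx_measurable_rgrad (mX k i) (hL i)).
have Ni : 0 <= N%:R^-1 :> R by rewrite invr_ge0 ltW.
have nn w : setT w -> (0 <= \sum_(i < N) (frob (F k w i - rgrad (f_ i) (X k w i)) ^+ 2)%:E)%E.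
  by move=> _; apply: sume_ge0 => i _; rewrite lee_fin sqr_ge0.
rewrite (ge0_integralZl_EFin Pr measurableT nn (emeasurable_sum _ mi) Ni).
rewrite ge0_integral_sum//; last by move=> i w _; rewrite lee_fin sqr_ge0.
apply: (@le_trans _ _ ((N%:R^-1)%:E * \sum_(i < N) (sigma ^+ 2 / (Nk k)%:R)%:E)%E).
  apply: lee_wpmul2l; first by rewrite lee_fin invr_ge0 ltW.
  by apply: lee_sum => i _; exact: (batch_noise hL hA2 hG hNk hxi XSt xpast).
by rewrite sumEFin -EFinM lee_fin mean_const.
Qed.

(** [fine] would send an infinite expectation to 0, so finiteness is established before [fine] is
    undone; it follows from the almost sure bound on the batches. *)
Lemma tracking_mean_fin : (\int[Pr]_w (T0 w)%:E)%E \is a fin_num.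
Proof.
have T00 w : 0 <= T0 w by exact: msq_ge0.
rewrite ge0_fin_numE; last by apply: integral_ge0 => w _; rewrite lee_fin.
have bd : {ae Pr, forall w, setT w -> ((T0 w)%:E <= (`|A1| ^+ 2)%:E)%E}.
  apply: filterS (batch_grad_le_ae hG hNk hxi XSt) => w hF _; rewrite lee_fin.
  have A10 : 0 <= A1 by apply: le_trans (hF i0 0%N); exact: frob_ge0.
  have N0 : 0 < N%:R :> R by rewrite ltr0n ltnW.
  have -> : T0 w = msq (fun i => F 0%N w i - avg (F 0%N w)).
    by congr msq; apply/funext => i; have [_ -> _ _] := halg w i.
  rewrite /msq mulrC ler_pdivrMr// (le_trans (stack_frob2_center _ (ltnW hN)))//.
  rewrite /stack_frob2 mulr_natr -[X in _ *+ X](card_ord N) -sumr_const.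
  apply: ler_sum => i _; rewrite (ger0_norm A10).
  by rewrite ler_pXn2r ?nnegrE ?frob_ge0//; exact: hF.
apply: (@le_lt_trans _ _ (\int[Pr]_w (cst (`|A1| ^+ 2)%:E w))%E).
  apply: ae_ge0_le_integral => //.
  - by move=> w _; rewrite lee_fin.
  - exact/measurable_EFinP.
  - by move=> w _; rewrite lee_fin sqr_ge0.
rewrite integral_cst// [X in (_ * X)%E](_ : _ = 1%E) ?mule1 ?ltry//.
exact: probability_setT.
Qed.

Lemma tracking_meanE :
  fine ('E_Pr[fun w => stack_frob2 (fun i => Y 0%N w i - avg (F 0%N w))]%R)%E
  = N%:R * fine ('E_Pr[T0])%E.
Proof.
have N0 : 0 < N%:R :> R by rewrite ltr0n ltnW.
rewrite !expectationE.
have -> : (fun w => (stack_frob2 (fun i => Y 0%N w i - avg (F 0%N w)))%:E)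
    = (fun w => (N%:R)%:E * (T0 w)%:E)%E.
  by apply/funext => w; rewrite -EFinM /T0 /msq mulVKf// gt_eqF.
rewrite ge0_integralZl_EFin//; first by rewrite fineM// tracking_mean_fin.
- by move=> w _; rewrite lee_fin; exact: msq_ge0.
- exact/measurable_EFinP.
Qed.

Lemma expected_bound K :
  (\sum_(k < K.+1) 'E_Pr[fun w => frob (rgrad f (hat (X k w))) ^+ 2]%R
   <= (16 / b * (f (hat X0) - Fs + 3 * LG * S0 / a + b * fine ('E_Pr[T0])%E
        + 20 * b * (sigma ^+ 2 * \sum_(k < K.+1) ((Nk k)%:R)^-1)))%:E)%E.
Proof.
have N0 : 0 < N%:R :> R by rewrite ltr0n ltnW.
under eq_bigr do rewrite expectationE.
pose C := f (hat X0) - Fs + 3 * LG * S0 / a.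
have T00 w : 0 <= T0 w by exact: msq_ge0.
have n0 k w : 0 <= nu k w by exact: msq_ge0.
have C0 : 0 <= C.
  have [hS _ _] := hX0; have [hS0 _] := hhat hS.
  apply: addr_ge0; first by rewrite subr_ge0; exact: hFs.
  apply: divr_ge0 (ltW a0); apply: mulr_ge0 (msq_ge0 _).
  by apply: mulr_ge0 (ltW LG0).
have q0 : 0 <= 16 / b by rewrite divr_ge0// ltW.
(* After division by [b] the coefficients of the tracking error and of the noise are 16 and
   [16 * 20 = 320]. They enter the majorant [H], which is measurable and can therefore be integrated
   term by term. *)
have [u u0 uE] : exists2 u : R, 0 <= u & u = 16 by exists 16; rewrite ?ler0n.
have [v v0 vE] : exists2 v : R, 0 <= v & v = 320 by exists 320; rewrite ?ler0n.
pose H w := 16 / b * C + u * T0 w + v * \sum_(k < K.+1) nu k w.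
have sn0 w : 0 <= \sum_(k < K.+1) nu k w by exact: sumr_ge0.
have mH : measurable_fun setT H.
  apply: measurable_funD; first apply: measurable_funD => //.
    by apply: measurable_funM => //; exact: measurable_cst.
  apply: measurable_funM; first exact: measurable_cst.
  by apply: measurable_sum => k; exact: mnu.
have H0 w : 0 <= H w.
  exact: (addr_ge0 (addr_ge0 (mulr_ge0 q0 C0) (mulr_ge0 u0 (T00 w)))
    (mulr_ge0 v0 (sn0 w))).
have hae := mean_trajectory_ae K.
have hle := @sum_lower_integral_le R _ _ Pr K.+1
  (fun k w => frob (rgrad f (hat (X k w))) ^+ 2) H (fun k w => sqr_ge0 _) H0 mH.
apply: (le_trans (hle _)).
  apply: filterS hae => w; rewrite -/C mulrC -ler_pdivlMr// => hw.
  apply: (le_trans hw); rewrite ler_pdivrMr// /H uE vE.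
  move: (T0 w) (\sum_(k < _) nu k w) => x y;
  have -> : (16 / b * C + 16 * x + 320 * y) * b = 16 * (C + b * x + 20 * b * y).
    by field; rewrite gt_eqF.
  exact: lexx.
rewrite /H.
have mS : measurable_fun setT (fun w => \sum_(k < K.+1) nu k w).
  by apply: measurable_sum => k; exact: mnu.
have -> : (\int[Pr]_w (16 / b * C + u * T0 w + v * \sum_(k < K.+1) nu k w)%:E
   = (16 / b * C)%:E + u%:E * \int[Pr]_w (T0 w)%:E
     + v%:E * \int[Pr]_w (\sum_(k < K.+1) nu k w)%:E)%E.
  have m1 : measurable_fun setT (fun w => (u * T0 w)%:E).
    by apply/measurable_EFinP; apply: measurable_funM => //; exact: measurable_cst.
  have m2 : measurable_fun setT (fun w => (v * \sum_(k < K.+1) nu k w)%:E).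
    by apply/measurable_EFinP; apply: measurable_funM => //; exact: measurable_cst.
  have p0 : 0 <= 16 / b * C by exact: mulr_ge0.
  have p1 w : (0 <= (u * T0 w)%:E)%E by rewrite lee_fin; exact: (mulr_ge0 u0 (T00 w)).
  have p2 w : (0 <= (v * \sum_(k < K.+1) nu k w)%:E)%E.
    by rewrite lee_fin; exact: (mulr_ge0 v0 (sn0 w)).
  under eq_integral do rewrite 2!EFinD.
  rewrite ge0_integralD//; first last.
  - exact: emeasurable_funD.
  - by move=> w _; rewrite -EFinD lee_fin addr_ge0// -lee_fin.
  rewrite ge0_integralD//.
  rewrite (integral_cst Pr measurableT) [X in (_ * X)%E](_ : _ = 1%E) ?mule1; last first.
    exact: probability_setT.
  congr (_ + _ + _)%E.
    under eq_integral do rewrite EFinM.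
    rewrite ge0_integralZl_EFin//; last exact/measurable_EFinP.
    by move=> w _; rewrite lee_fin.
  under eq_integral do rewrite EFinM.
  rewrite ge0_integralZl_EFin//; last exact/measurable_EFinP.
  by move=> w _; rewrite lee_fin.
have hS : (\int[Pr]_w (\sum_(k < K.+1) nu k w)%:E
    <= (sigma ^+ 2 * \sum_(k < K.+1) ((Nk k)%:R)^-1)%:E)%E.
  under eq_integral do rewrite -sumEFin.
  rewrite ge0_integral_sum//; first last.
  - by move=> k w _; rewrite lee_fin.
  - by move=> k; exact/measurable_EFinP.
  rewrite mulr_sumr -sumEFin; apply: lee_sum => k _; exact: noise_mean.
rewrite expectationE -(fineK tracking_mean_fin) -!EFinM -EFinD /=.
move: (fine _) => x.
apply: (@le_trans _ _ ((16 / b * C + u * x)%:E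
    + (v * (sigma ^+ 2 * \sum_(k < K.+1) ((Nk k)%:R)^-1))%:E)%E).
  by rewrite leeD2l// [leRHS]EFinM lee_wpmul2l// lee_fin.
rewrite -EFinD lee_fin -/C uE vE; move: (sigma ^+ 2 * _) => y.
by rewrite le_eqVlt; apply/orP; left; apply/eqP; field; rewrite gt_eqF.
Qed.

End ExpectedBound.

(** * Consequences of the step-size conditions *)

Section Constants.
Context {R : realType}.
Implicit Types a b s x y : R.

(** With [Phi <= 2] the radicand is at least [(1 - a * Lt) ^+ 2], so [rho] is at least [1 - a * Lt],
    and [Lt <= 2]. *)
Lemma rho_bounds (a Lt Phi : R) : 0 < a -> 0 < Lt -> Lt <= 2 -> Phi <= 2 ->
  let rho := Num.sqrt (1 - (a * Lt * Phi - a ^+ 2 * Lt ^+ 2)) in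
  [/\ 0 <= rho, 1 - rho <= 2 * a & 1 - rho ^+ 2 = a * Lt * Phi - a ^+ 2 * Lt ^+ 2].
Proof.
move=> a0 Lt0 Lt2 P2 rho.
have aL : 0 < a * Lt by exact: mulr_gt0.
have h : (1 - a * Lt) ^+ 2 <= 1 - (a * Lt * Phi - a ^+ 2 * Lt ^+ 2).
  rewrite -exprMn; move: (a * Lt) aL => x x0; nra.
have h' : 1 - a * Lt <= rho.
  by rewrite (le_trans (ler_norm _))// -sqrtr_sqr ler_wsqrtr.
split; first exact: sqrtr_ge0.
- have : a * Lt <= a * 2 by rewrite ler_pM2l.
  by move: (a * Lt) h' => x; clear; lra.
- by rewrite sqr_sqrtr ?(le_trans (sqr_ge0 _) h)// opprB addrC subrK.
Qed.

(** A quotient by a nonpositive number, zero included, is nonpositive here. This recovers the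
    positivity of [Lt] and [LG] from the step-size bounds in which they are denominators. *)
Lemma div_gt0_of (x y z : R) : 0 < x -> 0 <= y -> x <= y / z -> 0 < z.
Proof.
move=> x0 y0 h; rewrite ltNge; apply/negP => z0.
have : y / z <= 0 by rewrite mulr_ge0_le0// invr_le0.
by move=> /(le_trans h); rewrite leNgt x0.
Qed.

(* The third bound on [b] gives [16 * b * D4 * G0 <= 1] because [C1] contains
   [2 * D4 * G0]; as [G0 >= 1 / (2 * a ^+ 2)] this makes [d1] small against
   [a ^+ 2 * b * LG], and the remaining parts of [C1] bound [b * LG] and [b * M * A]. *)
Lemma step_regime (a b M A LG d1 d2 rr Lt Phi G2 : R) :
  let rho := Num.sqrt (1 - (a * Lt * Phi - a ^+ 2 * Lt ^+ 2)) in
  let G0 := 2 / (1 - rho) ^+ 2 in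
  let D1 := (d1 ^+ 2 + 5) * LG + 2 * M * A in
  let D4 := 4 * rr * d1 ^+ 2 / (b ^+ 2 * LG) in
  let Ct := d2 ^+ 2 / rr in
  let D2 := 3 * LG + 2 * a * A + 13 * LG * Ct * a ^+ 2 + D4 in
  let C1 := D2 * G0 + D4 * G0 + D1 in
  let bbar := Num.min ((1 - rho) * d1 / (10 * A + LG))
                      (a * d1 / (5 * (10 * A + LG))) in
  0 < a -> a <= Num.min 1 (Num.min (1 / M) (Phi / Lt)) -> 0 < b ->
  b <= Num.min bbar (Num.min (1 / (9 * LG))
    (1 / (4 * (a * d1 * LG * (16 * G0 + G2) + 2 * C1)))) ->
  0 < M -> 0 <= A -> 0 < d1 -> 1 <= rr -> Lt <= 2 -> 1 <= Phi -> Phi <= 2 -> 0 <= G2 ->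
  [/\ [/\ a <= 1, a * M <= 1 & 0 < LG],
      [/\ 32 * d1 ^+ 2 <= a ^+ 2 * (b * LG), 16 * (b * M * A) <= 1
        & 5 * (b * LG) + 50 * (b * A) <= a * d1],
      40 * (b * LG) <= 1
    & [/\ 0 < 1 - rho, 0 < 1 - rho ^+ 2 & 1 - rho ^+ 2 <= 4 * a]].
Proof.
move=> rho G0 D1 D4 Ct D2 C1 bbar a0; rewrite !le_min => /and3P[a1 aM aL] b0.
move=> /andP[/andP[hb1 hb2] /andP[hb3 hb4]] M0 A0 d10 rr1 Lt2 P1 P2 G20.
have Phi0 : 0 <= Phi by rewrite (le_trans ler01).
have Lt0 : 0 < Lt by exact: div_gt0_of aL.
have LG0 : 0 < LG.
  have := div_gt0_of b0 ler01 hb3; by rewrite pmulr_rgt0.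
have [rho0 rho2 rhoE] := rho_bounds a0 Lt0 Lt2 P2; rewrite -/rho in rho0 rho2 rhoE.
have AL0 : 0 < 10 * A + LG by rewrite ltr_wpDl// mulr_ge0.
have r1 : 0 < 1 - rho.
  have : 0 < (1 - rho) * d1 / (10 * A + LG) by exact: lt_le_trans hb1.
  by rewrite pmulr_lgt0 ?invr_gt0// pmulr_lgt0.
have q0 : 0 < (1 - rho) ^+ 2 by rewrite exprn_gt0.
have G0p : 0 < G0 by rewrite divr_gt0.
have G0a : 1 <= 2 * a ^+ 2 * G0.
  rewrite /G0 mulrA ler_pdivlMr// mul1r.
  have : (1 - rho) ^+ 2 <= (2 * a) ^+ 2.
    by rewrite ler_pXn2r// nnegrE; [exact: ltW|exact: mulr_ge0 (ler0n _ 2) (ltW a0)].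
  by rewrite exprMn; move: (_ ^+ 2) (a ^+ 2) => x y; clear; lra.
have rr0 : 0 < rr by rewrite (lt_le_trans ltr01).
have b2 : 0 < b ^+ 2 * LG by rewrite mulr_gt0 ?exprn_gt0.
have d1s : 0 < d1 ^+ 2 by rewrite exprn_gt0.
have D40 : 0 < D4 by rewrite divr_gt0 ?mulr_gt0.
have aA : 0 <= a * A by exact: mulr_ge0 (ltW a0) A0.
have Ct0 : 0 <= Ct by rewrite divr_ge0 ?sqr_ge0 ?(ltW rr0).
have D2D : D4 <= D2.
  rewrite lerDr; apply: addr_ge0; first apply: addr_ge0.
  - by rewrite mulr_ge0 ?(ltW LG0).
  - by rewrite -mulrA mulr_ge0.
  - by rewrite mulr_ge0 ?sqr_ge0// mulr_ge0// mulr_ge0 ?(ltW LG0).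
have hDG : D4 * G0 <= D2 * G0 by rewrite ler_wpM2r// ltW.
have DG0 : 0 < D4 * G0 by rewrite mulr_gt0.
have MA0 : 0 <= M * A by rewrite mulr_ge0// ltW.
have hD1 : 5 * LG + 2 * (M * A) <= D1.
  have h : 0 <= d1 ^+ 2 * LG by rewrite mulr_ge0 ?(ltW d1s) ?(ltW LG0).
  rewrite /D1 (mulrDl (d1 ^+ 2)) -(mulrA 2); move: h.
  by move: (d1 ^+ 2 * LG) (2 * (M * A)) => x y; clear; lra.
have ex0 : 0 <= a * d1 * LG * (16 * G0 + G2).
  have h1 : 0 <= a * d1 * LG by rewrite !mulr_ge0// ltW.
  by rewrite mulr_ge0// addr_ge0// mulr_ge0// ltW.
have C10 : 0 < C1.
  have lin (x1 x2 x3 x4 x5 : R) : x2 <= x1 -> 0 < x2 -> 5 * x5 + 2 * x4 <= x3 ->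
    0 <= x4 -> 0 < x5 -> 0 < x1 + x2 + x3 by clear; lra.
  exact: (lin _ _ _ _ _ hDG DG0 hD1 MA0 LG0).
have hC : 8 * (b * C1) <= 1.
  rewrite ler_pdivlMr in hb4; last first.
    by rewrite mulr_gt0// ltr_wpDl// mulr_gt0.
  have : 0 <= b * (a * d1 * LG * (16 * G0 + G2)) by rewrite mulr_ge0// ltW.
  have lin (x y : R) : b * (4 * (x + 2 * y)) <= 1 -> 0 <= b * x -> 8 * (b * y) <= 1.
    clear; lra.
  exact: lin hb4.
have hbC : 2 * (b * (D4 * G0)) + 5 * (b * LG) + 2 * (b * M * A) <= b * C1.
  have : b * (2 * (D4 * G0) + 5 * LG + 2 * (M * A)) <= b * C1.
    have lin (x1 x2 x3 x4 : R) : x2 <= x1 -> 5 * LG + 2 * x4 <= x3 ->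
      2 * x2 + 5 * LG + 2 * x4 <= x1 + x2 + x3 by clear; lra.
    by rewrite ler_pM2l//; exact: (lin _ _ _ _ hDG hD1).
  by rewrite !mulrDr (mulrCA b 2) (mulrCA b 5) (mulrCA b 2) (mulrA b M).
have bLG : 0 < b * LG by rewrite mulr_gt0.
have bMA : 0 <= b * M * A by rewrite -mulrA mulr_ge0// ltW.
have bDG : 0 < b * (D4 * G0) by rewrite mulr_gt0.
split.
- split=> //; by rewrite -ler_pdivlMr.
- split.
  (* Multiplying by [b] and by [b * LG] clears the denominator of [D4], leaving an inequality
     between [d1 ^+ 2 * G0] and [b * LG]. *)
  + have hD : b * (D4 * G0) * (b * LG) = 4 * rr * d1 ^+ 2 * G0.
      by rewrite /D4; field; rewrite !gt_eqF.
    have e1 : 16 * (b * (D4 * G0)) <= 1.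
      by move: hC hbC bLG bMA; move: (b * C1) (b * (D4 * G0)) (b * LG) (b * M * A)
         => x1 x2 x3 x4; clear; lra.
    have e2 : 16 * (4 * rr * d1 ^+ 2 * G0) <= b * LG.
      rewrite -hD mulrA -[leRHS]mul1r ler_pM2r//.
    have e3 : 64 * (d1 ^+ 2 * G0) <= b * LG.
      apply: le_trans e2.
      have : d1 ^+ 2 * G0 * 1 <= d1 ^+ 2 * G0 * rr by rewrite ler_pM2l// mulr_gt0.
      have -> : 16 * (4 * rr * d1 ^+ 2 * G0) = 64 * (d1 ^+ 2 * G0 * rr) by ring.
      by move: (d1 ^+ 2 * G0 * rr) (d1 ^+ 2 * G0) => x y; clear; lra.
    have e4 : d1 ^+ 2 <= d1 ^+ 2 * (2 * a ^+ 2 * G0) by rewrite ler_pMr.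
    have e5 : a ^+ 2 * (64 * (d1 ^+ 2 * G0)) <= a ^+ 2 * (b * LG).
      by rewrite ler_wpM2l ?sqr_ge0.
    apply: le_trans e5.
    have -> : a ^+ 2 * (64 * (d1 ^+ 2 * G0)) = 32 * (d1 ^+ 2 * (2 * a ^+ 2 * G0)) by ring.
    by rewrite ler_wpM2l.
  + move: hC hbC bLG bDG; move: (b * C1) (b * (D4 * G0)) (b * LG) (b * M * A).
    by move=> x1 x2 x3 x4; clear; lra.
  + move: hb2; rewrite ler_pdivlMr ?mulr_gt0//.
    have -> : b * (5 * (10 * A + LG)) = 5 * (b * LG) + 50 * (b * A) by ring.
    by [].
- move: hC hbC bMA bDG; move: (b * C1) (b * (D4 * G0)) (b * LG) (b * M * A).
  by move=> x1 x2 x3 x4; clear; lra.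
- have r2 : rho <= 1 by rewrite -subr_ge0 ltW.
  have e1 : rho ^+ 2 <= rho by rewrite expr2 ler_piMr.
  split=> //; first by move: e1 r1; clear; lra.
  rewrite rhoE.
  have h1 : a * (Lt * Phi) <= a * 4.
    rewrite ler_pM2l//; have -> : 4 = 2 * 2 :> R by rewrite -natrM.
    by rewrite ler_pM// ltW.
  have h2 : 0 <= a ^+ 2 * Lt ^+ 2 by rewrite mulr_ge0 ?sqr_ge0.
  by move: h1 h2; rewrite mulrA; move: (_ * Phi) (_ * Lt ^+ 2) => x y; clear; lra.
Qed.

End Constants.

(** * Averages, comparison of constants, and sums of inverse sample sizes *)

Section Averages.
Context {R : realType}.

Lemma bigmin_average K (e : nat -> \bar R) (B : R) : (forall k, 0 <= e k)%E ->
  (\sum_(k < K.+1) e k <= B%:E)%E ->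
  (\big[mine/+oo]_(k < K.+1) e k <= (B / K.+1%:R)%:E)%E.
Proof.
move=> e0 hB; set m := \big[_/_]_(_ < _) _.
have hm (k : 'I_K.+1) : (m <= e k)%E by rewrite /m bigmin_le_cond.
have m0 : (0 <= m)%E by rewrite le_bigmin ?leey.
have hs : (\sum_(k < K.+1) m <= B%:E)%E.
  by apply: le_trans hB; apply: lee_sum => k _; exact: hm.
move: m0 hs; move: m {hm} => [x| |]//=.
  rewrite sumEFin sumr_const card_ord !lee_fin => _ h.
  by rewrite ler_pdivlMr// mulr_natr.
move=> _; rewrite big_ord_recl/= addye ?leye_eq//.
rewrite -ltNye; apply: (@lt_le_trans _ _ 0%E) => //.
by apply: sume_ge0 => k _; exact: leey.
Qed.

(** [40 * (b * LG) <= 1] turns the noise factor [20 * b] into [1 / (2 * LG)]; the consensus and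
    tracking terms are dominated separately. *)
Lemma bound_comparison (a b LG gap S0 T0 v c C0 G1 G3 E3 D3t G1t : R) :
  0 < a -> 0 < b -> 0 < LG -> 40 * (b * LG) <= 1 -> S0 / a <= G1 ->
  3 * LG * G1 <= C0 -> 0 <= C0 -> 0 <= T0 -> 2 * T0 <= G3 -> 0 <= E3 -> 0 <= gap ->
  0 <= v -> 1 / (2 * LG) <= D3t -> 0 <= G1t -> 16 <= c ->
  16 / b * (gap + 3 * LG * S0 / a + b * T0 + 20 * b * v)
  <= (c * (gap + (C0 + b / 2 * (G3 + E3)) + D3t * v) + G1t) / b.
Proof.
move=> a0 b0 LG0 hb hS hC C00 T00 hG3 E30 gap0 v0 hD G1t0 hc.
have hD' : 20 * b * v <= D3t * v.
  rewrite ler_wpM2r//; apply: le_trans hD.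
  by rewrite ler_pdivlMr ?mulr_gt0//; move: (b) (LG) hb => x y; clear; nra.
have hS' : 3 * LG * S0 / a <= C0.
  apply: le_trans hC; rewrite -mulrA ler_pM2l ?mulr_gt0//.
have hT : b * T0 <= b / 2 * (G3 + E3).
  rewrite -mulrA ler_pM2l//; move: hG3 E30; clear; lra.
have q0 : 0 <= 20 * b * v by rewrite !mulr_ge0 ?ler0n// ltW.
have p0 : 0 <= b * T0 by rewrite mulr_ge0// ltW.
rewrite ler_pdivlMr// [leLHS]mulrAC mulfVK ?gt_eqF//.
set s := gap + (C0 + b / 2 * (G3 + E3)) + D3t * v.
have s0 : 0 <= s.
  move: q0 p0 hD' hT C00 gap0; rewrite /s; move: (20 * b * v) (D3t * v) (b * T0) (b / 2 * _).
  by move=> x1 x2 x3 x4; clear; lra.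
have hs : gap + 3 * LG * S0 / a + b * T0 + 20 * b * v <= s.
  rewrite /s; move: hD' hT hS'; move: (20 * b * v) (D3t * v) (b * T0) (b / 2 * _) (_ / a).
  by move=> x1 x2 x3 x4 x5; clear; lra.
have : 16 * s <= c * s by rewrite ler_wpM2r.
move: hs G1t0; move: (gap + _ + _ + _) (s) (c * s) => x1 x2 x3; clear; lra.
Qed.

Lemma consensus_rate (N t : nat) (s2 : R) : (0 < N)%N -> (0 < t)%N -> 0 <= s2 < 1 ->
  (s2 != 0 -> Num.ceil (ln (1 / (2 * Num.sqrt N%:R)) / ln s2) <= t%:Z) ->
  N%:R * (s2 ^+ t) ^+ 2 <= 1 / 4.
Proof.
move=> N0 t0 /andP[s0 s1] ht.
have Nr : 0 < N%:R :> R by rewrite ltr0n.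
have [->|sn] := eqVneq s2 0.
  by rewrite expr0n gtn_eqF// expr0n mulr0 divr_ge0.
have sp : 0 < s2 by rewrite lt0r sn.
have sq0 : 0 < 2 * Num.sqrt (N%:R : R) by rewrite mulr_gt0 ?sqrtr_gt0.
have l0 : ln s2 < 0 by rewrite ln_lt0// sp.
have h1 : ln (1 / (2 * Num.sqrt N%:R)) / ln s2 <= t%:R.
  apply: le_trans (Num.Theory.ceil_ge _) _; rewrite -[t%:R]/((t%:Z)%:~R) ler_int.
  exact: ht.
have h2 : ln (s2 ^+ t) <= ln (1 / (2 * Num.sqrt N%:R)).
  (* [ln s2] is negative, so clearing it from the denominator reverses the inequality. *)
  by rewrite lnXn// -[ln s2 *+ t]mulr_natl -ler_ndivrMr.
have h3 : s2 ^+ t <= 1 / (2 * Num.sqrt N%:R).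
  by rewrite -ler_ln ?posrE ?exprn_gt0 ?divr_gt0.
have h4 : (s2 ^+ t) ^+ 2 <= (1 / (2 * Num.sqrt N%:R)) ^+ 2.
  by rewrite ler_pXn2r ?nnegrE ?exprn_ge0 ?divr_ge0 ?(ltW sq0).
have h5 : (1 / (2 * Num.sqrt N%:R)) ^+ 2 = 1 / (4 * N%:R) :> R.
  rewrite !div1r exprVn exprMn sqr_sqrtr ?(ltW Nr)//.
  by rewrite -natrX.
rewrite h5 in h4.
apply: (le_trans (ler_wpM2l (ltW Nr) h4)).
by rewrite le_eqVlt; apply/orP; left; apply/eqP; field; rewrite gt_eqF.
Qed.

Lemma geometric_sum_le (q : R) K : 0 < q < 1 -> \sum_(k < K) q ^+ k <= 1 / (1 - q).
Proof.
move=> /andP[q0 q1]; have h : 0 < 1 - q by rewrite subr_gt0.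
rewrite ler_pdivlMr//.
have -> : (\sum_(k < K) q ^+ k) * (1 - q) = 1 - q ^+ K.
  elim: K => [|K IH]; first by rewrite big_ord0 mul0r expr0 subrr.
  by rewrite big_ord_recr/= mulrDl IH exprS; ring.
by rewrite lerBlDr lerDl exprn_ge0// ltW.
Qed.

Lemma ln_step (k : nat) : ln (k.+1%:R / k.+2%:R) <= - (k.+2%:R)^-1 :> R.
Proof.
have -> : k.+1%:R / k.+2%:R = 1 + - (k.+2%:R)^-1 :> R.
  have : k.+2%:R = k.+1%:R + 1 :> R by rewrite natr1.
  have : k.+2%:R != 0 :> R by rewrite pnatr_eq0.
  by move: (k.+2%:R) (k.+1%:R) => y x + yx; rewrite yx => x0; field.
by apply: le_ln1Dx; rewrite ltrN2 invf_lt1 ?ltr0n ?ltr1n.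
Qed.

Lemma harmonic_sum_le K : \sum_(k < K.+1) k.+1%:R^-1 <= ln K.+1%:R + 1 :> R.
Proof.
elim: K => [|K IH]; first by rewrite big_ord_recl big_ord0 ln1 add0r addr0 invr1.
rewrite big_ord_recr/=.
have h := ln_step K; rewrite ln_div ?posrE// in h.
move: IH h; move: (\sum_(i < _) _) (ln _) (ln _) (_^-1) => x1 x2 x3 x4; lra.
Qed.

Lemma power_sum_lt1 (a : R) K : 0 < a -> a < 1 ->
  \sum_(k < K.+1) (k.+1%:R `^ a)^-1 <= K.+1%:R `^ (1 - a) / (1 - a).
Proof.
move=> a0 a1; have s0 : 0 < 1 - a by rewrite subr_gt0.
rewrite ler_pdivlMr// mulr_suml.
elim: K => [|K IH].
  by rewrite big_ord_recl big_ord0 !powR1 invr1 mul1r addr0 gerBl ltW.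
rewrite big_ord_recr/= -lerBrDr; apply: (le_trans IH).
set y : R := K.+2%:R; set x : R := K.+1%:R.
have y0 : 0 < y by rewrite ltr0n. have x0 : 0 < x by rewrite ltr0n.
have yx : y = x + 1 by rewrite /y /x natr1.
have hx : x `^ (1 - a) = y `^ (1 - a) * expR ((1 - a) * ln (x / y)).
  by rewrite /powR !gt_eqF// -expRD ln_div ?posrE// -mulrDr (addrC (ln y)) subrK.
have hy : (y `^ a)^-1 = y `^ (1 - a) / y.
  have yn : y != 0 by rewrite gt_eqF.
  by rewrite -powRN powRD ?yn ?implybT// powRr1 ?(ltW y0)// mulrAC divff// mul1r.
rewrite hx hy.
have -> : y `^ (1 - a) - y `^ (1 - a) / y * (1 - a) = y `^ (1 - a) * (1 - (1 - a) / y).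
  by move: (y `^ _) => p; field; rewrite gt_eqF.
rewrite ler_pM2l ?powR_gt0//.
set l := ln (x / y); pose s := 1 - a.
have el : expR l = 1 - y^-1.
  rewrite /l lnK ?posrE ?divr_gt0// -[1](@divff _ y) ?gt_eqF// -[X in _ = _ - X]mul1r.
  by rewrite -mulrBl yx addrK.
have h1 := expR_ge1Dx (a * l); have h2 := expR_ge1Dx (- (s * l)).
have e1 : expR l = expR (s * l) * expR (a * l) by rewrite -expRD /s -mulrDl subrK mul1r.
have e2 : 1 = expR (s * l) * expR (- (s * l)) by rewrite -expRD subrr expR0.
(* Tangent lines of the exponential at 0, with weights [s] and [a] chosen so that the linear terms
   cancel. Multiplied by [expR (s * l)] this is Bernoulli's inequality, bounding [(1 - y^-1)] to the
   power [s] by [1 - s / y]. *)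
have h3 : 1 <= s * expR (a * l) + a * expR (- (s * l)).
  have g1 : s * (1 + a * l) <= s * expR (a * l) by rewrite ler_pM2l.
  have g2 : a * (1 + - (s * l)) <= a * expR (- (s * l)) by rewrite ler_pM2l.
  have g3 : s * (1 + a * l) + a * (1 + - (s * l)) = 1 by rewrite /s; ring.
  by rewrite -g3; exact: lerD.
have h4 : expR (s * l) * 1 <= expR (s * l) * (s * expR (a * l) + a * expR (- (s * l))).
  by rewrite ler_pM2l ?expR_gt0.
have h5 : expR (s * l) * (s * expR (a * l) + a * expR (- (s * l))) = s * expR l + a.
  rewrite mulrDr mulrCA -e1; congr (_ + _).
  by rewrite mulrCA -e2 mulr1.
rewrite mulr1 h5 el in h4; apply: (le_trans h4).
by rewrite le_eqVlt; apply/orP; left; apply/eqP; rewrite /s; ring.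
Qed.

Lemma power_sum_gt1 (a : R) K : 1 < a ->
  \sum_(k < K.+1) (k.+1%:R `^ a)^-1 <= a / (a - 1).
Proof.
move=> a1; have s0 : 0 < a - 1 by rewrite subr_gt0.
rewrite ler_pdivlMr//.
(* The bound is sharpened by the tail term so that the induction telescopes. *)
suff h : (\sum_(k < K.+1) (k.+1%:R `^ a)^-1) * (a - 1) <= a - K.+1%:R `^ (1 - a).
  by apply: (le_trans h); rewrite gerBl powR_ge0.
elim: K => [|K IH].
  by rewrite big_ord_recl big_ord0 !powR1 invr1 addr0 mul1r.
rewrite big_ord_recr/= mulrDl.
set y : R := K.+2%:R; rewrite -/y in IH *; set x : R := K.+1%:R in IH *.
have y0 : 0 < y by rewrite ltr0n. have x0 : 0 < x by rewrite ltr0n.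
have hx : x `^ (1 - a) = y `^ (1 - a) * expR ((1 - a) * ln (x / y)).
  by rewrite /powR !gt_eqF// -expRD ln_div ?posrE// -mulrDr (addrC (ln y)) subrK.
have hy : (y `^ a)^-1 = y `^ (1 - a) / y.
  have yn : y != 0 by rewrite gt_eqF.
  by rewrite -powRN powRD ?yn ?implybT// powRr1 ?(ltW y0)// mulrAC divff// mul1r.
suff h : (y `^ a)^-1 * (a - 1) <= x `^ (1 - a) - y `^ (1 - a).
  by rewrite (le_trans (lerD IH h))// addrA subrK.
rewrite hx hy.
have -> : y `^ (1 - a) * expR ((1 - a) * ln (x / y)) - y `^ (1 - a)
  = y `^ (1 - a) * (expR ((1 - a) * ln (x / y)) - 1) by rewrite mulrBr mulr1.
rewrite -mulrA ler_pM2l ?powR_gt0//.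
have h1 := ln_step K; rewrite -/x -/y in h1.
have h2 := expR_ge1Dx ((1 - a) * ln (x / y)).
have h3 : (a - 1) * ln (x / y) <= (a - 1) * - y^-1 by rewrite ler_pM2l.
apply: (@le_trans _ _ ((1 - a) * ln (x / y))); last by rewrite lerBrDl.
have -> : y^-1 * (a - 1) = - ((a - 1) * - y^-1) by ring.
have -> : (1 - a) * ln (x / y) = - ((a - 1) * ln (x / y)) by ring.
by rewrite lerN2.
Qed.

End Averages.

(** Without a lower bound the infimum defining [fstar] would not lie below the values of the
    objective. The bound is the descent inequality from a variable [U] to the fixed [H], as points
    of the manifold have bounded distance and gradients. *)
Lemma agents_bounded_below {R : realType} n r N (f_ : 'I_N -> 'M[R]_(n, r) -> R)
    (L A : R) (H : 'M[R]_(n, r)) :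
  (forall i (U : 'M[R]_(n, r)), differentiable (f_ i) U) ->
  (forall i U V, frob (grad (f_ i) U - grad (f_ i) V) <= L * frob (U - V)) ->
  (forall i U, stiefel U -> frob (grad (f_ i) U) <= A) -> stiefel H ->
  has_lbound (avg_obj f_ @` (stiefel : set 'M[R]_(n, r))).
Proof.
move=> df hL hA hH.
pose D : R := 2 * Num.sqrt r%:R.
exists (N%:R^-1 * \sum_i (f_ i H - (`|A| * D + `|L| / 2 * D ^+ 2))).
move=> _ [U hU <-]; rewrite /avg_obj ler_wpM2l ?invr_ge0 ?ler0n//.
apply: ler_sum => i _; rewrite lerBlDr addrA.
have hd := descent U H (df i) (hL i).
have fs (V : 'M[R]_(n, r)) : stiefel V -> frob V = Num.sqrt r%:R.
  by move=> hV; rewrite -(frob_stiefel hV) sqrtr_sqr ger0_norm ?frob_ge0.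
have hD : frob (H - U) <= D.
  by rewrite (le_trans (frobB _ _))// !fs// /D mulr_natl mulr2n.
have D0 := frob_ge0 (H - U).
apply: (le_trans hd); apply: lerD; first apply: lerD => //.
  apply: (le_trans (ler_norm _)); apply: (le_trans (cauchy_schwarz_abs _ _)).
  by rewrite ler_pM ?frob_ge0// (le_trans (hA i U hU))// ler_norm.
apply: (@le_trans _ _ (`|L| / 2 * frob (H - U) ^+ 2)).
  by rewrite ler_wpM2r ?sqr_ge0// ler_wpM2r// ler_norm.
rewrite ler_wpM2l ?divr_ge0// ler_pXn2r// nnegrE//; exact: le_trans hD.
Qed.

(* The sampling noise enters only through [D]; every term in [G2] is slack. *)
Section Rates.
Context {R : realType}.
Variables (c p D g b sg G2 k1 : R).
Hypotheses (c0 : 0 <= c) (D0 : 0 <= D) (b0 : 0 < b) (sg0 : 0 <= sg) (G20 : 0 <= G2)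
  (k10 : 0 < k1).

Let bound_mono x y : x <= y -> (c * (p + x) + g) / (b * k1) <= (c * (p + y) + g) / (b * k1).
Proof.
move=> xy; rewrite ler_wpM2r ?invr_ge0 ?mulr_ge0 ?(ltW b0) ?(ltW k10)//.
by rewrite lerD2r ler_wpM2l// lerD2l.
Qed.

Lemma rate_geometric q : 0 < q < 1 ->
  (c * (p + D * (sg * (1 / (1 - q)))) + g) / (b * k1)
  <= (c * (p + sg * (2 * b * G2 * (1 + q) + D) / (1 - q)) + g) / (b * k1).
Proof.
move=> /andP[q0 q1]; apply: bound_mono.
have h : 0 < 1 - q by rewrite subr_gt0.
rewrite div1r !mulrA ler_pM2r ?invr_gt0// [D * sg]mulrC ler_wpM2l// lerDr.
by rewrite !mulr_ge0 ?ler0n ?(ltW b0)// addr_ge0 ?ler01 ?(ltW q0).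
Qed.

Lemma rate_harmonic l : 0 <= l ->
  (c * (p + D * (sg * l)) + g) / (b * k1)
  <= (g + c * (p + 2 * sg * (4 * b * G2 + D) * l)) / (b * k1).
Proof.
move=> l0; rewrite [g + _]addrC; apply: bound_mono.
have h1 : 0 <= sg * (b * G2) * l by rewrite !mulr_ge0 ?(ltW b0).
have h2 : 0 <= D * (sg * l) by rewrite !mulr_ge0.
have -> : 2 * sg * (4 * b * G2 + D) * l = 8 * (sg * (b * G2) * l) + 2 * (D * (sg * l)) by ring.
by rewrite ler_wpDl ?(mulr_ge0 _ h1)// ler_peMl// ler1n.
Qed.

Lemma rate_sublinear a : 0 < a -> a < 1 ->
  (c * (p + D * (sg * (k1 `^ (1 - a) / (1 - a)))) + g) / (b * k1)
  <= sg * c * (6 * G2 + D) / (b * (1 - a) * k1 `^ a) + (c * p + g) / (b * k1).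
Proof.
move=> a0 a1; have h : 0 < 1 - a by rewrite subr_gt0.
have y0 : 0 < k1 `^ a by exact: powR_gt0.
have kn : k1 != 0 by rewrite gt_eqF.
have -> : k1 `^ (1 - a) = k1 / k1 `^ a.
  by rewrite powRD ?kn ?implybT// powRr1 ?(ltW k10)// powRN.
have -> : (c * (p + D * (sg * (k1 / k1 `^ a / (1 - a)))) + g) / (b * k1)
    = sg * c * D / (b * (1 - a) * k1 `^ a) + (c * p + g) / (b * k1).
  by field; rewrite kn !gt_eqF.
rewrite lerD2r ler_wpM2r ?invr_ge0 ?mulr_ge0 ?(ltW b0) ?(ltW h) ?(ltW y0)//.
by rewrite ler_wpM2l ?mulr_ge0// lerDr mulr_ge0 ?ler0n.
Qed.

Lemma rate_superlinear a : 1 < a ->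
  (c * (p + D * (sg * (a / (a - 1)))) + g) / (b * k1)
  <= sg * c * (3 * G2 * a + G2 + a * D / b) / ((a - 1) * k1) + (c * p + g) / (b * k1).
Proof.
move=> a1; have h : 0 < a - 1 by rewrite subr_gt0.
have -> : (c * (p + D * (sg * (a / (a - 1)))) + g) / (b * k1)
    = sg * c * (a * D / b) / ((a - 1) * k1) + (c * p + g) / (b * k1).
  by field; rewrite !gt_eqF.
rewrite lerD2r ler_wpM2r ?invr_ge0 ?mulr_ge0 ?(ltW k10) ?(ltW h)//.
have a0 : 0 <= a by rewrite (le_trans ler01)// ltW.
by rewrite ler_wpM2l ?mulr_ge0// lerDr addr_ge0// !mulr_ge0 ?ler0n.
Qed.

Lemma rate_constant Q : 0 < Q ->
  (c * (p + D * (sg * (k1 / Q))) + g) / (b * k1)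
  <= c * (sg * (4 * b * G2 + D) / (b * Q)) + (g + c * p) / (b * k1).
Proof.
move=> Q0.
have -> : (c * (p + D * (sg * (k1 / Q))) + g) / (b * k1)
    = c * (sg * D / (b * Q)) + (g + c * p) / (b * k1).
  by field; rewrite !gt_eqF.
rewrite lerD2r ler_wpM2l// ler_wpM2r ?invr_ge0 ?mulr_ge0 ?(ltW b0) ?(ltW Q0)//.
by rewrite ler_wpM2l// lerDr !mulr_ge0 ?ler0n ?(ltW b0).
Qed.

End Rates.

Lemma inv_sample_size {R : realType} (m : nat) (x : R) : 0 < x ->
  m%:Z = Num.ceil x -> m%:R^-1 <= x^-1 :> R.
Proof.
move=> x0 hm; have h : x <= m%:R.
  by rewrite -[m%:R]/((m%:Z)%:~R) hm Num.Theory.ceil_ge.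
by rewrite lef_pV2// posrE (lt_le_trans x0).
Qed.
Theorem theorem2 (R : realType) (n r N : nat) (hr : (0 < r)%N) (hN : (1 < N)%N)
  (* induced arithmetic mean: an arbitrary selection of the argmin *)
  (hat : ('I_N -> 'M[R]_(n, r)) -> 'M[R]_(n, r))
  (hhat : forall X : 'I_N -> 'M[R]_(n, r),
     (forall i, stiefel (X i)) -> is_iam X (hat X))
  (* retraction constant *)
  (M : R) (hM0 : 0 < M)
  (hM : forall X v : 'M[R]_(n, r), stiefel X -> tangent X v ->
     frob (polar_retraction X v - (X + v)) <= M * frob v ^+ 2)
  (* objective *)
  (dX : measure_display) (Xi : 'I_N -> measurableType dX)
  (mu : forall i, probability (Xi i) R)
  (Floss : forall i, 'M[R]_(n, r) -> Xi i -> R)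
  (hFloss : forall i X, (mu i).-integrable setT (EFin \o Floss i X))
  (L : R)
  (hdiff : forall i (X : 'M[R]_(n, r)),
     differentiable (local_obj mu Floss i) X)
  (hLip : forall i (X Y : 'M[R]_(n, r)),
     frob (grad (local_obj mu Floss i) X - grad (local_obj mu Floss i) Y)
       <= L * frob (X - Y))
  (* network *)
  (e : rel 'I_N) (hsym : symmetric e) (hconn : forall i j, connect e i j)
  (W : 'M[R]_N) (hW : mixing_matrix e W)
  (t : nat) (ht1 : (1 <= t)%N)
  (ht : let s2 := (singular_values W)`_1 in
     s2 != 0 ->
     Num.ceil (ln (1 / (2 * Num.sqrt N%:R)) / ln s2) <= t%:Z)
  (* local region *)
  (delta1 delta2 : R) (hd1 : 0 < delta1) (hd2 : 0 < delta2)
  (hd12 : delta1 <= 1 / (5 * Num.sqrt r%:R) * delta2)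
  (hd26 : delta2 <= 1 / 6)
  (Phi : R) (hPhi1 : 1 <= Phi)
  (hPhi : forall X, local_region hat delta1 delta2 X ->
     forall i, Phi <= 2 - frob (X i - hat X) ^+ 2)
  (* stochastic oracle *)
  (G : forall i, 'M[R]_(n, r) -> Xi i -> 'M[R]_(n, r))
  (sigma A1 A2 : R)
  (hG : forall i, stochastic_oracle mu (local_obj mu Floss) G sigma A1 i)
  (hA2 : forall i (X : 'M[R]_(n, r)), stiefel X ->
     frob (grad (local_obj mu Floss i) X) <= A2)
  (* algorithm *)
  (dO : measure_display) (Omega : measurableType dO) (P : probability Omega R)
  (Nk : nat -> nat) (hNk : forall k, (0 < Nk k)%N)
  (xi : forall i : 'I_N, nat -> nat -> Omega -> Xi i)
  (hxi : iid_sampling P mu Nk xi)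
  (X0 : 'I_N -> 'M[R]_(n, r)) (hX0 : local_region hat delta1 delta2 X0)
  (alpha beta : R)
  (X Y : nat -> Omega -> 'I_N -> 'M[R]_(n, r))
  (halg : algorithm1 W t alpha beta G Nk xi X0 X Y) :
  let f := avg_obj (local_obj mu Floss) in
  let fstar := inf (f @` stiefel) in
  let LG := L + 2 * max_grad_norm (local_obj mu Floss) in
  let A := Num.max A1 A2 in
  let s2 := (singular_values W)`_1 in
  let Lt := 1 - (spectrum (W ^+ t))`_N.-1 in
  let rho := Num.sqrt (1 - (alpha * Lt * Phi - alpha ^+ 2 * Lt ^+ 2)) in
  let Gamma0 := 2 / (1 - rho) ^+ 2 in
  let Gamma1 := 2 / (1 - rho ^+ 2) * stack_frob2 (fun i => X0 i - hat X0) in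
  let Gamma2 := 2 / (1 - s2 ^+ t) ^+ 2 in
  let Gamma3 := 2 / (1 - s2 ^+ (2 * t)) * (1 / N%:R *
    fine ('E_P[fun w => stack_frob2 (fun i =>
      Y 0%N w i - avg (batch_grad G Nk xi X 0%N w))]%R)%E) in
  let D1 := (delta1 ^+ 2 + 5) * LG + 2 * M * A in
  let D4 := 4 * r%:R * delta1 ^+ 2 / (beta ^+ 2 * LG) in
  let Ct := delta2 ^+ 2 / r%:R in
  let D2 := 3 * LG + 2 * alpha * A + 13 * LG * Ct * alpha ^+ 2 + D4 in
  let D3 := (1 + 4 * LG ^+ 2 * beta ^+ 2) / (2 * LG) in
  let D3t := D3 + 5 * beta / 8 in
  let C0 := D4 * Gamma0 * alpha ^+ 2 * delta1 ^+ 2 / 25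
            + Gamma1 * (D2 + D4) in
  let C1 := D2 * Gamma0 + D4 * Gamma0 + D1 in
  let Gamma1t := 2 * LG ^+ 2 * beta * Gamma1 in
  let Gamma3t := C0 + beta / 2 *
    (Gamma3 + 16 * alpha ^+ 2 * LG ^+ 2 * Gamma2 * Gamma1) in
  let betabar := Num.min ((1 - rho) * delta1 / (10 * A + LG))
                         (alpha * delta1 / (5 * (10 * A + LG))) in
  let c := 16 + Gamma0 * alpha ^+ 2 * delta1 ^+ 2 in
  let gap := f (hat X0) - fstar in
  let minE K := (\big[mine/+oo]_(k < K.+1)
    'E_P[fun w => frob (rgrad f (hat (X k w))) ^+ 2]%R)%E in
  0 < alpha ->
  alpha <= Num.min 1 (Num.min (1 / M) (Phi / Lt)) ->
  0 < beta ->
  beta <= Num.min betabar (Num.min (1 / (9 * LG))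
    (1 / (4 * (alpha * delta1 * LG * (16 * Gamma0 + Gamma2) + 2 * C1)))) ->
  forall K : nat,
  [/\ (* (i) *)
      forall q : R, 0 < q < 1 ->
        (forall k, (Nk k)%:Z = Num.ceil (q ^- k)) ->
        (minE K <= (
           (c * (gap + Gamma3t
                 + sigma ^+ 2 * (2 * beta * Gamma2 * (1 + q) + D3t) / (1 - q))
            + Gamma1t) / (beta * K.+1%:R))%:E)%E,
      (* (ii) *)
      forall a : R, 0 < a ->
        (forall k, (Nk k)%:Z = Num.ceil (k.+1%:R `^ a)) ->
        [/\ a = 1 ->
            (minE K <= (
               (Gamma1t + c * (gap + Gamma3t
                  + 2 * sigma ^+ 2 * (4 * beta * Gamma2 + D3t)
                    * (ln K.+1%:R + 1))) / (beta * K.+1%:R))%:E)%E,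
            a < 1 ->
            (minE K <= (
               sigma ^+ 2 * c * (6 * Gamma2 + D3t)
                 / (beta * (1 - a) * K.+1%:R `^ a)
               + (c * (gap + Gamma3t) + Gamma1t) / (beta * K.+1%:R))%:E)%E
          & 1 < a ->
            (minE K <= (
               sigma ^+ 2 * c * (3 * Gamma2 * a + Gamma2 + a * D3t / beta)
                 / ((a - 1) * K.+1%:R)
               + (c * (gap + Gamma3t) + Gamma1t) / (beta * K.+1%:R))%:E)%E]
    & (* (iii) *)
      forall Q : nat, (0 < Q)%N -> (forall k, Nk k = Q) ->
        (minE K <= (
           c * (sigma ^+ 2 * (4 * beta * Gamma2 + D3t) / (beta * Q%:R))
           + (Gamma1t + c * (gap + Gamma3t)) / (beta * K.+1%:R))%:E)%E].

Proof.
move=> f fstar LG A s2 Lt rho Gamma0 Gamma1 Gamma2 Gamma3 D1 D4 Ct D2 D3 D3t C0 C1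
  Gamma1t Gamma3t betabar c gap minE a0 ha b0 hb K.
have N0 : (0 < N)%N by exact: ltnW.
have Nr : 0 < N%:R :> R by rewrite ltr0n.
have N2 : 2 <= N%:R :> R by rewrite ler_nat.
pose i0 : 'I_N := Ordinal N0.
have [/andP[s20 s21] hs2] := second_singular hN hsym hconn hW.
rewrite -/s2 in s20 s21 hs2.
have hWd := mixing_dstoch hW; have hP := dstochX t hWd.
have hk (Z : 'I_N -> 'M[R]_(n, r)) : \sum_i Z i = 0 ->
    stack_frob2 (mix (W ^+ t) Z) <= (s2 ^+ t) ^+ 2 * stack_frob2 Z.
  exact: (@mix_contract _ _ _ _ W t s2 Z hWd s20 hs2).
have k2N : N%:R * (s2 ^+ t) ^+ 2 <= 1 / 4.
  by apply: consensus_rate => //; rewrite s20.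
have k20 := sqr_ge0 (s2 ^+ t).
have k28 : (s2 ^+ t) ^+ 2 <= 1 / 8.
  have : 2 * (s2 ^+ t) ^+ 2 <= N%:R * (s2 ^+ t) ^+ 2 by rewrite ler_wpM2r.
  by move=> /le_trans /(_ k2N); move: (s2 ^+ t ^+ 2) => y; clear; lra.
have [hS hd1S hd2S] := hX0.
have [hHS hHmin] := hhat _ hS.
have A20 : 0 <= A2 by rewrite (le_trans (frob_ge0 _) (hA2 i0 _ (hS i0))).
have A0 : 0 <= A by rewrite /A le_max A20 orbT.
have hop := max_grad_norm_bound hr hA2.
have Ln0 := op_bound_ge0 hr (hop i0 _ (hS i0)).
have P2 : Phi <= 2.
  by rewrite (le_trans (hPhi _ hX0 i0))// gerBl sqr_ge0.
have Lt2 : Lt <= 2.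
  have hN1 : (N.-1 < N)%N by rewrite prednK.
  have := dstoch_spectrum_ge (Ordinal hN1) hP.
  by rewrite /Lt /=; move: (_`__) => x; clear; lra.
have rr1 : 1 <= r%:R :> R by rewrite ler1n.
have G20 : 0 <= Gamma2 by rewrite divr_ge0 ?ler0n ?sqr_ge0.
have [[a1 aM LG0] [c1 c3 c4] hbLG [hr1 hr2 hr4]] :=
  step_regime a0 ha b0 hb hM0 A0 hd1 rr1 Lt2 hPhi1 P2 G20.
have d12 : 5 * delta1 <= delta2.
  have sr : 1 <= Num.sqrt (r%:R : R) by rewrite -[leLHS](@sqrtr1 R) ler_wsqrtr.
  have sr0 : 0 < Num.sqrt (r%:R : R) by exact: lt_le_trans sr.
  have : delta1 * (5 * Num.sqrt r%:R) <= delta2.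
    by rewrite -ler_pdivlMr ?mulr_gt0// mulrC -[_^-1]div1r.
  have -> : delta1 * (5 * Num.sqrt r%:R) = 5 * (delta1 * Num.sqrt r%:R) by ring.
  by apply: le_trans; rewrite ler_pM2l// ler_peMr// ltW.
have hlb := agents_bounded_below hdiff hLip hA2 hHS.
have hFs U : stiefel U -> fstar <= f U.
  by move=> hU; apply: (ge_inf hlb); exists U.
have gap0 : 0 <= gap by rewrite subr_ge0; exact: hFs.
have hexp := expected_bound hN hP hk k20 k28 k2N hM0 hM a0 a1 aM b0 LG0 hd1 d12 hd26
  c1 c3 c4 hdiff hLip Ln0 hop (erefl _) hA2 hhat hX0 hG hNk hxi halg hFs K.
have hTE := tracking_meanE hN hX0 hG hNk hxi halg.
set S0 := msq _ in hexp; set T0 := fine _ in hexp; rewrite -/T0 in hTE.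
have S00 : 0 <= S0 by exact: msq_ge0.
have T00 : 0 <= T0.
  by apply: fine_ge0; apply: expectation_ge0 => w; exact: msq_ge0.
have SE : stack_frob2 (fun i => X0 i - hat X0) = N%:R * S0.
  by rewrite /S0 /msq mulVKf ?gt_eqF.
have hG3 : 2 * T0 <= Gamma3.
  rewrite /Gamma3 hTE div1r mulKf ?gt_eqF// ler_wpM2r//.
  have p1 : s2 ^+ (2 * t) < 1 by rewrite exprn_ilt1// muln_eq0 /= -lt0n.
  by rewrite ler_pdivlMr ?subr_gt0// ger_pMr// gerBl exprn_ge0.
have G10 : 0 <= Gamma1.
  by rewrite /Gamma1 mulr_ge0 ?divr_ge0 ?(ltW hr2) ?stack_frob2_ge0.
have hS1 : S0 / alpha <= Gamma1.
  (* The comparison uses [1 - rho ^+ 2 <= 4 * alpha]; the missing factor 2 comes from [N >= 2]. *)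
  have e1 : S0 / alpha = 4 * S0 * (4 * alpha)^-1 by field; rewrite gt_eqF.
  have e2 : Gamma1 = 2 * (N%:R * S0) * (1 - rho ^+ 2)^-1.
    by rewrite /Gamma1 SE mulrAC.
  have a40 : 0 < 4 * alpha by rewrite mulr_gt0.
  rewrite e1 e2; apply: ler_pM.
  - by rewrite mulr_ge0.
  - by rewrite invr_ge0 ltW.
  - have -> : 4 * S0 = 2 * (2 * S0) by ring.
    by rewrite ler_wpM2l// ler_wpM2r.
  - by rewrite lef_pV2.
have G00 : 0 <= Gamma0 by rewrite divr_ge0 ?sqr_ge0.
have D40 : 0 <= D4.
  exact: (divr_ge0 (mulr_ge0 (mulr_ge0 (ler0n _ 4) (ler0n _ r)) (sqr_ge0 _))
    (mulr_ge0 (sqr_ge0 _) (ltW LG0))).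
have D2LG : 3 * LG <= D2.
  have Ct0 : 0 <= Ct by rewrite divr_ge0 ?sqr_ge0.
  rewrite /D2 -addrA -addrA lerDl; apply: addr_ge0.
    exact: (mulr_ge0 (mulr_ge0 (ler0n _ 2) (ltW a0)) A0).
  apply: addr_ge0 D40.
  exact: (mulr_ge0 (mulr_ge0 (mulr_ge0 (ler0n _ 13) (ltW LG0)) Ct0) (sqr_ge0 _)).
have q0 : 0 <= D4 * Gamma0 * alpha ^+ 2 * delta1 ^+ 2 / 25.
  exact: (divr_ge0 (mulr_ge0 (mulr_ge0 (mulr_ge0 D40 G00) (sqr_ge0 _)) (sqr_ge0 _))
    (ler0n _ 25)).
have hC0 : 3 * LG * Gamma1 <= C0.
  rewrite /C0 ler_wpDl// [leRHS]mulrC ler_wpM2r//.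
  by rewrite ler_wpDr.
have C00 : 0 <= C0.
  by apply: le_trans hC0; exact: (mulr_ge0 (mulr_ge0 (ler0n _ 3) (ltW LG0)) G10).
have E30 : 0 <= 16 * alpha ^+ 2 * LG ^+ 2 * Gamma2 * Gamma1.
  exact: (mulr_ge0 (mulr_ge0 (mulr_ge0 (mulr_ge0 (ler0n _ 16) (sqr_ge0 _)) (sqr_ge0 _))
    G20) G10).
have D3t1 : 1 / (2 * LG) <= D3t.
  have e1 : D3 = 1 / (2 * LG) + 4 * LG ^+ 2 * beta ^+ 2 / (2 * LG).
    by rewrite /D3 mulrDl.
  rewrite /D3t e1 -addrA lerDl; apply: addr_ge0; apply: divr_ge0 => //.
  - exact: (mulr_ge0 (mulr_ge0 (ler0n _ 4) (sqr_ge0 _)) (sqr_ge0 _)).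
  - exact: (mulr_ge0 (ler0n _ 2) (ltW LG0)).
  - exact: (mulr_ge0 (ler0n _ 5) (ltW b0)).
have D3t0 : 0 <= D3t.
  by apply: le_trans D3t1; exact: (divr_ge0 ler01 (mulr_ge0 (ler0n _ 2) (ltW LG0))).
have G1t0 : 0 <= Gamma1t.
  exact: (mulr_ge0 (mulr_ge0 (mulr_ge0 (ler0n _ 2) (sqr_ge0 _)) (ltW b0)) G10).
have c16 : 16 <= c by rewrite /c lerDl; exact: (mulr_ge0 (mulr_ge0 G00 (sqr_ge0 _)) (sqr_ge0 _)).
have c0 : 0 <= c by rewrite (le_trans _ c16).
have sg0 := sqr_ge0 sigma.
have K0 : 0 < K.+1%:R :> R by rewrite ltr0n.
(* From here the sample sizes matter only through the sum of their inverses. *)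
have key s : \sum_(k < K.+1) (Nk k)%:R^-1 <= s ->
   (minE K <= ((c * (gap + Gamma3t + D3t * (sigma ^+ 2 * s)) + Gamma1t)
               / (beta * K.+1%:R))%:E)%E.
  move=> hs.
  have v0 : 0 <= sigma ^+ 2 * \sum_(k < K.+1) (Nk k)%:R^-1.
    by rewrite mulr_ge0// sumr_ge0// => k _; rewrite invr_ge0 ler0n.
  have hcmp := bound_comparison a0 b0 LG0 hbLG hS1 hC0 C00 T00 hG3 E30 gap0 v0 D3t1 G1t0 c16.
  have hsum : (\sum_(k < K.+1) 'E_P[fun w => frob (rgrad f (hat (X k w))) ^+ 2]%R
      <= ((c * (gap + Gamma3t + D3t * (sigma ^+ 2 * s)) + Gamma1t) / beta)%:E)%E.
    apply: (le_trans hexp); rewrite lee_fin; apply: (le_trans hcmp).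
    rewrite ler_wpM2r ?invr_ge0 ?(ltW b0)// lerD2r ler_wpM2l// lerD2l ler_wpM2l//.
    by rewrite ler_wpM2l.
  have he k : (0 <= 'E_P[fun w => frob (rgrad f (hat (X k w))) ^+ 2]%R)%E.
    by apply: expectation_ge0 => w; exact: sqr_ge0.
  by have := bigmin_average he hsum; rewrite -(mulrA _ beta^-1) -invfM.
split.
- move=> q hq hNq.
  have hs : \sum_(k < K.+1) (Nk k)%:R^-1 <= 1 / (1 - q).
    apply: le_trans (geometric_sum_le K.+1 hq); apply: ler_sum => k _.
    have qk : 0 < q ^+ k by rewrite exprn_gt0//; case/andP: hq.
    by rewrite -[leRHS]invrK; apply: inv_sample_size (hNq k); rewrite invr_gt0.
  apply: (le_trans (key _ hs)); rewrite lee_fin; exact: rate_geometric.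
- move=> a ha0 hNa.
  have hN' (k : 'I_K.+1) : (Nk k)%:R^-1 <= (k.+1%:R `^ a)^-1 :> R.
    by apply: inv_sample_size (hNa k); rewrite powR_gt0.
  split=> ha1.
  + have hs : \sum_(k < K.+1) (Nk k)%:R^-1 <= ln K.+1%:R + 1 :> R.
      apply: le_trans (harmonic_sum_le K); apply: ler_sum => k _.
      by have := hN' k; rewrite ha1 powRr1.
    apply: (le_trans (key _ hs)); rewrite lee_fin; apply: rate_harmonic => //.
    by rewrite addr_ge0// ln_ge0// ler1n.
  + have hs := le_trans (ler_sum _ (fun k _ => hN' k)) (power_sum_lt1 K ha0 ha1).
    apply: (le_trans (key _ hs)); rewrite lee_fin; exact: rate_sublinear.
  + have hs := le_trans (ler_sum _ (fun k _ => hN' k)) (power_sum_gt1 K ha1).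
    apply: (le_trans (key _ hs)); rewrite lee_fin; exact: rate_superlinear.
- move=> Q Q0 hQ.
  have hs : \sum_(k < K.+1) (Nk k)%:R^-1 <= K.+1%:R / Q%:R :> R.
    rewrite -[K.+1 in leRHS]card_ord mulr_natl -sumr_const.
    by apply: ler_sum => k _; rewrite hQ.
  apply: (le_trans (key _ hs)); rewrite lee_fin; apply: rate_constant => //.
  by rewrite ltr0n.
Qed.
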